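(* There are absolute constants $C_1>0$ and $C_2$ such that the following holds. Let $n\geq 1$, let $\mathbb{F}$ stand for either $\mathbb{R}$, $\mathbb{C}$ or the quaternions $\mathbb{H}$, and let $E$ be either $\mathcal{M}_n(\mathbb{F})$ or the subspace of $\mathbb{F}$-self-adjoint matrices in $\mathcal{M}_n(\mathbb{F})$. Let $d_n=\dim(E)$, let $B_E$ be the unit ball of the operator norm $\|\cdot\|_{S_\infty^n}$ on $E$, and let $\overline{B_E}=\frac{B_E}{[\mathrm{vol}(B_E)]^{1/d_n}}$ be its homothetic copy of volume $1$. Then $$C_1\;\leq\;\sigma_{B_E}^2:=d_n\,\frac{\mathrm{Var}_{\overline{B_E}}\bigl(\|T\|_{S_2^n}^2\bigr)}{\left(\int_{\overline{B_E}}\|T\|_{S_2^n}^2\,dT\right)^2}\;\leq\;C_2 .$$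
   Context: $\mathcal{M}_n(\mathbb{F})$ is the space of $n\times n$ matrices with entries in $\mathbb{F}$, viewed as a real vector space of dimension $\beta n^2$, where $\beta=\dim_{\mathbb{R}}(\mathbb{F})\in\{1,2,4\}$ for $\mathbb{F}=\mathbb{R},\mathbb{C},\mathbb{H}$ respectively. A matrix $T$ is $\mathbb{F}$-self-adjoint if $T=T^*$ (conjugate transpose with respect to the standard conjugation of $\mathbb{F}$). Dimensions are real dimensions. For $T\in\mathcal{M}_n(\mathbb{F})$, $s_1(T)\geq\cdots\geq s_n(T)$ are the singular values, i.e. the eigenvalues of $(T^*T)^{1/2}$; $\|T\|_{S_2^n}=\bigl(\sum_{i=1}^n s_i(T)^2\bigr)^{1/2}$ is the Hilbert-Schmidt (Frobenius) norm, which is the Euclidean norm on $\mathcal{M}_n(\mathbb{F})$, and $\|T\|_{S_\infty^n}=s_1(T)$ is the operator norm. Volume $\mathrm{vol}$ and integration $dT$ are with respect to Lebesgue measure on $E$ for the Euclidean structure given by $\|\cdot\|_{S_2^n}$. For the set $\overline{B_E}$ of volume $1$ and a function $f$, $\mathrm{Var}_{\overline{B_E}}(f)=\int_{\overline{B_E}}f^2\,dT-\bigl(\int_{\overline{B_E}}f\,dT\bigr)^2$. ''Absolute'' means independent of $n$, $\mathbb{F}$ and $E$. *)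

(* Defs.v *)
From HB Require Import structures.
From mathcomp Require Import all_boot all_order all_algebra all_field.
From mathcomp Require Import all_classical all_reals all_analysis.
From mathcomp.real_closed Require Import complex.
From mathcomp Require Import ring.
Set Implicit Arguments. Unset Strict Implicit. Unset Printing Implicit Defensive.
Import Order.TTheory GRing.Theory Num.Theory.
Local Open Scope classical_set_scope.
Local Open Scope ring_scope.

(* [Rcomplex R] is [R[i]] seen as an algebra over [R] instead of over itself. *)
Section complex_falg.
Variable R : realType.

Let C_vect : Vector.axiom 2 (Rcomplex R).
Proof.
exists (fun z : Rcomplex R => \row_(i < 2) (if i == 0 then complex.Re z else complex.Im z)).
  by move=> a [x y] [x' y']; apply/rowP => i; rewrite !mxE; case: ifP.
exists (fun v : 'rV[R]_2 => (Complex (v 0 0) (v 0 1) : Rcomplex R)).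
  by case=> x y; rewrite !mxE.
move=> v; apply/rowP => i; rewrite mxE /=.
by case: i => [[|[|//]] p] /=; congr (v _ _); apply/val_inj.
Qed.
HB.instance Definition _ := Lmodule_hasFinDim.Build R (Rcomplex R) C_vect.

Let C_scalerAr (a : R) (x y : Rcomplex R) : a *: (x * y) = x * (a *: y).
Proof. by rewrite mulrC scalerAl mulrC. Qed.
HB.instance Definition _ := GRing.Lalgebra_isAlgebra.Build R (Rcomplex R) C_scalerAr.
End complex_falg.

Record quaternion (R : Type) :=
  Quaternion { qre : R; qi : R; qj : R; qk : R }.

Section quaternion_alg.
Variable R : realType.
Local Notation H := (quaternion R).
Implicit Types p q r : H.

Definition prod_of_quat q := (qre q, qi q, qj q, qk q).
Definition quat_of_prod (x : R * R * R * R) :=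
  let: (a, b, c, d) := x in Quaternion a b c d.
Lemma prod_of_quatK : cancel prod_of_quat quat_of_prod.
Proof. by case. Qed.
HB.instance Definition _ := Choice.copy H (can_type prod_of_quatK).

Lemma quatP p q : qre p = qre q -> qi p = qi q -> qj p = qj q -> qk p = qk q ->
  p = q.
Proof. by case: p => ? ? ? ?; case: q => ? ? ? ? /= -> -> -> ->. Qed.

Definition addq p q :=
  Quaternion (qre p + qre q) (qi p + qi q) (qj p + qj q) (qk p + qk q).
Definition oppq q := Quaternion (- qre q) (- qi q) (- qj q) (- qk q).
Definition scaleq (a : R) q :=
  Quaternion (a * qre q) (a * qi q) (a * qj q) (a * qk q).
Definition mulq p q := Quaternion
  (qre p * qre q - qi p * qi q - qj p * qj q - qk p * qk q)
  (qre p * qi q + qi p * qre q + qj p * qk q - qk p * qj q)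
  (qre p * qj q - qi p * qk q + qj p * qre q + qk p * qi q)
  (qre p * qk q + qi p * qj q - qj p * qi q + qk p * qre q).
Definition conjq q := Quaternion (qre q) (- qi q) (- qj q) (- qk q).
Definition q0 : H := Quaternion 0 0 0 0.
Definition q1 : H := Quaternion 1 0 0 0.

Let addqA : associative addq.
Proof. by move=> ? ? ?; apply: quatP => /=; ring. Qed.
Let addqC : commutative addq.
Proof. by move=> ? ?; apply: quatP => /=; ring. Qed.
Let add0q : left_id q0 addq.
Proof. by move=> ?; apply: quatP => /=; ring. Qed.
Let addNq : left_inverse q0 oppq addq.
Proof. by move=> ?; apply: quatP => /=; ring. Qed.
HB.instance Definition _ := GRing.isZmodule.Build H addqA addqC add0q addNq.

Let mulqA : associative mulq.
Proof. by move=> ? ? ?; apply: quatP => /=; ring. Qed.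
Let mul1q : left_id q1 mulq.
Proof. by move=> ?; apply: quatP => /=; ring. Qed.
Let mulq1 : right_id q1 mulq.
Proof. by move=> ?; apply: quatP => /=; ring. Qed.
Let mulqDl : left_distributive mulq addq.
Proof. by move=> ? ? ?; apply: quatP => /=; ring. Qed.
Let mulqDr : right_distributive mulq addq.
Proof. by move=> ? ? ?; apply: quatP => /=; ring. Qed.
Let q1_neq0 : q1 != q0.
Proof. by apply/eqP => -[] /eqP; rewrite oner_eq0. Qed.
HB.instance Definition _ := GRing.Zmodule_isNzRing.Build H
  mulqA mul1q mulq1 mulqDl mulqDr q1_neq0.

Let scaleqA (a b : R) q : scaleq a (scaleq b q) = scaleq (a * b) q.
Proof. by apply: quatP => /=; ring. Qed.
Let scale1q : left_id 1 scaleq.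
Proof. by move=> ?; apply: quatP => /=; ring. Qed.
Let scaleqDr : right_distributive scaleq addq.
Proof. by move=> ? ? ?; apply: quatP => /=; ring. Qed.
Let scaleqDl q : {morph scaleq^~ q : a b / a + b >-> addq a b}.
Proof. by move=> ? ?; apply: quatP => /=; ring. Qed.
HB.instance Definition _ := GRing.Zmodule_isLmodule.Build R H
  scaleqA scale1q scaleqDr scaleqDl.

Let scaleqAl (a : R) p q : a *: (p * q) = (a *: p) * q.
Proof. by apply: quatP => /=; ring. Qed.
HB.instance Definition _ := GRing.Lmodule_isLalgebra.Build R H scaleqAl.
Let scaleqAr (a : R) p q : a *: (p * q) = p * (a *: q).
Proof. by apply: quatP => /=; ring. Qed.
HB.instance Definition _ := GRing.Lalgebra_isAlgebra.Build R H scaleqAr.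

Let quat_vect : Vector.axiom 4 H.
Proof.
exists (fun q => \row_(i < 4) [:: qre q; qi q; qj q; qk q]`_i).
  move=> a p q; apply/rowP => i; rewrite !mxE.
  by case: i => [[|[|[|[|//]]]]].
exists (fun v : 'rV[R]_4 => Quaternion (v 0 0) (v 0 1) (v 0 2) (v 0 3)).
  by move=> q; apply: quatP; rewrite /= mxE.
move=> v; apply/rowP => i; rewrite mxE.
by case: i => [[|[|[|[|//]]]] ?] /=; congr (v _ _); apply/val_inj.
Qed.
HB.instance Definition _ := Lmodule_hasFinDim.Build R H quat_vect.
HB.instance Definition _ := Algebra_isFalgebra.Build R H.

Let conjq_linear : linear (conjq : H -> H).
Proof. by move=> a p q; apply: quatP => /=; ring. Qed.
HB.instance Definition _ :=
  GRing.isLinear.Build R H H _ (conjq : H -> H) conjq_linear.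
End quaternion_alg.

Section lebesgue_tuple.
Variable R : realType.
Local Notation RB := (measurableTypeR R).

Definition consT n (x : RB * n.-tuple RB) : n.+1.-tuple RB :=
  [tuple of x.1 :: x.2].

Lemma measurable_consT n : measurable_fun setT (@consT n).
Proof.
exact: (@measurable_cons _ _ (RB * n.-tuple RB)%type RB fst n snd measurable_fst measurable_snd).
Qed.

Section step.
Variables (n : nat) (m : {sigma_finite_measure set (n.-tuple RB) -> \bar R}).

Definition lebesgue_cons : set (n.+1.-tuple RB) -> \bar R :=
  pushforward (@lebesgue_measure R \x m)%E (@consT n).

Let lebesgue_cons0 : lebesgue_cons set0 = 0%E.
Proof. by rewrite /lebesgue_cons /pushforward preimage_set0 measure0. Qed.

Let lebesgue_cons_ge0 A : (0 <= lebesgue_cons A)%E.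
Proof. exact: (measure_ge0 (@lebesgue_measure R \x m)%E). Qed.

Let lebesgue_cons_sigma_additive : semi_sigma_additive lebesgue_cons.
Proof.
have mcons (A : set (n.+1.-tuple RB)) : measurable A ->
    measurable (@consT n @^-1` A).
  by move=> mA; rewrite -[X in measurable X]setTI; exact: measurable_consT.
move=> F mF tF mUF; rewrite /lebesgue_cons /pushforward preimage_bigcup.
apply: measure_semi_sigma_additive.
- by move=> k; exact: mcons.
- apply/trivIsetP => /= i j _ _ ij; rewrite -preimage_setI.
  by move/trivIsetP : tF => /(_ _ _ _ _ ij) ->//; rewrite preimage_set0.
- by rewrite -preimage_bigcup; exact: mcons.
Qed.

HB.instance Definition _ := isMeasure.Build _ _ _ lebesgue_cons
  lebesgue_cons0 lebesgue_cons_ge0 lebesgue_cons_sigma_additive.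

Let lebesgue_cons_sigma_finite : sigma_finite setT lebesgue_cons.
Proof.
have /sigma_finiteP[F [TF ndF Foo]] := sigma_finiteT (@lebesgue_measure R).
have /sigma_finiteP[G [TG ndG Goo]] := sigma_finiteT m.
pose un (t : n.+1.-tuple RB) : RB * n.-tuple RB :=
  (thead t, [tuple of behead t]).
have consTK : cancel (@consT n) un.
  by case=> a b; rewrite /un /consT theadE; congr pair; apply/val_inj.
have mun : measurable_fun setT un.
  by apply/measurable_fun_pairP; split;
    [exact: measurable_tnth | exact: measurable_behead].
exists (fun k => un @^-1` (F k `*` G k)).
  apply/esym; rewrite -subTset => t _.
  have [i _ Fi] : (\bigcup_k F k) (un t).1 by rewrite -TF.
  have [j _ Gj] : (\bigcup_k G k) (un t).2 by rewrite -TG.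
  exists (maxn i j) => //; split.
  - by move: Fi; apply/subsetPset/ndF/leq_maxl.
  - by move: Gj; apply/subsetPset/ndG/leq_maxr.
move=> k; have [mF Fk] := Foo k; have [mG Gk] := Goo k; split.
  by rewrite -[X in measurable X]setTI; apply: mun => //; exact: measurableX.
rewrite /lebesgue_cons /pushforward -comp_preimage.
have -> : un \o @consT n = id by apply/funext => x /=; rewrite consTK.
rewrite preimage_id product_measure1E//.
by rewrite lte_mul_pinfty// ge0_fin_numE.
Qed.

HB.instance Definition _ :=
  @Measure_isSigmaFinite.Build _ _ _ lebesgue_cons lebesgue_cons_sigma_finite.
End step.

(* Lebesgue measure on R^n, as the n-fold product measure. *)
Fixpoint lebesgue_tuple n : {sigma_finite_measure set (n.-tuple RB) -> \bar R} :=
  match n with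
  | 0 => \d_([tuple] : 0.-tuple RB)
  | n'.+1 => lebesgue_cons (lebesgue_tuple n')
  end.
End lebesgue_tuple.

(* A real algebra with a conjugation and a real part. No law is imposed on these
   two fields: the record only packages the three instances below. *)
Record conjAlg (R : realType) := ConjAlg {
  carrier :> falgType R;
  conjF : {linear carrier -> carrier};
  reF : carrier -> R }.

Section instances.
Variable R : realType.

Definition realAlg : conjAlg R := @ConjAlg R R^o idfun (fun x => x).

Definition complexAlg : conjAlg R :=
  @ConjAlg R (Rcomplex R) (@conjc R : Rcomplex R -> Rcomplex R)
    (fun z => complex.Re z).

Definition quaternionAlg : conjAlg R :=
  @ConjAlg R (quaternion R) (@conjq R) (@qre R).

End instances.

Inductive scalars := RealScalars | ComplexScalars | QuaternionScalars.

Definition scalar_alg (R : realType) (k : scalars) : conjAlg R :=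
  match k with
  | RealScalars => realAlg R
  | ComplexScalars => complexAlg R
  | QuaternionScalars => quaternionAlg R
  end.

(* An alias of ['M[F]_(m, n)] that carries the structure of a vector space over
   [R]; the library makes ['M[F]_(m, n)] a module over [F] only. *)
Definition Mat (R : realType) (F : conjAlg R) (m n : nat) := 'M[F]_(m, n).

Section real_space.
Variables (R : realType) (F : conjAlg R) (m n : nat).
Local Notation M := (Mat F m n).

HB.instance Definition _ := GRing.Zmodule.copy M 'M[F]_(m, n).

Definition scale_Mat (a : R) (T : M) : M := \matrix_(i, j) (a *: T i j).

Let scale_MatA (a b : R) (T : M) :
  scale_Mat a (scale_Mat b T) = scale_Mat (a * b) T.
Proof. by apply/matrixP => i j; rewrite !mxE scalerA. Qed.
Let scale_Mat1 : left_id 1 scale_Mat.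
Proof. by move=> T; apply/matrixP => i j; rewrite mxE scale1r. Qed.
Let scale_MatDr : right_distributive scale_Mat +%R.
Proof. by move=> a T U; apply/matrixP => i j; rewrite !mxE scalerDr. Qed.
Let scale_MatDl (T : M) : {morph scale_Mat^~ T : a b / a + b}.
Proof. by move=> a b; apply/matrixP => i j; rewrite !mxE scalerDl. Qed.
HB.instance Definition _ := GRing.Zmodule_isLmodule.Build R M
  scale_MatA scale_Mat1 scale_MatDr scale_MatDl.

Lemma scale_MatE (a : R) (T : M) i j : (a *: T) i j = a *: T i j.
Proof. by rewrite mxE. Qed.

Import VectorInternalTheory.
Let fT := {ffun 'I_m * 'I_n -> F}.

Let Mat_vect : Vector.axiom (dim fT) M.
Proof.
pose to (T : M) : fT := [ffun ij => T ij.1 ij.2].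
pose from (f : fT) : M := \matrix_(i, j) f (i, j).
have toK : cancel to from by move=> T; apply/matrixP => i j; rewrite mxE ffunE.
have fromK : cancel from to by move=> f; apply/ffunP => -[i j]; rewrite ffunE mxE.
exists (v2r \o to).
  move=> a T U /=; rewrite -linearP; congr v2r; apply/ffunP => ij.
  by rewrite !ffunE mxE scale_MatE.
by exists (from \o r2v) => x /=; rewrite ?v2rK ?toK ?fromK ?r2vK.
Qed.
HB.instance Definition _ := Lmodule_hasFinDim.Build R M Mat_vect.
End real_space.

Section matrices.
Variables (R : realType) (F : conjAlg R).

Definition adj m n (T : Mat F m n) : Mat F n m := (map_mx (@conjF R F) T)^T.

Definition inner m n (T U : Mat F m n) : R := reF (\tr (adj T *m U)).

Section square.
Variable n : nat.
Local Notation M := (Mat F n n).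
Implicit Types (S T : M).

Definition sub_adj T : M := T - adj T.

Let sub_adj_linear : linear sub_adj.
Proof.
move=> a T U; apply/matrixP => i j.
by rewrite !(mxE, scale_MatE) (linearP (conjF F)) scalerBr opprD addrACA.
Qed.
HB.instance Definition _ :=
  GRing.isLinear.Build R M M _ sub_adj sub_adj_linear.

Definition selfadjoint : {vspace M} := lker (linfun sub_adj).

Lemma mem_selfadjoint T : (T \in selfadjoint) = (T == adj T).
Proof. by rewrite memv_ker lfunE /= subr_eq0. Qed.

Definition psd S : Prop :=
  S = adj S /\ forall x : Mat F n 1, 0 <= reF ((adj x *m S *m x) 0 0).

Definition psd_sqrt T : M := xget 0 [set S : M | psd S /\ S *m S = T].

Definition sub_scale S (a : R) (x : Mat F n 1) : Mat F n 1 := S *m x - a *: x.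

Let sub_scale_linear S a : linear (sub_scale S a).
Proof.
move=> c x y; apply/matrixP => i j.
rewrite !(mxE, scale_MatE) scalerBr scalerDr opprD addrACA; congr (_ + _).
  rewrite scaler_sumr -big_split; apply: eq_bigr => k _ /=.
  by rewrite !(mxE, scale_MatE) mulrDr scalerAr.
by rewrite !scalerA mulrC.
Qed.
HB.instance Definition _ S (a : R) :=
  GRing.isLinear.Build R (Mat F n 1) (Mat F n 1) _
    (sub_scale S a) (sub_scale_linear S a).

Definition real_eigenspace S (a : R) : {vspace Mat F n 1} :=
  lker (linfun (sub_scale S a)).

Lemma mem_real_eigenspace S a (x : Mat F n 1) :
  (x \in real_eigenspace S a) = (S *m x == a *: x :> Mat F n 1).
Proof. by rewrite memv_ker lfunE /= subr_eq0. Qed.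

(* The eigenvalues (with multiplicity, in nonincreasing order) of a self-adjoint
   [S]; these are real. The multiplicity of [a] is the dimension over [F] of its
   eigenspace, that is the real dimension divided by [\dim {:F}]. *)
Definition eigenvalues S : n.-tuple R :=
  xget [tuple of nseq n 0]
    [set s : n.-tuple R | sorted >=%R s /\
       forall a : R,
         \dim (real_eigenspace S a) = (\dim {:F} * count_mem a s)%N].

Definition singular_values T : n.-tuple R :=
  eigenvalues (psd_sqrt (adj T *m T)).

Definition hs_norm T : R :=
  Num.sqrt (\sum_(i < n) tnth (singular_values T) i ^+ 2).

Definition op_norm T : R := (singular_values T)`_0.

End square.
End matrices.

Section euclidean_volume.
Variables (R : realType) (V : vectType R) (d : nat) (b : d.-tuple V).

Definition coords (x : d.-tuple (measurableTypeR R)) : V :=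
  \sum_(i < d) (tnth x i : R) *: tnth b i.

(* When [b] is an orthonormal basis of a subspace [E], the map [coords] is an
   isometry from [R^d] onto [E], and the next two definitions are the volume on
   [E] and the integral over a part of [E] with respect to this volume; neither
   depends on the choice of [b]. *)
Definition vol (A : set V) : \bar R := lebesgue_tuple R d (coords @^-1` A).

Definition vol_integral (A : set V) (f : V -> R) : R :=
  \int[lebesgue_tuple R d]_(x in coords @^-1` A) f (coords x).

Definition variance_on (A : set V) (f : V -> R) : R :=
  vol_integral A (fun T => f T ^+ 2) - vol_integral A f ^+ 2.

Definition homothetic1 (A : set V) : set V :=
  [set fine (vol A) `^ (- d%:R^-1) *: T | T in A].

End euclidean_volume.

Section thin_shell.
Variables (R : realType) (F : conjAlg R) (n : nat) (E : {vspace Mat F n n}).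

Definition op_ball : set (Mat F n n) := [set T | T \in E /\ op_norm T <= 1].

Definition orthonormal_basis (b : (\dim E).-tuple (Mat F n n)) : Prop :=
  basis_of E b /\
  forall i j, inner (tnth b i) (tnth b j) = (i == j)%:R.

Definition sigma2 (b : (\dim E).-tuple (Mat F n n)) : R :=
  (\dim E)%:R *
  (variance_on b (homothetic1 b op_ball) (fun T => hs_norm T ^+ 2)
   / vol_integral b (homothetic1 b op_ball) (fun T => hs_norm T ^+ 2) ^+ 2).

End thin_shell.

(* Main.v *)
Require Import Defs.
From HB Require Import structures.
From mathcomp Require Import all_boot all_order all_algebra all_field.
From mathcomp Require Import all_classical all_reals all_analysis.
From mathcomp.real_closed Require Import complex.
From mathcomp Require Import measurable_realfun.
From mathcomp Require Import ring lra zify.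
Set Implicit Arguments. Unset Strict Implicit. Unset Printing Implicit Defensive.
Import Order.TTheory GRing.Theory Num.Theory.
Import numFieldNormedType.Exports.
Local Open Scope classical_set_scope.
Local Open Scope ring_scope.

(** The parameter sigma2 only involves the moments of tr (T* T) over the unit ball of the
    operator norm, and these are governed by integration by parts. Write W = T* T, let
    N be the size of the matrices and beta the real dimension of the scalars; tr denotes the
    real part of the trace.

    A vector field T W^k - T W^(k+1), or T^j - T^(j+2) on self-adjoint matrices, moves each
    singular value (each eigenvalue) u with a velocity that contains the factor 1 - u^2, so
    it is tangent to the boundary of the ball. Hence the divergence of g X integrates to zero
    over the ball for every such field X and every polynomial g (loop_equation,
    matrix_loop_equation). The ball has corners, so this is proved with the cutoffs
    (1 - tr W^p)_+^2, which are supported in the ball and converge to its indicator function.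
    The divergences are polynomials in the traces of powers, because the maps B -> A B C and
    B -> A B* C have the traces beta tr A tr C, for A self-adjoint, and (2 - beta) <A, C>
    (unit_trace_mul, unit_trace_adj). This yields exact linear relations between moments,
    with beta as a parameter, for the three algebras of scalars at once.

    On all matrices three relations suffice (full_identities): they give
    sigma2 = 2 (I1 - J) / I1, where I1 and J are the integrals of tr W and tr W^2, and
    I1 <= 8 (I1 - J), so that 1/4 <= sigma2 <= 2 (full_estimate).

    On self-adjoint matrices the seven relations of selfadjoint_identities relate the
    variance V of tr (T^2) to D, the mean of tr (T^2) - tr (T^4). They bound V from above by a
    multiple of D / N, and D is at most the mean m of tr (T^2), which is of the order of N.
    Read from below, they express V by a difference of positive terms, which is hard to
    control for small N; the lower bound is obtained otherwise. Let delta be the divergence of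
    T - T^3. It has mean 0, covariance -2 D with tr (T^2), and a second moment at most of the
    order of N^2, so the Cauchy-Schwarz inequality gives V >= 4 D^2 / E[delta^2]
    (variance_quadratic_ge0), and D is at least N / 600. As sigma2 is d V / m^2, with the
    dimension d of the order of N^2, both bounds follow (selfadjoint_normalized_estimate).
    Matrices of size 1 are treated directly.

    To apply this, the operator norm has to be related to traces of powers. Over the
    quaternions there is neither a determinant nor a cyclic trace, so the spectral theorem is
    derived from a real polynomial that annihilates a self-adjoint matrix
    (reduced_annihilator, spectral_resolution_exists). It shows that the singular values have
    the power sums tr W^k, that their Euclidean norm is the Euclidean norm of the matrix, and
    that the open ball is the union over k of the sets where tr W^k < 1. Scaling shows that
    the boundary of the ball is negligible and removes the normalization of the volume
    (boundary_null, sigma2E). *)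

(** * Real algebras with a conjugation *)

(** What is used of R, C and H, so that the three cases are treated at once. The list
    onb is the standard basis 1, i, j, k, orthonormal for the form Re (conj x * y). The
    constant 2 - beta of law_anti is, besides the dimension beta itself, all that
    distinguishes the three algebras in the divergences computed below. *)
Record conj_laws (R : realType) (F : conjAlg R) (beta : nat) (onb : seq F) : Prop := ConjLaws {
  law_conjM : forall x y : F, conjF F (x * y) = conjF F y * conjF F x;
  law_conjK : forall x : F, conjF F (conjF F x) = x;
  law_reP : forall (a : R) (x y : F), reF (a *: x + y) = a * reF x + reF y;
  law_re1 : reF (1 : F) = 1;
  law_reC : forall x y : F, reF (x * y) = reF (y * x);
  law_re_conj : forall x : F, reF (conjF F x) = reF x;
  law_add_conj : forall x : F, x + conjF F x = (2 * reF x) *: 1;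
  law_norm_gt0 : forall x : F, x != 0 -> 0 < reF (conjF F x * x);
  law_size : size onb = beta;
  law_dim : \dim {: F} = beta;
  law_unit : forall u : F, u \in onb -> conjF F u * u = 1;
  law_expand : forall x : F, x = \sum_(u <- onb) reF (conjF F u * x) *: u;
  law_anti : forall a c : F,
    \sum_(u <- onb) reF (conjF F u * (a * (conjF F u * c))) = (2 - beta%:R) * reF (conjF F a * c) }.

Lemma real_laws (R : realType) : @conj_laws R (realAlg R) 1 [:: 1].
Proof.
split => //=.
- by move=> x y; rewrite mulrC.
- by move=> x y; rewrite mulrC.
- by move=> x; rewrite -mulr2n /GRing.scale /= mulr1 mulr_natl.
- by move=> x x0; rewrite -expr2 exprn_even_gt0.
- by rewrite dimvf.
- by move=> u; rewrite inE => /eqP ->; rewrite mulr1.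
- by move=> x; rewrite big_seq1 /GRing.scale /= mul1r mulr1.
- by move=> a c; rewrite big_seq1 !mul1r; ring.
Qed.

Lemma complex_laws (R : realType) :
  @conj_laws R (complexAlg R) 2 [:: Complex 1 0; Complex 0 1].
Proof.
have E (x y : R[i]) : complex.Re x = complex.Re y -> complex.Im x = complex.Im y -> x = y.
  by case: x y => [? ?] [? ?] /= -> ->.
split => //=.
- by move=> [a b] [c d]; apply: E => /=; ring.
- by move=> [a b]; apply: E => /=; ring.
- by move=> a [b c] [d e].
- by move=> [a b] [c d] /=; ring.
- by case.
- by move=> [a b]; apply: E => /=; ring.
- move=> [a b] x0 /=.
  have -> : a * a - - b * b = a ^+ 2 + b ^+ 2 by ring.
  rewrite lt_neqAle !addr_ge0 ?sqr_ge0 // andbT eq_sym; apply: contra x0 => /eqP h.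
  have := sqr_ge0 a; have := sqr_ge0 b => b0 a0.
  by apply/eqP; apply: E => /=; apply/eqP; rewrite -sqrf_eq0; apply/eqP; lra.
- by rewrite dimvf.
- move=> u; rewrite !inE => /orP[] /eqP ->; apply: E => /=; ring.
- move=> [a b]; rewrite big_cons big_seq1; apply: E => /=; ring.
- by move=> [a b] [c d]; rewrite big_cons big_seq1 /=; ring.
Qed.

Lemma quaternion_laws (R : realType) : @conj_laws R (quaternionAlg R) 4
  [:: Quaternion 1 0 0 0; Quaternion 0 1 0 0; Quaternion 0 0 1 0; Quaternion 0 0 0 1].
Proof.
split => //=.
- by move=> [? ? ? ?] [? ? ? ?]; apply: quatP => /=; ring.
- by move=> [? ? ? ?]; apply: quatP => /=; ring.
- by move=> [? ? ? ?] [? ? ? ?] /=; ring.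
- by move=> [? ? ? ?]; apply: quatP => /=; ring.
- move=> [a b c d] x0 /=.
  have -> : a * a - - b * b - - c * c - - d * d = a ^+ 2 + b ^+ 2 + c ^+ 2 + d ^+ 2 by ring.
  rewrite lt_neqAle !addr_ge0 ?sqr_ge0 // andbT eq_sym; apply: contra x0 => /eqP h.
  have := sqr_ge0 a; have := sqr_ge0 b; have := sqr_ge0 c; have := sqr_ge0 d.
  move=> d0 c0 b0 a0; apply/eqP; apply: quatP => /=; apply/eqP; rewrite -sqrf_eq0; apply/eqP; lra.
- by rewrite dimvf.
- by move=> u; rewrite !inE => /or4P[] /eqP ->; apply: quatP => /=; ring.
- by move=> [? ? ? ?]; rewrite !big_cons big_nil; apply: quatP => /=; ring.
- by move=> [? ? ? ?] [? ? ? ?]; rewrite !big_cons big_nil /=; ring.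
Qed.

(** Bundling the laws with the algebra allows the linearity of the adjoint, of the real
    trace and of the inner product to be canonical instances, free of hypotheses. *)
Record lawfulAlg (R : realType) := LawfulAlg {
  lawful_alg :> conjAlg R;
  dimF : nat;
  onbF : seq lawful_alg;
  lawfulP : conj_laws dimF onbF }.

Definition lawful_scalars (R : realType) (k : scalars) : lawfulAlg R :=
  match k with
  | RealScalars => LawfulAlg (real_laws R)
  | ComplexScalars => LawfulAlg (complex_laws R)
  | QuaternionScalars => LawfulAlg (quaternion_laws R)
  end.

(** * Matrices over such an algebra as a real algebra *)

Section square_algebra.
Variables (R : realType) (F : conjAlg R) (n : nat).
Local Notation M := (Mat F n.+1 n.+1).
HB.instance Definition _ := GRing.NzRing.copy M 'M[F]_n.+1.

Let scale_mulAl (a : R) (x y : M) : a *: (x * y) = (a *: x) * y.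
Proof.
apply/matrixP => i j; rewrite !(mxE, scale_MatE) scaler_sumr.
by apply: eq_bigr => k _; rewrite scale_MatE scalerAl.
Qed.
HB.instance Definition _ := GRing.Lmodule_isLalgebra.Build R M scale_mulAl.

Let scale_mulAr (a : R) (x y : M) : a *: (x * y) = x * (a *: y).
Proof.
apply/matrixP => i j; rewrite !(mxE, scale_MatE) scaler_sumr.
by apply: eq_bigr => k _; rewrite scale_MatE scalerAr.
Qed.
HB.instance Definition _ := GRing.Lalgebra_isAlgebra.Build R M scale_mulAr.
End square_algebra.

(** Matrix multiplication with its type folded back to Mat, so that rewriting sees the
    real vector space structure on the factors and on the product. *)
Definition mm (R : realType) (F : conjAlg R) m n p (A : Mat F m n) (B : Mat F n p) : Mat F m p :=
  A *m B.
Infix "**" := mm (at level 40, left associativity).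

(** The trace itself is not cyclic over the quaternions; its real part is. *)
Definition rtr (R : realType) (F : conjAlg R) n (T : Mat F n n) : R := reF (\tr T).

Section mat_theory.
Variables (R : realType) (F : lawfulAlg R).
Let HF := lawfulP F.
Implicit Types (m n p q : nat).

Lemma mmE n (A B : Mat F n.+1 n.+1) : A ** B = A * B. Proof. by []. Qed.
Lemma mmA m n p q (A : Mat F m n) (B : Mat F n p) (C : Mat F p q) :
  A ** (B ** C) = A ** B ** C.
Proof. exact: mulmxA. Qed.
Lemma mmDl m n p (A B : Mat F m n) (C : Mat F n p) : (A + B) ** C = A ** C + B ** C.
Proof. exact: mulmxDl. Qed.
Lemma mmDr m n p (A : Mat F m n) (B C : Mat F n p) : A ** (B + C) = A ** B + A ** C.
Proof. exact: mulmxDr. Qed.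
Lemma mmZl m n p a (A : Mat F m n) (B : Mat F n p) : (a *: A) ** B = a *: (A ** B).
Proof.
apply/matrixP => i j; rewrite !(mxE, scale_MatE) scaler_sumr.
by apply: eq_bigr => k _; rewrite scale_MatE scalerAl.
Qed.
Lemma mmZr m n p a (A : Mat F m n) (B : Mat F n p) : A ** (a *: B) = a *: (A ** B).
Proof.
apply/matrixP => i j; rewrite !(mxE, scale_MatE) scaler_sumr.
by apply: eq_bigr => k _; rewrite scale_MatE scalerAr.
Qed.

Lemma mm_sumr m n p I (r : seq I) P (A : Mat F m n) (G : I -> Mat F n p) :
  A ** (\sum_(i <- r | P i) G i) = \sum_(i <- r | P i) A ** G i.
Proof. exact: mulmx_sumr. Qed.
Lemma mm_suml m n p I (r : seq I) P (A : Mat F n p) (G : I -> Mat F m n) :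
  (\sum_(i <- r | P i) G i) ** A = \sum_(i <- r | P i) G i ** A.
Proof. exact: mulmx_suml. Qed.

Lemma adjFE m n (A : Mat F m n) i j : adj A i j = conjF F (A j i).
Proof. by rewrite !mxE. Qed.
Lemma adjFK m n (A : Mat F m n) : adj (adj A) = A.
Proof. by apply/matrixP => i j; rewrite !adjFE (law_conjK HF). Qed.
Lemma adjF_linear m n : linear (@adj R F m n).
Proof. by move=> a A B; apply/matrixP => i j; rewrite !(mxE, scale_MatE) linearP. Qed.
HB.instance Definition _ m n := GRing.isLinear.Build R (Mat F m n) (Mat F n m) _ (@adj R F m n) (@adjF_linear m n).
Lemma adjFD m n (A B : Mat F m n) : adj (A + B) = adj A + adj B. Proof. exact: linearD. Qed.
Lemma adjFB m n (A B : Mat F m n) : adj (A - B) = adj A - adj B. Proof. exact: linearB. Qed.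
Lemma adjFZ m n a (A : Mat F m n) : adj (a *: A) = a *: adj A. Proof. exact: linearZ. Qed.
Lemma adjF_sum m n I (r : seq I) P (G : I -> Mat F m n) :
  adj (\sum_(i <- r | P i) G i) = \sum_(i <- r | P i) adj (G i).
Proof. exact: linear_sum. Qed.
Lemma adjFM m n p (A : Mat F m n) (B : Mat F n p) : adj (A ** B) = adj B ** adj A.
Proof.
apply/matrixP => i j; rewrite adjFE !mxE raddf_sum.
by apply: eq_bigr => k _ /=; rewrite (law_conjM HF) !mxE.
Qed.
Lemma conj1 : conjF F 1 = 1.
Proof. by rewrite -[conjF F 1]mul1r -{1}[1](law_conjK HF) -(law_conjM HF) mul1r (law_conjK HF). Qed.
Lemma adjF1 n : adj (1%:M : Mat F n n) = 1%:M.
Proof. by apply/matrixP => i j; rewrite adjFE !mxE eq_sym raddfMn /= conj1. Qed.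
Lemma adjF_one n : adj (1 : Mat F n.+1 n.+1) = 1. Proof. exact: adjF1. Qed.
Lemma mm1 m n (A : Mat F m n) : A ** 1%:M = A. Proof. exact: mulmx1. Qed.
Lemma m1m m n (A : Mat F m n) : 1%:M ** A = A. Proof. exact: mul1mx. Qed.
Lemma m0m m n p (A : Mat F n p) : (0 : Mat F m n) ** A = 0. Proof. exact: mul0mx. Qed.
Lemma mm0 m n p (A : Mat F m n) : A ** (0 : Mat F n p) = 0. Proof. exact: mulmx0. Qed.

Lemma reD (x y : F) : reF (x + y) = reF x + reF y.
Proof. by rewrite -[x]scale1r (law_reP HF) mul1r scale1r. Qed.
Lemma re0 : reF (0 : F) = 0.
Proof. by apply: (addrI (reF (0:F))); rewrite -reD !addr0. Qed.
Lemma reZ a (x : F) : reF (a *: x) = a * reF x.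
Proof. by rewrite -[a *: x]addr0 (law_reP HF) re0 addr0. Qed.
Lemma re_sum I (r : seq I) P (G : I -> F) : reF (\sum_(i <- r | P i) G i) = \sum_(i <- r | P i) reF (G i).
Proof. by elim/big_rec2: _ => [|i y1 y2 _ <-]; rewrite ?re0 ?reD. Qed.

Lemma rtr_linear n : linear (@rtr R F n : Mat F n n -> R^o).
Proof.
move=> a A B; rewrite /rtr /mxtrace !re_sum scaler_sumr -big_split.
by apply: eq_bigr => i _; rewrite !(mxE, scale_MatE) reD reZ.
Qed.
HB.instance Definition _ n := GRing.isLinear.Build R (Mat F n n) R^o _ (@rtr R F n : Mat F n n -> R^o) (@rtr_linear n).
Lemma rtrB n (A B : Mat F n n) : rtr (A - B) = rtr A - rtr B. Proof. exact: linearB. Qed.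
Lemma rtrZ n a (A : Mat F n n) : rtr (a *: A) = a * rtr A. Proof. exact: linearZ. Qed.
Lemma rtr_sum n I (r : seq I) P (G : I -> Mat F n n) :
  rtr (\sum_(i <- r | P i) G i) = \sum_(i <- r | P i) rtr (G i).
Proof. exact: linear_sum. Qed.
Lemma rtrC m n (A : Mat F m n) (B : Mat F n m) : rtr (A ** B) = rtr (B ** A).
Proof.
rewrite /rtr /mxtrace !re_sum.
under eq_bigr do rewrite mxE re_sum.
under [RHS]eq_bigr do rewrite mxE re_sum.
by rewrite exchange_big; apply: eq_bigr => i _; apply: eq_bigr => j _; rewrite (law_reC HF).
Qed.
Lemma rtr_adj n (A : Mat F n n) : rtr (adj A) = rtr A.
Proof. by rewrite /rtr /mxtrace !re_sum; apply: eq_bigr => i _; rewrite adjFE (law_re_conj HF). Qed.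
Lemma rtr1 n : rtr (1%:M : Mat F n n) = n%:R.
Proof.
rewrite /rtr /mxtrace re_sum; under eq_bigr do rewrite mxE eqxx (law_re1 HF).
by rewrite sumr_const card_ord.
Qed.

Lemma innerE m n (T U : Mat F m n) : inner T U = rtr (adj T ** U).
Proof. by []. Qed.
Lemma innerC m n (T U : Mat F m n) : inner T U = inner U T.
Proof. by rewrite !innerE -rtr_adj adjFM adjFK. Qed.
Lemma inner_linear m n (T : Mat F m n) : linear (inner T : Mat F m n -> R^o).
Proof. by move=> a A B; rewrite !innerE mmDr mmZr linearP. Qed.
HB.instance Definition _ m n (T : Mat F m n) :=
  GRing.isLinear.Build R (Mat F m n) R^o _ (inner T : Mat F m n -> R^o) (inner_linear T).
Lemma innerDr m n (T A B : Mat F m n) : inner T (A + B) = inner T A + inner T B.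
Proof. exact: linearD. Qed.
Lemma innerZr m n a (T A : Mat F m n) : inner T (a *: A) = a * inner T A.
Proof. exact: linearZ. Qed.
Lemma innerZl m n a (T A : Mat F m n) : inner (a *: A) T = a * inner A T.
Proof. by rewrite !(innerC _ T) innerZr. Qed.
Lemma inner_sumr m n (T : Mat F m n) I (r : seq I) P (G : I -> Mat F m n) :
  inner T (\sum_(i <- r | P i) G i) = \sum_(i <- r | P i) inner T (G i).
Proof. exact: linear_sum. Qed.
Lemma inner0r m n (T : Mat F m n) : inner T 0 = 0. Proof. exact: linear0. Qed.
Lemma inner_entries m n (T U : Mat F m n) :
  inner T U = \sum_i \sum_j reF (conjF F (T i j) * U i j).
Proof.
rewrite innerE /rtr /mxtrace re_sum exchange_big; apply: eq_bigr => j _.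
by rewrite mxE re_sum; apply: eq_bigr => i _; rewrite adjFE.
Qed.
Lemma reN_ge0 (x : F) : 0 <= reF (conjF F x * x).
Proof.
have [->|x0] := eqVneq x 0; first by rewrite mulr0 re0.
exact/ltW/(law_norm_gt0 HF).
Qed.
Lemma inner_ge0 m n (T : Mat F m n) : 0 <= inner T T.
Proof. by rewrite inner_entries; do 2!apply: sumr_ge0 => ? _; exact: reN_ge0. Qed.
(** The form is a sum of the positive terms Re (conj t * t) over the entries. *)
Lemma inner_eq0 m n (T : Mat F m n) : inner T T = 0 -> T = 0.
Proof.
rewrite inner_entries => /eqP; rewrite psumr_eq0; last first.
  by move=> i _; apply: sumr_ge0 => j _; exact: reN_ge0.
move=> /allP h; apply/matrixP => i j; rewrite mxE.
have /= := h i (mem_index_enum _); rewrite psumr_eq0; last by move=> ? _; exact: reN_ge0.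
move=> /allP /(_ j (mem_index_enum _)) /= /eqP Tij; apply/eqP; apply: contraT => /(law_norm_gt0 HF).
by rewrite Tij ltxx.
Qed.

End mat_theory.

(** * Real polynomials that annihilate a self-adjoint matrix *)

(** A complex root of p is either real, which gives a linear factor, or it gives
    together with its conjugate the quadratic factor. *)
Lemma real_factor (R : realType) (p : {poly R}) : (1 < size p)%N ->
  (exists a q, p = ('X - a%:P) * q) \/
  (exists a b q, b != 0 /\ p = (('X - a%:P) ^+ 2 + (b ^+ 2)%:P) * q).
Proof.
move=> p1; pose f := real_complex R.
have /closed_rootP [[a b]] : size (map_poly f p) != 1%N.
  by rewrite size_map_poly; case: (size p) p1 => [|[]].
move=> rz; have [b0|b0] := eqVneq b 0.
  left; exists a; exists (p %/ ('X - a%:P)); rewrite mulrC divpK // dvdp_XsubCl.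
  by rewrite -(fmorph_root f) /= /f b0 in rz *.
right; set d := ('X - a%:P) ^+ 2 + (b ^+ 2)%:P.
have sd : size d = 3%N.
  rewrite /d size_polyDl size_exp_XsubC //= (leq_ltn_trans (size_polyC_leq1 _)) //.
exists a, b, (p %/ d); split => //; rewrite mulrC divpK //.
have d0 : d != 0 by rewrite -size_poly_eq0 sd.
set r := p %% d; suff r0 : r = 0 by rewrite /dvdp -/r r0.
have sr : (size r <= 2)%N by rewrite -ltnS -sd ltn_modp.
have rr : root (map_poly f r) (Complex a b).
  move: rz; rewrite (divp_eq p d) -/r rmorphD rmorphM /= !rootE !hornerE.
  suff -> : (map_poly f d).[Complex a b] = 0 by rewrite mulr0 add0r.
  rewrite /d rmorphD rmorphXn rmorphB /= map_polyX !map_polyC /= !hornerE /f /=.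
  by rewrite /real_complex_def; simpc; rewrite expr2; simpc; congr Complex; ring.
have re : r = (r`_0)%:P + r`_1 *: 'X.
  apply/polyP => i; rewrite !coefE; case: i => [|[|i]] /=; rewrite ?mulr0 ?mulr1 ?addr0 ?add0r //.
  by rewrite nth_default // (leq_trans sr).
move: rr; rewrite re rootE rmorphD /= map_polyZ map_polyX map_polyC /= !hornerE /f /=.
rewrite /real_complex_def; simpc => /eqP [] h1 /eqP; rewrite mulf_eq0 (negPf b0) orbF => /eqP r1.
by move: h1; rewrite r1 mul0r addr0 => ->; rewrite scale0r addr0.
Qed.

Section spectral.
Variables (R : realType) (F : lawfulAlg R).
Variable n : nat.
Local Notation M := (Mat F n.+1 n.+1).
Implicit Types (S : M) (p q : {poly R}).

(** The powers of S lie in a finite-dimensional real space, hence are linearly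
    dependent. This does not refer to the characteristic polynomial, which is not
    available over H. *)
Lemma annihilator S : exists p, p != 0 /\ horner_alg S p = 0.
Proof.
pose N := \dim {: M}; pose X := [tuple S ^+ i | i < N.+1].
have : ~~ free X.
  apply/negP; rewrite /free size_tuple => /eqP h.
  by have := dimvS (subvf <<X>>); rewrite h ltnn.
move=> /negP nf.
have [k [kX [i ki]]] : exists k : 'I_N.+1 -> R, \sum_i k i *: X`_i = 0 /\ exists i, k i != 0.
  apply: contrapT => nk; apply: nf; apply/freeP => k kX i; apply/eqP/negPn/negP => ki.
  by apply: nk; exists k; split => //; exists i.
exists (\poly_(i < N.+1) k (inord i)); split.
  apply: contraNneq ki => /polyP /(_ i); rewrite coef_poly ltn_ord inord_val coef0 => ->.
  by [].
rewrite poly_def rmorph_sum /= -[RHS]kX; apply: eq_bigr => j _.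
rewrite inord_val linearZ /= rmorphXn /= horner_algX.
by rewrite -(tnth_nth 0 X j) tnth_mktuple -scalerAl mul1r.
Qed.

(** <S Y, S Y> = <Y, S (S Y)>. *)
Lemma sq_ker S (Y : M) : S = adj S -> S * (S * Y) = 0 -> S * Y = 0.
Proof.
move=> Ss h; apply: inner_eq0; rewrite (innerE (S * Y)) -[S * Y]/(S ** Y) adjFM -Ss.
by rewrite -mmA !mmE h -mmE mm0 linear0.
Qed.

Lemma adjF_XsubC S a : S = adj S -> S - a%:A = adj (S - a%:A).
Proof. by move=> Ss; rewrite adjFB adjFZ -Ss adjF_one. Qed.

Lemma ev_XsubC S a : horner_alg S ('X - a%:P) = S - a%:A.
Proof. by rewrite rmorphB /= horner_algX horner_algC. Qed.

Lemma ev_comm S p q : horner_alg S p * horner_alg S q = horner_alg S q * horner_alg S p.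
Proof. by rewrite -!rmorphM mulrC. Qed.

(** For self-adjoint S a factor (X - a)^2 + b^2 can be dropped, because <Y, ((S - a)^2 +
    b^2) Y> >= b^2 <Y, Y>, and a repeated linear factor can be dropped by sq_ker. The
    extra factor C is what makes the induction on p work: factors already treated are
    moved into it. *)
Lemma reduced_annihilator S (C : M) p : S = adj S -> p != 0 ->
  horner_alg S p * C = 0 ->
  exists rs : seq R, uniq rs /\ horner_alg S (\prod_(a <- rs) ('X - a%:P)) * C = 0.
Proof.
move=> Ss; have [N] := ubnP (size p); elim: N p C => // N IH p C sN p0 pC.
have [s1|s1] := leqP (size p) 1.
  have sp : size p = 1%N by apply/eqP; rewrite eqn_leq s1 lt0n size_poly_eq0.
  exists [::]; split => //; rewrite big_nil rmorph1 mul1r.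
  have [c c0 pE] := size_poly1P _ (introT eqP sp).
  move: pC; rewrite pE horner_algC -scalerAl mul1r => /eqP; rewrite scaler_eq0 (negPf c0) /=.
  by move/eqP.
have [[a [q pE]]|[a [b [q [b0 pE]]]]] := real_factor s1.
  have q0 : q != 0 by apply: contraNneq p0 => q0; rewrite pE q0 mulr0.
  have sq : (size q < N)%N by move: sN; rewrite pE size_proper_mul ?lead_coefXsubC ?mul1r ?lead_coef_eq0 // size_XsubC.
  have [|rs [urs hrs]] := IH q (horner_alg S ('X - a%:P) * C) sq q0.
    by rewrite mulrA ev_comm -rmorphM -pE.
  have [ars|ars] := boolP (a \in rs); last first.
    exists (a :: rs); split; rewrite /= ?ars // big_cons rmorphM /= -mulrA.
    by rewrite mulrA ev_comm -mulrA.
  exists rs; split=> //; move: hrs; rewrite (bigD1_seq a) //= rmorphM /= -mulrA.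
  set Q := \prod_(i <- rs | _) _; rewrite -mulrA (mulrA _ (horner_alg S ('X - a%:P)) C) -ev_comm -mulrA.
  rewrite ev_XsubC; exact/sq_ker/adjF_XsubC.
have q0 : q != 0 by apply: contraNneq p0 => q0; rewrite pE q0 mulr0.
set d := ('X - a%:P) ^+ 2 + (b ^+ 2)%:P in pE.
have sd : size d = 3%N.
  rewrite /d size_polyDl size_exp_XsubC //= (leq_ltn_trans (size_polyC_leq1 _)) //.
have sq : (size q < N)%N.
  have d0 : d != 0 by rewrite -size_poly_eq0 sd.
  by move: sN; rewrite pE size_mul // sd ltnS => /ltnW; apply: leq_trans.
have [|rs [urs hrs]] := IH q (horner_alg S d * C) sq q0.
  by rewrite mulrA ev_comm -rmorphM -pE.
exists rs; split=> //; move: hrs; rewrite mulrA ev_comm -mulrA.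
set Y := _ * C; rewrite /d rmorphD rmorphXn /= ev_XsubC horner_algC mulrDl -scalerAl mul1r.
set T := S - a%:A => hY.
have : inner Y (T ^+ 2 * Y + b ^+ 2 *: Y) = 0 by rewrite hY linear0.
have Ts : T = adj T by exact: adjF_XsubC.
have TTY : inner Y (T * (T * Y)) = inner (T * Y) (T * Y).
  by rewrite !innerE -!mmE adjFM -Ts mmA.
rewrite innerDr innerZr expr2 -mulrA TTY => /eqP.
rewrite paddr_eq0 ?inner_ge0 // => [/andP[_]|]; last by rewrite mulr_ge0 ?sqr_ge0 // inner_ge0.
rewrite mulf_eq0 sqrf_eq0 (negPf b0) /= => /eqP; exact: inner_eq0.
Qed.

End spectral.

(** * Self-adjoint projections *)

Section projections.
Variables (R : realType) (F : lawfulAlg R).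

Lemma conj_fixed_real (z : F) : conjF F z = z -> z = reF z *: 1.
Proof.
move=> zz; have := law_add_conj (lawfulP F) z; rewrite zz -mulr2n -scaler_nat -scalerA.
by apply: scalerI; rewrite pnatr_eq0.
Qed.

Lemma adjM_col m (x : Mat F m 1) : adj x ** x = inner x x *: (1%:M : Mat F 1 1).
Proof.
have E : (adj x ** x) 0 0 = inner x x *: 1.
  rewrite [LHS]conj_fixed_real ?innerE /rtr /mxtrace ?big_ord_recl ?big_ord0 ?addr0 //.
  by rewrite -adjFE adjFM adjFK.
by apply/matrixP => i j; rewrite !ord1 E scale_MatE mxE.
Qed.

Lemma mm_row_adj n a b (x : Mat F n a) (X : Mat F n b) :
  (row_mx x X : Mat F n (a + b)) ** adj (row_mx x X : Mat F n (a + b)) = x ** adj x + X ** adj X.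
Proof. rewrite /mm /adj map_row_mx tr_row_mx; exact: mul_row_col. Qed.

Lemma mm_adj_row n a b (x : Mat F n a) (X : Mat F n b) :
  adj (row_mx x X : Mat F n (a + b)) ** (row_mx x X : Mat F n (a + b)) =
  block_mx (adj x ** x) (adj x ** X) (adj X ** x) (adj X ** X).
Proof. rewrite /mm /adj map_row_mx tr_row_mx; exact: mul_col_row. Qed.

(** Induction on an integer bound for the real trace of P. A nonzero column of P,
    normalized, is a unit vector x with P x = x, and P - x x* is again a projection, of
    real trace smaller by one. The number m of columns plays the role of the rank over
    F: it shows that the real trace of a projection is an integer, also over the
    quaternions. *)
Lemma proj_factor n (P : Mat F n n) : P = adj P -> P ** P = P ->
  exists m (X : Mat F n m), adj X ** X = 1%:M /\ X ** adj X = P.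
Proof.
have [N] : exists N : nat, rtr P < N%:R.
  by exists (Num.truncn (rtr P)).+1; exact: truncnS_gt.
elim: N P => [|N IH] P ltN Pa PP.
  by have := inner_ge0 P; rewrite innerE -Pa PP leNgt ltN.
have [->|/eqP P0] := eqVneq P 0.
  exists 0%N, 0; split; first by apply/matrixP => -[].
  by rewrite m0m.
have [j xn0] : exists j, (col j P : Mat F n 1) != 0.
  apply: contrapT => /forallNP h; apply: P0; apply/matrixP => i j.
  by have /negP/negPn/eqP/matrixP/(_ i 0) := h j; rewrite !mxE.
set x0 : Mat F n 1 := col j P in xn0.
have Px0 : P ** x0 = x0.
  by rewrite /x0 colE -[P *m _]/(P ** (delta_mx j 0 : Mat F n 1)) mmA PP.
have c0 : 0 < inner x0 x0.
  rewrite lt_neqAle inner_ge0 andbT eq_sym; apply: contraNneq xn0 => /inner_eq0 ->.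
  exact: eqxx.
pose x := (Num.sqrt (inner x0 x0))^-1 *: x0.
have Px : P ** x = x by rewrite mmZr Px0.
have xP : adj x ** P = adj x by rewrite Pa -adjFM Px.
have xx : adj x ** x = 1%:M.
  rewrite adjM_col innerZl innerZr mulrA -invfM -expr2 sqr_sqrtr ?ltW // mulVf ?gt_eqF //.
  by rewrite scale1r.
pose Q := x ** adj x.
have PQ : P ** Q = Q by rewrite mmA Px.
have QP : Q ** P = Q by rewrite -mmA xP.
have QQ : Q ** Q = Q by rewrite /Q mmA -(mmA x) xx mm1.
have mmN m1 m2 m3 (A : Mat F m1 m2) (B : Mat F m2 m3) : A ** (- B) = - (A ** B) by exact: mulmxN.
have mNm m1 m2 m3 (A : Mat F m1 m2) (B : Mat F m2 m3) : (- A) ** B = - (A ** B) by exact: mulNmx.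
have [||//|m [X [XX XXP]]] := IH (P - Q).
- by rewrite rtrB /Q rtrC xx rtr1 ltrBlDr -natr1 in ltN *.
- by rewrite adjFB -Pa /Q adjFM adjFK.
- by rewrite mmDr !mmDl !mmN !mNm PP PQ QP QQ subrr addr0.
have xX : adj x ** X = 0.
  rewrite -[X]mm1 -XX !mmA -(mmA (adj x)) XXP mmDr mmN xP /Q mmA xx m1m subrr.
  by rewrite m0m.
exists (1 + m)%N, (row_mx x X); split; last first.
  by rewrite mm_row_adj XXP addrC subrK.
rewrite mm_adj_row xx xX XX -[adj X ** x]adjFK adjFM adjFK xX linear0.
by rewrite [RHS]scalar_mx_block.
Qed.

Lemma dim_Mat m n : \dim {: Mat F m n} = (m * n * dimF F)%N.
Proof.
rewrite -(law_dim (lawfulP F)) !dimvf.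
transitivity (#|{: 'I_m * 'I_n}| * dim F)%N; last by rewrite card_prod !card_ord.
by [].
Qed.
End projections.

(** * Spectral resolution of a self-adjoint matrix *)

Section eigen.
Variables (R : realType) (F : lawfulAlg R) (n : nat).
Local Notation M := (Mat F n.+1 n.+1).
Implicit Types (S T : M) (p q : {poly R}).
Local Notation ev := horner_alg.

Lemma adjF_exp S k : S = adj S -> adj (S ^+ k) = S ^+ k.
Proof.
move=> Ss; elim: k => [|k IH]; first by rewrite expr0 adjF_one.
by rewrite exprS -mmE adjFM -Ss IH mmE -exprSr exprS.
Qed.

Lemma adjF_ev S p : S = adj S -> adj (ev S p) = ev S p.
Proof.
move=> Ss; elim/poly_ind: p => [|p c IH]; first by rewrite rmorph0 linear0.
rewrite rmorphD rmorphM /= horner_algX horner_algC adjFD -mmE adjFM IH -Ss mmE adjFZ adjF_one.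
by have SP := ev_comm S p (polyX R); rewrite horner_algX in SP; congr (_ + _); exact: esym SP.
Qed.

(** The spectral theorem: P a is the projection onto the eigenspace of a. The list rs
    may contain numbers that are not eigenvalues, for which P a = 0. *)
Record spectral_resolution S (rs : seq R) (P : R -> M) : Prop := SpectralResolution {
  res_uniq : uniq rs;
  res_ev : forall p, ev S p = \sum_(a <- rs) p.[a] *: P a;
  res_adj : forall a, adj (P a) = P a;
  res_idem : forall a, a \in rs -> P a ** P a = P a;
  res_orth : forall a b, a \in rs -> b \in rs -> a != b -> P a ** P b = 0 }.

(** P a is the Lagrange interpolation polynomial at a, evaluated at S. A polynomial that
    vanishes on rs is a multiple of the annihilator of S, so that every law reduces to
    an equality of values at the points of rs. *)
Lemma spectral_resolution_exists S : S = adj S ->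
  exists rs P, spectral_resolution S rs P.
Proof.
move=> Ss; have [p [p0 pS]] := annihilator S.
have [|rs [urs hrs]] := @reduced_annihilator _ _ _ _ 1 _ Ss p0; first by rewrite mulr1.
rewrite mulr1 in hrs.
have van q : {in rs, forall a, q.[a] = 0} -> ev S q = 0.
  move=> qrs; have /dvdpP[d ->] : \prod_(a <- rs) ('X - a%:P) %| q.
    apply: uniq_roots_dvdp; last by rewrite uniq_rootsE.
    by apply/allP => a /qrs ars; apply/rootP.
  by rewrite rmorphM /= hrs mulr0.
pose l a := \prod_(b <- rs | b != a) ((a - b)^-1 *: ('X - b%:P)).
have lE a b : a \in rs -> b \in rs -> (l a).[b] = (a == b)%:R.
  move=> ar br; rewrite /l horner_prod; have [<-|ab] := eqVneq a b.
    rewrite big1_seq // => c /andP[ca _]; rewrite hornerZ hornerXsubC mulVf //.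
    by rewrite subr_eq0 eq_sym.
  apply/eqP; rewrite prodf_seq_eq0; apply/hasP; exists b => //.
  by rewrite eq_sym ab hornerZ hornerXsubC subrr mulr0 /=.
exists rs, (fun a => ev S (l a)); split => //.
- move=> q; apply/eqP; rewrite -subr_eq0; apply/eqP.
  transitivity (ev S (q - \sum_(a <- rs) q.[a] *: l a)).
    rewrite rmorphB rmorph_sum /=; congr (_ - _); apply: eq_bigr => a _.
    by rewrite linearZ /= mulr_algl.
  apply: van => b br; rewrite hornerD hornerN horner_sum (bigD1_seq b) //= hornerZ lE // eqxx mulr1.
  rewrite big1_seq ?addr0 ?subrr // => a /andP[ab ar].
  by rewrite hornerZ lE // (negPf ab) mulr0.
- by move=> a; exact: adjF_ev.
- move=> a ar; rewrite mmE -rmorphM; apply/eqP; rewrite -subr_eq0 -rmorphB; apply/eqP.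
  apply: van => b br; rewrite !hornerE lE //.
  by case: eqVneq => _; rewrite ?mulr1 ?mulr0 ?subrr // subr0.
- move=> a b ar br ab; rewrite mmE -rmorphM; apply: van => c cr; rewrite !hornerE !lE //.
  have [<-|] := eqVneq a c; last by rewrite mul0r.
  by rewrite eq_sym (negPf ab) mulr0.
Qed.

Section resolution.
Variables (S : M) (rs : seq R) (P : R -> M).
Hypothesis res : spectral_resolution S rs P.

Lemma res_one : \sum_(a <- rs) P a = 1.
Proof.
have := res_ev res 1; rewrite rmorph1 => ->; apply: eq_bigr => a _.
by rewrite hornerC scale1r.
Qed.

Lemma ev_res p a : a \in rs -> ev S p ** P a = p.[a] *: P a.
Proof.
move=> ar; rewrite mmE (res_ev res) mulr_suml (bigD1_seq a) ?(res_uniq res) //=.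
rewrite -scalerAl -mmE (res_idem res) // big1_seq ?addr0 // => b /andP[ba br].
by rewrite -scalerAl -mmE (res_orth res) // scaler0.
Qed.

Lemma res_ev_comm p a : a \in rs -> P a ** ev S p = p.[a] *: P a.
Proof.
move=> ar; rewrite mmE (res_ev res) mulr_sumr (bigD1_seq a) ?(res_uniq res) //=.
rewrite -scalerAr -mmE (res_idem res) // big1_seq ?addr0 // => b /andP[ba br].
by rewrite -scalerAr -mmE (res_orth res) // ?scaler0 // eq_sym.
Qed.

Lemma res_mul_l a : a \in rs -> S ** P a = a *: P a.
Proof. by move=> ar; rewrite -{1}(horner_algX S) ev_res // hornerX. Qed.
Lemma res_mul_r a : a \in rs -> P a ** S = a *: P a.
Proof. by move=> ar; rewrite -{1}(horner_algX S) res_ev_comm // hornerX. Qed.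

Lemma eigenvector_res a (x : Mat F n.+1 1) : S ** x = a *: x ->
  x = if a \in rs then P a ** x else 0.
Proof.
move=> Sx; have Pb b : b \in rs -> b != a -> P b ** x = 0.
  move=> br ba; have : P b ** (S ** x) = P b ** (a *: x) by rewrite Sx.
  rewrite mmA res_mul_r // mmZl mmZr => /eqP; rewrite -subr_eq0 -scalerBl scaler_eq0.
  by rewrite subr_eq0 (negPf ba) => /eqP.
rewrite -[LHS]m1m -[1%:M]res_one /mm mulmx_suml; case: ifP => ar.
  rewrite (bigD1_seq a) ?(res_uniq res) //= big1_seq ?addr0 // => b /andP[ba br].
  exact: Pb.
rewrite big1_seq // => b br; apply: Pb => //.
by apply: contraFneq ar => <-.
Qed.

(** Write P a = X X* with X* X = 1, by proj_factor. Multiplication by X is an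
    isomorphism from the columns of height m onto the eigenspace of a, which thus has
    real dimension beta m, where m is the real trace of P a. *)
Lemma res_multiplicity a : exists m : nat,
  (a \in rs -> rtr (P a) = m%:R) /\ \dim (real_eigenspace S a) = (\dim {: F} * m)%N /\ (a \notin rs -> m = 0%N).
Proof.
have [ar|ar] := boolP (a \in rs); last first.
  exists 0%N; split=> //; split=> //; rewrite muln0; apply/eqP; rewrite dimv_eq0 -subv0.
  apply/subvP => x; rewrite mem_real_eigenspace => /eqP /eigenvector_res.
  by rewrite (negPf ar) => ->; rewrite mem0v.
have [m [X [XX XXP]]] := proj_factor (esym (res_adj res a)) (res_idem res ar).
exists m; split; first by rewrite -XXP rtrC XX rtr1.
split=> //.
have mX_lin : linear (fun c : Mat F m 1 => X ** c : Mat F n.+1 1).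
  by move=> k x y; rewrite mmDr mmZr.
pose mXc := GRing.isLinear.Build R (Mat F m 1) (Mat F n.+1 1) _ _ mX_lin.
pose mX : {linear Mat F m 1 -> Mat F n.+1 1} := HB.pack (fun c : Mat F m 1 => X ** c : Mat F n.+1 1) mXc.
have -> : real_eigenspace S a = (linfun mX @: fullv)%VS.
  apply/vspaceP => x; rewrite mem_real_eigenspace; apply/eqP/idP.
    move=> /eigenvector_res; rewrite ar -XXP -mmA => ->.
    have := memv_img (linfun mX) (memvf (adj X ** x)); by rewrite lfunE.
  move=> /memv_imgP [c _ ->]; rewrite lfunE /=.
  have -> : X ** c = P a ** (X ** c) by rewrite -XXP -mmA (mmA (adj X)) XX m1m.
  by rewrite -[LHS]/(S ** (P a ** (X ** c))) mmA res_mul_l // mmZl.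
rewrite limg_dim_eq ?dim_Mat ?(law_dim (lawfulP F)) ?muln1 1?mulnC //.
apply/eqP; rewrite -subv0; apply/subvP => c; rewrite memv_cap memv_ker lfunE /= => /andP[_ /eqP Xc].
by rewrite memv0 -[c]m1m -XX -mmA Xc mm0.
Qed.

End resolution.

End eigen.

(** * Eigenvalues, singular values and the operator norm *)

Lemma re_entry (R : realType) (F : lawfulAlg R) (A : Mat F 1 1) : reF (A 0 0) = rtr A.
Proof. by rewrite /rtr /mxtrace big_ord_recl big_ord0 addr0. Qed.

Section singular.
Variables (R : realType) (F : lawfulAlg R) (n : nat).
Local Notation M := (Mat F n.+1 n.+1).
Implicit Types (S T : M) (p q : {poly R}).
Local Notation ev := horner_alg.

Let beta_gt0 : (0 < \dim {: F})%N.
Proof.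
rewrite lt0n dimv_eq0; apply/negP => /eqP h.
by have := memvf (1 : F); rewrite h memv0 oner_eq0.
Qed.

(** Repeat each point of rs according to its multiplicity. The list has the right length
    because the multiplicities add up to the real trace of 1. *)
Lemma eigenvalues_exist S : S = adj S ->
  exists s : n.+1.-tuple R, [/\ sorted >=%R s,
       forall a, \dim (real_eigenspace S a) = (\dim {: F} * count_mem a s)%N
     & forall p, rtr (ev S p) = \sum_(x <- s) p.[x] ].
Proof.
move=> Ss; have [rs [P res]] := spectral_resolution_exists Ss.
have [m mP] := boolp.choice (res_multiplicity res).
pose s0 := flatten [seq nseq (m a) a | a <- rs].
have sumE (G : R -> R) : \sum_(x <- s0) G x = \sum_(a <- rs) (m a)%:R * G a.
  rewrite /s0 big_flatten big_map; apply: eq_bigr => a _.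
  by rewrite big_nseq iter_addr_0 mulr_natl.
have evE p : rtr (ev S p) = \sum_(x <- s0) p.[x].
  rewrite sumE (res_ev res) rtr_sum; apply: eq_big_seq => a ar.
  by have [/(_ ar) h _] := mP a; rewrite rtrZ h mulrC.
have sz : size (sort >=%R s0) == n.+1.
  have := evE 1; rewrite rmorph1 [LHS]rtr1 size_sort -(eqr_nat R) => ->.
  under eq_bigr do rewrite hornerC.
  by rewrite big_const_seq count_predT iter_addr_0.
exists (Tuple sz); split => /=.
- by apply: sort_sorted => x y; exact: le_total.
- move=> a; have [_ [-> h]] := mP a; congr (_ * _)%N.
  rewrite (permP (permEl (perm_sort _ _))) /s0 count_flatten -map_comp sumnE big_map.
  have [ar|ar] := boolP (a \in rs); last first.
    rewrite h // big1_seq // => b /andP[_ br] /=; rewrite count_nseq /=.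
    by rewrite (_ : (b == a) = false) ?mul0n //; apply: contraNF ar => /eqP <-.
  rewrite (bigD1_seq a) ?(res_uniq res) //= count_nseq /= eqxx mul1n.
  by rewrite big1 ?addn0 // => b ba; rewrite count_nseq /= (negPf ba).
- by move=> p; rewrite evE; apply: perm_big; rewrite perm_sym perm_sort.
Qed.

(** The dimensions of the eigenspaces determine the list up to order, so symmetric sums
    do not depend on the list that the choice operator returns. *)
Lemma eigenvaluesP S : S = adj S ->
  sorted >=%R (eigenvalues S) /\
  forall p, rtr (ev S p) = \sum_(x <- eigenvalues S) p.[x].
Proof.
move=> /eigenvalues_exist [s [ss sd sp]].
have : exists t : n.+1.-tuple R, sorted >=%R t /\ forall a : R,
   \dim (real_eigenspace S a) = (\dim {:F} * count_mem a t)%N by exists s.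
move=> /(xgetPex [tuple of nseq n.+1 0]) [es ed]; split=> // p.
rewrite sp; apply: perm_big; apply/allP => a _ /=; apply/eqP.
by apply/eqP; rewrite -(eqn_pmul2l beta_gt0) -sd -ed.
Qed.

Lemma eigenvalues_dim S (a : R) : S = adj S -> a \in eigenvalues S ->
  (0 < \dim (real_eigenspace S a))%N.
Proof.
move=> /eigenvalues_exist [s [ss sd sp]].
have : exists t : n.+1.-tuple R, sorted >=%R t /\ forall a : R,
   \dim (real_eigenspace S a) = (\dim {:F} * count_mem a t)%N by exists s.
move=> /(xgetPex [tuple of nseq n.+1 0]) [es ed] ae.
by rewrite ed muln_gt0 beta_gt0 -has_count has_pred1.
Qed.

Lemma psd_eigenvalues_ge0 S a : psd S -> a \in eigenvalues S -> 0 <= a.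
Proof.
move=> [Ss Sp] /(eigenvalues_dim Ss) d0.
pose x : Mat F n.+1 1 := vpick (real_eigenspace S a).
have x0 : x != 0 by rewrite vpick0 -dimv_eq0 -lt0n.
have Sx : S ** x = a *: x by apply/eqP; rewrite -mem_real_eigenspace memv_pick.
have := Sp x; rewrite -mulmxA -[S *m x]/(S ** x) Sx.
rewrite re_entry -[adj x *m _]/(adj x ** (a *: x)) mmZr rtrZ -innerE.
have : 0 < inner x x.
  by rewrite lt_neqAle inner_ge0 andbT eq_sym; apply: contraNneq x0 => /inner_eq0 ->; exact: eqxx.
by move=> h; rewrite pmulr_lge0.
Qed.

Lemma gram_adj T : adj T ** T = adj (adj T ** T).
Proof. by rewrite adjFM adjFK. Qed.

(** If a < 0 then P a = 0, because <T P a, T P a> = a <P a, P a>. So the square roots of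
    the points of the spectrum of T* T define a positive square root. *)
Lemma psd_sqrt_exists T : exists S : M, psd S /\ S *m S = adj T ** T.
Proof.
set W := adj T ** T.
have [rs [P res]] := spectral_resolution_exists (gram_adj T).
have Pneg a : a \in rs -> a < 0 -> P a = 0.
  move=> ar a0; apply: inner_eq0; apply/eqP.
  have : inner (T ** P a) (T ** P a) = a * inner (P a) (P a).
    by rewrite !innerE adjFM -mmA (mmA (adj T)) (res_mul_l res ar) mmZr rtrZ.
  have := inner_ge0 (T ** P a); have := inner_ge0 (P a).
  by rewrite le_eqVlt => /predU1P[<- //|p0 t0 te]; move: t0; rewrite te nmulr_rge0 // leNgt p0.
have sqr a : a \in rs -> (Num.sqrt a) ^+ 2 *: P a = a *: P a.
  move=> ar; have [a0|a0] := leP 0 a; first by rewrite sqr_sqrtr.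
  by rewrite Pneg // !scaler0.
exists (\sum_(a <- rs) Num.sqrt a *: P a); split; last first.
  rewrite -[LHS]/((\sum_(a <- rs) Num.sqrt a *: P a) * (\sum_(a <- rs) Num.sqrt a *: P a)).
  rewrite -[RHS](horner_algX W) (res_ev res) mulr_suml; apply: eq_big_seq => a ar.
  rewrite mulr_sumr (bigD1_seq a) ?(res_uniq res) //= -scalerAl -scalerAr scalerA -mmE.
  rewrite (res_idem res) // -expr2 sqr // hornerX big1_seq ?addr0 // => b /andP[ba br].
  by rewrite -scalerAl -scalerAr -mmE (res_orth res) ?scaler0 // eq_sym.
split; first by rewrite adjF_sum; apply: eq_bigr => a _; rewrite adjFZ (res_adj res).
move=> x; rewrite re_entry -[_ *m x]/(adj x ** (\sum_(a <- rs) Num.sqrt a *: P a) ** x).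
rewrite mm_sumr mm_suml rtr_sum big_seq; apply/sumr_ge0 => a ar.
rewrite mmZr mmZl rtrZ mulr_ge0 ?sqrtr_ge0 //.
rewrite -(res_idem res ar) -{1}(res_adj res a) mmA -(mmA _ (P a)) -adjFM -innerE.
exact: inner_ge0.
Qed.

(** The later arguments use the singular values only through these power sums, which are
    polynomials in the entries of T. *)
Lemma singular_valuesP T : [/\ sorted >=%R (singular_values T),
  {in singular_values T, forall x, 0 <= x} &
  forall k, rtr ((adj T ** T : M) ^+ k) = \sum_(x <- singular_values T) x ^+ (2 * k)].
Proof.
have [ps SS] := xgetPex 0 (psd_sqrt_exists T).
have [es ep] := eigenvaluesP (proj1 ps).
split=> //; first by move=> x; exact: psd_eigenvalues_ge0.
move=> k; rewrite /singular_values -SS.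
have -> : psd_sqrt (adj T ** T) *m psd_sqrt (adj T ** T) = psd_sqrt (adj T ** T) ^+ 2 by rewrite expr2.
have := ep ('X^(2 * k)); rewrite rmorphXn /= horner_algX exprM => ->.
by apply: eq_bigr => x _; rewrite hornerXn.
Qed.

Lemma hs_normE T : hs_norm T ^+ 2 = inner T T.
Proof.
have [_ _ /(_ 1%N)] := singular_valuesP T; rewrite expr1 -innerE => ->.
rewrite sqr_sqrtr; last by apply: sumr_ge0 => i _; exact: sqr_ge0.
by rewrite big_tuple.
Qed.

Lemma op_norm_mem T : op_norm T \in singular_values T.
Proof. by apply: mem_nth; rewrite size_tuple. Qed.

Lemma op_norm_max T x : x \in singular_values T -> x <= op_norm T.
Proof.
move=> xs; have {xs} : x \in tval (singular_values T) := xs.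
have [+ _ _] := singular_valuesP T; rewrite /op_norm; move: (tval (singular_values T)) => -[|a s] //=.
rewrite path_sortedE; last by move=> y1 y2 y3 h1 h2; exact: le_trans h2 h1.
by move=> /andP[/allP h _]; rewrite inE => /predU1P[->|/h].
Qed.

Lemma op_norm_ge0 T : 0 <= op_norm T.
Proof. by have [_ h _] := singular_valuesP T; exact/h/op_norm_mem. Qed.

Lemma op_norm_pow_le T k : op_norm T ^+ (2 * k) <= rtr ((adj T ** T : M) ^+ k).
Proof.
have [_ h ->] := singular_valuesP T.
rewrite (big_rem (op_norm T)) ?op_norm_mem //= lerDl big_seq; apply/sumr_ge0 => x /mem_rem xs.
exact/exprn_ge0/h.
Qed.

Lemma op_norm_pow_ge T k : rtr ((adj T ** T : M) ^+ k) <= n.+1%:R * op_norm T ^+ (2 * k).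
Proof.
have [_ h ->] := singular_valuesP T.
have -> : n.+1%:R * op_norm T ^+ (2 * k) = \sum_(x <- singular_values T) op_norm T ^+ (2 * k).
  by rewrite big_const_seq count_predT size_tuple iter_addr_0 mulr_natl.
rewrite big_seq [leRHS]big_seq; apply: ler_sum => x xs.
by rewrite lerXn2r ?nnegrE ?op_norm_ge0 ?op_norm_max ?h.
Qed.

Lemma expr_small (x e : R) : 0 <= x < 1 -> 0 < e -> exists k : nat, x ^+ k < e.
Proof.
move=> /andP[x0 x1] e0; have : (fun k => x ^+ k) @ \oo --> (0 : R).
  by apply: cvg_expr; rewrite ger0_norm.
move=> /cvgrPdist_lt /(_ e e0) [N _ /(_ N (leqnn N))] /=.
by rewrite sub0r normrN ger0_norm ?exprn_ge0 //; exists N.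
Qed.

(** The real trace of (T* T)^k lies between s^(2k) and n.+1 s^(2k), where s is the
    largest singular value. Both unit balls are therefore given by polynomial
    inequalities. *)
Lemma op_norm_le1 T : op_norm T <= 1 <-> forall k, rtr ((adj T ** T : M) ^+ k) <= n.+1%:R.
Proof.
split=> [T1 k|h].
  apply: (le_trans (op_norm_pow_ge T k)); rewrite ler_piMr //.
  by rewrite exprn_ile1 ?op_norm_ge0.
rewrite leNgt; apply/negP => T1.
have T0 : 0 < op_norm T by rewrite (lt_trans _ T1).
have [|//|k] := @expr_small (op_norm T)^-1 n.+1%:R^-1; rewrite ?invr_gt0 ?ltr0n //.
  by rewrite invr_ge0 ltW //= invf_lt1.
rewrite exprVn ltf_pV2 ?posrE ?exprn_gt0 ?ltr0n // ltNge => /negP; apply.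
apply: le_trans (h k); apply: le_trans (op_norm_pow_le T k).
by rewrite ler_eXn2l // leq_pmull.
Qed.

(** In this form the open ball is the union of the sublevel sets of the traces of (T*
    T)^k, which serve as cutoffs in the integration by parts. *)
Lemma op_norm_lt1 T : op_norm T < 1 <-> exists k, rtr ((adj T ** T : M) ^+ k) < 1.
Proof.
split=> [T1|[k]].
  have [|//|k hk] := @expr_small (op_norm T) n.+1%:R^-1; rewrite ?invr_gt0 ?ltr0n ?op_norm_ge0 //.
  exists k; apply: (le_lt_trans (op_norm_pow_ge T k)).
  rewrite -ltr_pdivlMl ?ltr0n // mulr1; apply: le_lt_trans hk.
  by rewrite ler_wiXn2l ?op_norm_ge0 ?ltW // leq_pmull.
rewrite !ltNge; apply: contra => T1; apply: le_trans (op_norm_pow_le T k).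
by rewrite exprn_ege1.
Qed.

End singular.

(** * Scaling of the Lebesgue measure on tuples *)

Section scaling.
Variable R : realType.
Local Notation RB := (measurableTypeR R).
Local Notation lam := (@lebesgue_measure R).
Local Notation mu := (lebesgue_tuple R).

Lemma measurable_scale1 (r : R) : measurable_fun setT (fun t : RB => r * t : RB).
Proof. exact: mulrl_measurable. Qed.

Section one.
Variable r : R.
Hypothesis r0 : 0 < r.

Definition scaled_lebesgue : set RB -> \bar R :=
  mscale (NngNum (ltW r0))
    (measure_function_pushforward__canonical__measure_function_Measure lam (measurable_scale1 r)).
HB.instance Definition _ := Measure.on scaled_lebesgue.

Lemma scaled_lebesgueE (A : set RB) : measurable A -> lam A = scaled_lebesgue A.
Proof.
apply: lebesgue_measure_unique => X [[a b] _ <-] /=.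
transitivity (r%:E * lam (`](a / r)%R, (b / r)%R]%classic : set R))%E; last first.
  congr (_ * lam _)%E; apply/seteqP; split => t /=; rewrite !in_itv /=.
    by rewrite ltr_pdivrMr // ler_pdivlMr // mulrC.
  by rewrite ltr_pdivrMr // ler_pdivlMr // mulrC.
rewrite !lebesgue_measure_itv /= !lte_fin ltr_pM2r ?invr_gt0 //.
case: ifP => _; last by rewrite mule0.
by rewrite -!EFinB -EFinM; congr _%:E; field; rewrite gt_eqF.
Qed.

Lemma ge0_integral_scale1 (g : RB -> \bar R) : measurable_fun setT g ->
  (forall t, (0 <= g t)%E) ->
  (\int[lam]_t g t = r%:E * \int[lam]_t g (r * t)%R)%E.
Proof.
move=> mg g0.
transitivity (\int[scaled_lebesgue]_t g t)%E.
  apply: eq_measure_integral => A mA _; exact: scaled_lebesgueE.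
rewrite ge0_integral_mscale //.
by rewrite ge0_integral_pushforward //; exact: measurable_scale1.
Qed.
End one.

Lemma integral_lebesgue_cons n (g : n.+1.-tuple RB -> \bar R) : measurable_fun setT g ->
  (forall t, (0 <= g t)%E) ->
  (\int[mu n.+1]_t g t = \int[lam]_t \int[mu n]_x g (consT (t, x)))%E.
Proof.
move=> mg g0; transitivity (\int[(lam \x mu n)]_z g (consT z))%E.
  rewrite -[RHS](ge0_integral_pushforward (@measurable_consT R n) _ measurableT) //.
rewrite fubini_tonelli1 //.
by apply: measurableT_comp => //; exact: measurable_consT.
Qed.

Definition scaleT n (r : R) (x : n.-tuple RB) : n.-tuple RB := [tuple r * tnth x i | i < n].

Lemma measurable_scaleT n r : measurable_fun setT (@scaleT n r).
Proof.
apply/measurable_fun_tnthP => i; rewrite [X in measurable_fun _ X](_ : _ = fun x => r * tnth x i).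
  by apply: (measurableT_comp (measurable_scale1 r)); exact: measurable_tnth.
by apply/funext => x /=; rewrite tnth_mktuple.
Qed.

Lemma scaleT_cons n r t (x : n.-tuple RB) : scaleT r (consT (t, x)) = consT (r * t, scaleT r x).
Proof.
apply: eq_from_tnth => i; rewrite tnth_mktuple /consT /=.
by case: (unliftP ord0 i) => [j ->|->]; rewrite ?tnthS ?tnth0 ?tnth_mktuple.
Qed.

(** One coordinate at a time, by the Tonelli theorem. *)
Lemma ge0_integral_scaleT n (r : R) (g : n.-tuple RB -> \bar R) : 0 < r ->
  measurable_fun setT g -> (forall t, (0 <= g t)%E) ->
  (\int[mu n]_x g x = (r ^+ n)%:E * \int[mu n]_x g (scaleT r x))%E.
Proof.
move=> r0; elim: n g => [|n IH] g mg g0.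
  rewrite mul1e; apply: eq_integral => x _; congr g; apply: eq_from_tnth; by case.
have mg' t : measurable_fun setT (fun x => g (consT (t, x))).
  by apply: (measurableT_comp mg); apply: (measurableT_comp (@measurable_consT R n)).
rewrite integral_lebesgue_cons // (ge0_integral_scale1 r0); last 2 first.
- apply: (measurable_fun_fubini_tonelli_F (g \o @consT R n)); last by move=> x; exact: g0.
  by apply: (measurableT_comp mg); exact: measurable_consT.
- by move=> t; exact: integral_ge0.
rewrite integral_lebesgue_cons; last 2 first.
- by apply: (measurableT_comp mg); exact: measurable_scaleT.
- by [].
under eq_integral => t _ do rewrite IH //.
rewrite ge0_integralZl //; last 3 first.
- pose h z := g (consT (r * z.1, scaleT r z.2)).
  apply: (measurable_fun_fubini_tonelli_F h); last by move=> x; exact: g0.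
  apply: (measurableT_comp mg); apply: (measurableT_comp (@measurable_consT R n)).
  apply/measurable_fun_pairP; split => /=.
    by apply: (measurableT_comp (measurable_scale1 r)); exact: measurable_fst.
  by apply: (measurableT_comp (@measurable_scaleT n r)); exact: measurable_snd.
- by move=> t _; exact: integral_ge0.
- by rewrite lee_fin exprn_ge0 // ltW.
rewrite muleA -EFinM -exprS; congr (_ * _)%E; apply: eq_integral => t _.
by apply: eq_integral => x _; rewrite scaleT_cons.
Qed.

End scaling.

(** * Partial derivatives integrate to zero *)

Section boxes.
Variable R : realType.
Local Notation RB := (measurableTypeR R).
Local Notation lam := (@lebesgue_measure R).
Local Notation mu := (lebesgue_tuple R).

Lemma integrable_bounded_support d (T : measurableType d) (m : {measure set T -> \bar R})
  (B : set T) (f : T -> R) (C : R) : measurable B -> (m B < +oo)%E ->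
  measurable_fun setT f -> (forall x, `|f x| <= C) -> (forall x, ~ B x -> f x = 0) ->
  m.-integrable setT (EFin \o f).
Proof.
move=> mB Bfin mf fC f0; have -> : EFin \o f = (EFin \o f) \_ B.
  by apply/funext => x; rewrite patchE; case: ifPn => // /negP; rewrite inE => /f0 /= ->.
apply/(integrable_mkcond _ mB).1.
apply: measurable_bounded_integrable => //; first exact: measurable_funTS.
by exists C; split; rewrite ?num_real // => y Cy x _; apply: le_trans (ltW Cy).
Qed.

Definition box n (M : R) : set (n.-tuple RB) := [set x | forall i, `|tnth x i| <= M].
Arguments box : clear implicits.

Lemma measurable_box n M : measurable (box n M).
Proof.
have -> : box n M = \bigcap_(i in [set: 'I_n]) (fun x : n.-tuple RB => tnth x i) @^-1` `[- M, M]%classic.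
  apply/seteqP; split => x /= h i; first by move=> _; rewrite /preimage /= in_itv /= -ler_norml.
  by have := h i Logic.I; rewrite /= in_itv /= -ler_norml.
apply: fin_bigcap_measurable => [|i _]; first exact: finite_finset.
by rewrite -[X in measurable X]setTI; apply: (measurable_tnth i) => //; exact: measurable_itv.
Qed.

Lemma consT_box n M : @consT R n @^-1` (box n.+1 M) = `[- M, M]%classic `*` box n M.
Proof.
apply/seteqP; split => -[t x] /= h.
  split; first by rewrite in_itv /= -ler_norml; have := h ord0; rewrite tnth0.
  by move=> i; have := h (lift ord0 i); rewrite tnthS.
move: h => [ht hx] i; case: (unliftP ord0 i) => [j ->|->].
  by rewrite tnthS; exact: hx.
by rewrite tnth0; move: ht; rewrite in_itv /= -ler_norml.
Qed.

Lemma mu_box n M : 0 <= M -> mu n (box n M) = ((2 * M) ^+ n)%:E.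
Proof.
move=> M0; elim: n => [|n IH].
  by rewrite /= diracE mem_set // => -[].
transitivity ((lam \x mu n)%E (@consT R n @^-1` (box n.+1 M))); first by [].
rewrite consT_box product_measure1E ?IH; [|exact: measurable_itv|exact: measurable_box].
rewrite [X in (X * _)%E]lebesgue_measure_itv /= lte_fin.
case: ltP => h; first by rewrite -EFinB -EFinM exprS; congr (_ * _)%:E; ring.
by rewrite mul0e (_ : M = 0) ?mulr0 ?expr0n //; lra.
Qed.

(** On this class of functions every integrability condition is automatic. *)
Definition boxfun n M (f : n.-tuple RB -> R) := [/\ measurable_fun setT f,
  exists C, forall x, `|f x| <= C & forall x, ~ box n M x -> f x = 0].

Lemma mu_box_fin n M : (mu n (box n M) < +oo)%E.
Proof.
have [M0|M0] := leP 0 M; first by rewrite mu_box // ltry.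
apply: (@le_lt_trans _ _ (mu n (box n 0))); last by rewrite mu_box // ltry.
apply: le_measure; rewrite ?inE; try exact: measurable_box.
by move=> x h i; apply: le_trans (h i) (ltW M0).
Qed.

Lemma boxfun_integrable n M f : @boxfun n M f -> (mu n).-integrable setT (EFin \o f).
Proof.
move=> [mf [C fC] f0]; apply: (@integrable_bounded_support _ _ _ (box n M) _ C) => //.
  exact: measurable_box.
exact: mu_box_fin.
Qed.

Lemma boxfun_integrable_cons n M f : @boxfun n.+1 M f ->
  (lam \x mu n)%E.-integrable setT (EFin \o f \o @consT R n).
Proof.
move=> [mf [C fC] f0].
apply: (@integrable_bounded_support _ _ _ (@consT R n @^-1` box n.+1 M) (f \o @consT R n) C).
- rewrite -[X in measurable X]setTI; apply: measurable_consT => //; exact: measurable_box.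
- exact: (@mu_box_fin n.+1 M).
- by apply: (measurableT_comp mf); exact: measurable_consT.
- by move=> x; exact: fC.
- by move=> x; exact: f0.
Qed.

Lemma integral_boxfun_cons n M f : @boxfun n.+1 M f ->
  (\int[mu n.+1]_x (f x)%:E = \int[(lam \x mu n)]_z (f (consT z))%:E)%E.
Proof.
move=> bf; have [mf _ _] := bf.
rewrite -[RHS](@integral_pushforward _ _ _ _ _ _ (@measurable_consT R n) (lam \x mu n)%E setT (EFin \o f)) //.
  exact/measurable_EFinP.
exact: boxfun_integrable_cons bf.
Qed.

Lemma integral_deriv_box (f g : R -> R) (M : R) : (forall t : R, is_derive t (1 : R) f (g t)) ->
  continuous g -> (forall t, M < `|t| -> f t = 0) -> (forall t, M < `|t| -> g t = 0) ->
  (\int[lam]_t (g t)%:E = 0)%E.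
Proof.
move=> dfg cg f0 g0; pose b : R := `|M| + 1.
have b0 : 0 < b by rewrite ltr_wpDl.
have Mb : M < b by rewrite ltr_pwDr // ler_norm.
have -> : (\int[lam]_t (g t)%:E = \int[lam]_(t in `[(- b)%R, b]) (g t)%:E)%E.
  rewrite [RHS]integral_mkcond; apply: eq_integral => t _; rewrite patchE; case: ifPn => // /negP.
  rewrite inE /= in_itv /= -ler_norml => /negP; rewrite -ltNge => bt.
  by rewrite g0 // (lt_trans Mb).
have cf : continuous f.
  by move=> t; apply/differentiable_continuous/derivable1_diffP; have [] := dfg t.
rewrite (@continuous_FTC2 _ g f) //.
- rewrite !f0 ?subee // ?normrN gtr0_norm //.
- by rewrite gtrN.
- exact: continuous_subspaceT.
- split.
  + by move=> t _; have [] := dfg t.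
  + exact/cvg_at_right_filter/cf.
  + exact/cvg_at_left_filter/cf.
- by move=> t _; rewrite derive1E; have [_ ->] := dfg t.
Qed.

Definition upd n (x : n.-tuple RB) (i : 'I_n) (t : R) : n.-tuple RB :=
  [tuple if j == i then t else tnth x j | j < n].

Lemma upd_cons0 n s (x : n.-tuple RB) t : upd (consT (s, x)) ord0 t = consT (t, x).
Proof.
apply: eq_from_tnth => j; rewrite tnth_mktuple.
by case: (unliftP ord0 j) => [k ->|->]; rewrite ?tnthS ?tnth0.
Qed.

Lemma upd_consS n s (x : n.-tuple RB) i t :
  upd (consT (s, x)) (lift ord0 i) t = consT (s, upd x i t).
Proof.
apply: eq_from_tnth => j; rewrite tnth_mktuple.
case: (unliftP ord0 j) => [k ->|->]; rewrite ?tnthS ?tnth0 //.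
by rewrite tnth_mktuple (inj_eq lift_inj).
Qed.

(** By the Fubini theorem it suffices to integrate over the i-th coordinate, where the
    fundamental theorem of calculus applies. Only regularity along the lines in that
    direction is needed. *)
Lemma integral_partial_derivative n (i : 'I_n) (f g : n.-tuple RB -> R) M :
  boxfun M g -> (forall x, ~ box n M x -> f x = 0) ->
  (forall x (t : R), is_derive t (1 : R) (fun s => f (upd x i s)) (g (upd x i t))) ->
  (forall x, continuous (fun t => g (upd x i t))) ->
  (\int[mu n]_x (g x)%:E = 0)%E.
Proof.
elim: n i f g => [[] //|n IH] i f g bg f0 dfg cg.
have [mg [C gC] g0] := bg.
rewrite (integral_boxfun_cons bg).
have ig := boxfun_integrable_cons bg.
case: (unliftP ord0 i) => [j ij|i0].
  rewrite -(integral12_prod_meas1 ig) /fubini_F; apply: integral0_eq => t _.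
  apply: (IH j (fun x => f (consT (t, x)))).
  - split; last by move=> x h; apply: g0; apply: contra_not h => h k;
      have := h (lift ord0 k); rewrite tnthS.
    + apply: (measurableT_comp mg); apply: (measurableT_comp (@measurable_consT R n)).
      exact: pair1_measurable.
    + by exists C => x; exact: gC.
  - by move=> x h; apply: f0; apply: contra_not h => h k; have := h (lift ord0 k); rewrite tnthS.
  - move=> x s; have := dfg (consT (t, x)) s; rewrite ij upd_consS.
    by under eq_fun do rewrite upd_consS.
  - by move=> x; have := cg (consT (t, x)); rewrite ij; under eq_fun do rewrite upd_consS.
rewrite -(integral21_prod_meas1 ig) /fubini_G; apply: integral0_eq => x _.
apply: (@integral_deriv_box (fun t => f (consT (t, x))) _ M).
- move=> t; have := dfg (consT (0, x)) t; rewrite i0 upd_cons0.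
  by under eq_fun do rewrite upd_cons0.
- by have := cg (consT (0, x)); rewrite i0; under eq_fun do rewrite upd_cons0.
- move=> t Mt; apply: f0 => /(_ ord0); rewrite tnth0 => h.
  by move: Mt; rewrite ltNge h.
- move=> t Mt; apply: g0 => /(_ ord0); rewrite tnth0 => h.
  by move: Mt; rewrite ltNge h.
Qed.

End boxes.
Arguments box {R} n M.

(** * Polynomial functions on a vector space *)

Section polyfun.
Variables (R : realType) (V : vectType R).

(** Polynomial functions together with their derivatives: Df v B is the derivative of f
    at v in the direction B. This syntactic presentation turns measurability,
    boundedness on boxes and regularity along lines into immediate inductions, without
    differential calculus in several variables. *)
Inductive polyfun : (V -> R) -> (V -> V -> R) -> Prop :=
| polyfun_cst c : polyfun (fun=> c) (fun _ _ => 0)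
| polyfun_lin (phi : {linear V -> R^o}) : polyfun phi (fun _ B => phi B)
| polyfun_add f Df g Dg : polyfun f Df -> polyfun g Dg ->
    polyfun (fun v => f v + g v) (fun v B => Df v B + Dg v B)
| polyfun_mul f Df g Dg : polyfun f Df -> polyfun g Dg ->
    polyfun (fun v => f v * g v) (fun v B => Df v B * g v + f v * Dg v B).

Lemma eq_polyfun f Df g Dg : f =1 g -> (forall v, Df v =1 Dg v) -> polyfun f Df -> polyfun g Dg.
Proof.
move=> /funext -> h; suff -> : Df = Dg by [].
by apply/funext => v; apply/funext.
Qed.

Lemma polyfun_scale a f Df : polyfun f Df -> polyfun (fun v => a * f v) (fun v B => a * Df v B).
Proof.
move=> pf; apply: eq_polyfun (polyfun_mul (polyfun_cst a) pf) => // v B.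
by rewrite mul0r add0r.
Qed.

Lemma polyfun_sum I (r : seq I) (f : I -> V -> R) Df : (forall i, polyfun (f i) (Df i)) ->
  polyfun (fun v => \sum_(i <- r) f i v) (fun v B => \sum_(i <- r) Df i v B).
Proof.
move=> pf; elim: r => [|i r IH].
  by apply: eq_polyfun (polyfun_cst 0) => [v|v B]; rewrite big_nil.
by apply: eq_polyfun (polyfun_add (pf i) IH) => [v|v B]; rewrite big_cons.
Qed.

Lemma polyfun_deriv_linear f Df v : polyfun f Df -> linear (Df v : V -> R^o).
Proof.
move=> pf a x y; elim: pf => //= {f Df}.
- by move=> c; rewrite scaler0 addr0.
- by move=> phi; rewrite linearP.
- by move=> f Df g Dg _ -> _ ->; rewrite /GRing.scale /=; ring.
- by move=> f Df g Dg _ -> _ ->; rewrite /GRing.scale /=; ring.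
Qed.

Lemma polyfun_deriv f Df B : polyfun f Df -> exists D', polyfun (Df^~ B) D'.
Proof.
elim=> {f Df} [c|phi|f Df g Dg pf [D1 h1] pg [D2 h2]|f Df g Dg pf [D1 h1] pg [D2 h2]].
- by eexists; exact: polyfun_cst.
- by eexists; exact: polyfun_cst.
- by eexists; exact: polyfun_add h1 h2.
- by eexists; exact: polyfun_add (polyfun_mul h1 pg) (polyfun_mul pf h2).
Qed.

Lemma polyfun_is_derive f Df (v B : V) (t : R) : polyfun f Df ->
  is_derive t (1 : R) (fun s : R => f (v + s *: B)) (Df (v + t *: B) B).
Proof.
elim=> {f Df} [c|phi|f Df g Dg pf d1 pg d2|f Df g Dg pf d1 pg d2].
- exact: is_derive_cst.
- have -> : (fun s : R => phi (v + s *: B)) = (fun s : R => phi v + s * phi B).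
    by apply/funext => s; rewrite linearD linearZ.
  have h : is_derive t (1 : R) ((cst (phi v) : R -> R) + (id : R -> R) * cst (phi B : R)) _ :=
    is_deriveD (is_derive_cst _ _ _) (is_deriveM (is_derive_id _ _) (is_derive_cst _ _ _)).
  by apply: (is_derive_eq h); rewrite /GRing.scale /=; ring.
- exact: (is_deriveD d1 d2).
- by apply: (is_derive_eq (is_deriveM d1 d2)); rewrite /GRing.scale /=; ring.
Qed.

Lemma polyfun_line_continuous f Df (v B : V) : polyfun f Df ->
  continuous (fun s : R => f (v + s *: B)).
Proof.
move=> pf t; apply/differentiable_continuous/derivable1_diffP.
by have [] := polyfun_is_derive v B t pf.
Qed.

Section on_coords.
Variables (d : nat) (b : d.-tuple V).
Local Notation co := (coords b).
Implicit Types x : d.-tuple (measurableTypeR R).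

Lemma coords_upd x i t : co (upd x i t) = co (upd x i 0) + t *: tnth b i.
Proof.
rewrite /coords (bigD1 i) //= [in RHS](bigD1 i) //= !tnth_mktuple eqxx scale0r add0r addrC.
by congr (_ + _); apply: eq_bigr => j /negPf ji; rewrite !tnth_mktuple ji.
Qed.

Lemma polyfun_measurable f Df : polyfun f Df -> measurable_fun setT (f \o co).
Proof.
elim=> {f Df} [c|phi|f Df g Dg pf d1 pg d2|f Df g Dg pf d1 pg d2].
- exact: measurable_cst.
- rewrite (_ : _ \o _ = fun x => \sum_(i < d) tnth x i * phi (tnth b i)).
    by apply: measurable_sum => i; apply: measurable_funM => //; exact: measurable_tnth.
  by apply/funext => x; rewrite /= linear_sum; apply: eq_bigr => i _; rewrite linearZ.
- exact: measurable_funD.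
- exact: measurable_funM.
Qed.

Lemma polyfun_bounded f Df M : polyfun f Df ->
  exists C, forall x, box d M x -> `|f (co x)| <= C.
Proof.
elim=> {f Df} [c|phi|f Df g Dg pf [C1 h1] pg [C2 h2]|f Df g Dg pf [C1 h1] pg [C2 h2]].
- by exists `|c|.
- exists (\sum_(i < d) M * `|phi (tnth b i)|) => x bx.
  rewrite linear_sum (le_trans (ler_norm_sum _ _ _)) //; apply: ler_sum => i _.
  by rewrite linearZ normrM ler_wpM2r.
- exists (C1 + C2) => x bx; rewrite (le_trans (ler_normD _ _)) //.
  by rewrite lerD ?h1 ?h2.
- exists (C1 * C2) => x bx; rewrite normrM ler_pM ?h1 ?h2 //.
Qed.
End on_coords.

(** As for polyfun, Df v B is the derivative at v in the direction B; testing against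
    linear forms reduces everything to scalar functions. *)
Definition polymap (U : vectType R) (f : V -> U) (Df : V -> V -> U) : Prop :=
  forall phi : {linear U -> R^o}, polyfun (phi \o f) (fun v B => phi (Df v B)).

Lemma polymap_id : polymap id (fun _ B => B).
Proof. by move=> phi; exact: polyfun_lin. Qed.

Lemma polymap_cst (U : vectType R) (u : U) : polymap (fun=> u) (fun _ _ => 0).
Proof. by move=> phi; apply: eq_polyfun (polyfun_cst (phi u)) => // v B; rewrite linear0. Qed.

Lemma polymap_add (U : vectType R) (f g : V -> U) Df Dg : polymap f Df -> polymap g Dg ->
  polymap (fun v => f v + g v) (fun v B => Df v B + Dg v B).
Proof.
move=> pf pg phi; apply: eq_polyfun (polyfun_add (pf phi) (pg phi)) => [v|v B];
 by rewrite /= linearD.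
Qed.

Lemma polymap_scale (U : vectType R) a (f : V -> U) Df : polymap f Df ->
  polymap (fun v => a *: f v) (fun v B => a *: Df v B).
Proof.
move=> pf phi; apply: eq_polyfun (polyfun_scale a (pf phi)) => [v|v B];
 by rewrite /= linearZ.
Qed.

Lemma polymap_lin (U W : vectType R) (L : U -> W) (f : V -> U) Df : linear L -> polymap f Df ->
  polymap (fun v => L (f v)) (fun v B => L (Df v B)).
Proof.
move=> linL pf phi.
pose L' : {linear U -> W} := HB.pack L (GRing.isLinear.Build R U W _ L linL).
exact: (pf (phi \o L')).
Qed.

(** Expanding the first argument in a basis turns the bilinear map into a sum of
    products of scalar polynomial functions. *)
Lemma polymap_bilin (U1 U2 W : vectType R) (bil : U1 -> U2 -> W)
    (f : V -> U1) Df (g : V -> U2) Dg :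
  (forall w, linear (bil^~ w)) -> (forall u, linear (bil u)) ->
  polymap f Df -> polymap g Dg ->
  polymap (fun v => bil (f v) (g v)) (fun v B => bil (Df v B) (g v) + bil (f v) (Dg v B)).
Proof.
move=> linl linr pf pg phi.
pose e := vbasis {:U1}.
pose r u : {linear U2 -> W} := HB.pack (bil u) (GRing.isLinear.Build R U2 W _ (bil u) (linr u)).
pose l w : {linear U1 -> W} := HB.pack (bil^~ w) (GRing.isLinear.Build R U1 W _ (bil^~ w) (linl w)).
have E u w : phi (bil u w) = \sum_i coord e i u * phi (bil e`_i w).
  rewrite {1}(coord_vbasis (memvf u)) -[bil _ w]/(l w _) linear_sum linear_sum.
  by apply: eq_bigr => i _; rewrite !linearZ.
have pi i := polyfun_mul (pf (coord e i)) (pg (phi \o r e`_i)).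
apply: eq_polyfun (polyfun_sum (index_enum _) pi) => [v|v B] /=.
  by rewrite E.
by rewrite linearD !E -big_split.
Qed.

End polyfun.

(** * The squared positive part *)

Section loop.
Variable R : realType.

Definition pospart (y : R) : R := Num.max y 0.

Lemma pospart_ge0 y : 0 <= pospart y.
Proof. by rewrite le_max lexx orbT. Qed.

(** The square of the positive part is continuously differentiable, with derivative
    twice the positive part: it is a cutoff profile that can be differentiated once. *)
Lemma pospart_sq_taylor (y h : R) :
  `|pospart (y + h) ^+ 2 - pospart y ^+ 2 - h * (2 * pospart y)| <= h ^+ 2.
Proof.
rewrite /pospart ler_norml; case: (leP y 0) => y0; case: (leP (y + h) 0) => yh0;
  apply/andP; split; nra.
Qed.

Lemma is_derive_quadratic (f : R -> R) (a l : R) :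
  (forall h, `|f (a + h) - f a - h * l| <= h ^+ 2) -> is_derive a (1 : R) f l.
Proof.
move=> H.
have cv : h^-1 *: (f (h *: (1 : R) + a) - f a) @[h --> 0^'] --> l.
  apply/cvgrPdist_le => e e0; near=> h.
  have h0 : h != 0 by near: h; exact: nbhs_dnbhs_neq.
  have -> : h^-1 *: (f (h *: (1 : R) + a) - f a) = l + h^-1 * (f (a + h) - f a - h * l).
    by rewrite /GRing.scale /= mulr1 (addrC h); field.
  rewrite opprD addNKr normrN normrM normrV ?unitfE // mulrC ler_pdivrMr ?normr_gt0 //.
  apply: le_trans (H h) _; rewrite -real_normK ?num_real // expr2 ler_wpM2r //.
  near: h; apply: dnbhs0_le.
  exact: e0.
split; first by apply/cvg_ex; exists l.
exact: cvg_lim.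
Unshelve. all: by end_near. Qed.

Lemma is_derive_pospart_sq (y : R) : is_derive y (1 : R) (fun z : R => pospart z ^+ 2) (2 * pospart y).
Proof. apply: is_derive_quadratic => h; exact: pospart_sq_taylor. Qed.

Lemma pospart_continuous : continuous pospart.
Proof.
move=> y; apply: continuous_max; [exact: cvg_id | exact: cvg_cst].
Qed.

End loop.

(** * Integration by parts for tangential fields *)

Section tame.
Variables (R : realType) (d : nat).
Local Notation T := (d.-tuple (measurableTypeR R)).

(** The functions that become integrable when multiplied by a cutoff supported in a box. *)
Definition tame (f : T -> R) := measurable_fun setT f /\
  forall M, exists C, forall x, box d M x -> `|f x| <= C.

Lemma tame_add f g : tame f -> tame g -> tame (fun x => f x + g x).
Proof.
move=> [mf bf] [mg bg]; split; first exact: measurable_funD.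
move=> M; have [C1 h1] := bf M; have [C2 h2] := bg M; exists (C1 + C2) => x bx.
by rewrite (le_trans (ler_normD _ _)) // lerD ?h1 ?h2.
Qed.

Lemma tame_mul f g : tame f -> tame g -> tame (fun x => f x * g x).
Proof.
move=> [mf bf] [mg bg]; split; first exact: measurable_funM.
move=> M; have [C1 h1] := bf M; have [C2 h2] := bg M; exists (C1 * C2) => x bx.
by rewrite normrM ler_pM ?h1 ?h2.
Qed.

Lemma tame_cst c : tame (fun=> c).
Proof. by split; [exact: measurable_cst | move=> M; exists `|c|]. Qed.

Lemma tame_opp f : tame f -> tame (fun x => - f x).
Proof.
move=> tf; have := tame_mul (tame_cst (-1)) tf; congr tame.
by apply/funext => x; rewrite mulN1r.
Qed.

Lemma tame_pospart f : tame f -> tame (fun x => pospart (f x)).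
Proof.
move=> [mf bf]; split; first by apply: measurable_maxr => //; exact: measurable_cst.
move=> M; have [C h] := bf M; exists C => x /h; apply: le_trans.
rewrite ger0_norm ?pospart_ge0 // /pospart; case: (leP (f x) 0) => _; first exact: normr_ge0.
exact: ler_norm.
Qed.

Lemma tame_sum I (r : seq I) (f : I -> T -> R) : (forall i, tame (f i)) ->
  tame (fun x => \sum_(i <- r) f i x).
Proof.
move=> tf; elim: r => [|i r IH].
  by have := tame_cst 0; congr tame; apply/funext => x; rewrite big_nil.
by have := tame_add (tf i) IH; congr tame; apply/funext => x; rewrite big_cons.
Qed.

Lemma tame_boxfun M f : tame f -> (forall x, ~ box d M x -> f x = 0) -> boxfun M f.
Proof.
move=> [mf /(_ M) [C fC]] f0; split=> //; exists `|C| => x.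
have [bx|/f0 ->] := pselect (box d M x); last by rewrite normr0.
exact: le_trans (fC x bx) (ler_norm _).
Qed.

Lemma polyfun_tame (V : vectType R) (b : d.-tuple V) f Df :
  polyfun f Df -> tame (fun x => f (coords b x)).
Proof.
move=> pf; split; first exact: (polyfun_measurable b pf).
by move=> M; exact: (polyfun_bounded b M pf).
Qed.
End tame.

Section loop_equation.
Variables (R : realType) (V : vectType R) (d : nat) (b : d.-tuple V).
Variable c : 'I_d -> {linear V -> R^o}.
Local Notation co := (coords b).
Local Notation mu := (lebesgue_tuple R d).
Variables (Q : nat -> V -> R) (DQ : nat -> V -> V -> R).
Hypothesis pQ : forall p, polyfun (Q p) (DQ p).

(** In the applications Q p is the sum of the powers of order 2p + 2 of the singular
    values, and this set is the open unit ball. *)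
Definition sublevel : set (d.-tuple (measurableTypeR R)) := [set x | exists p, Q p (co x) < 1].

Lemma measurable_sublevel : measurable sublevel.
Proof.
have -> : sublevel = \bigcup_p ((fun x => Q p (co x)) @^-1` `]-oo, 1%R[%classic).
  by apply/seteqP; split => x /= [p]; [exists p => //; rewrite /= in_itv|rewrite /= in_itv; exists p].
apply: bigcupT_measurable => p; rewrite -[X in measurable X]setTI.
apply: (polyfun_measurable b (pQ p)) => //; exact: measurable_itv.
Qed.

(* X is a vector field with coordinates c i (X v), and g is a test function. Q_box says
   that the sublevel sets are bounded, DQ_bound and DQ_cvg say that X is asymptotically
   tangent to the level sets of Q p as p grows. *)
Variables (X : V -> V) (DX : V -> V -> V) (g : V -> R) (Dg : V -> V -> R) (M C0 : R).
Hypotheses (pX : polymap X DX) (pg : polyfun g Dg).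
Hypothesis X_expand : forall x, X (co x) = \sum_i c i (X (co x)) *: tnth b i.
Hypothesis Q_ge0 : forall p x, 0 <= Q p (co x).
Hypothesis Q_box : forall p x, Q p (co x) < 1 -> box d M x.
Hypothesis DQ_bound : forall p x, Q p (co x) < 1 -> `|DQ p (co x) (X (co x))| <= C0.
Hypothesis Q_cvg : forall x, sublevel x -> (fun p => Q p (co x)) @ \oo --> (0 : R).
Hypothesis DQ_cvg : forall x, sublevel x -> (fun p => DQ p (co x) (X (co x))) @ \oo --> (0 : R).

Definition divergence (v : V) : R := \sum_i (c i (DX v (tnth b i)) : R).

(* H is the divergence of g X. The square of w p is the cutoff, j p i is the partial
   derivative in the direction of the i-th basis vector of the i-th coordinate of the
   field obtained by multiplying g X by the cutoff, and J p is the divergence of this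
   field. *)
Let H v := g v * divergence v + Dg v (X v).
Let w p v := pospart (1 - Q p v).
Let part i (v : V) : R := g v * (c i (X v) : R).
Let Dpart i (v B : V) : R := Dg v B * (c i (X v) : R) + g v * (c i (DX v B) : R).
Let pp i : polyfun (part i) (Dpart i) := polyfun_mul pg (pX (c i)).
Let j p i v := w p v ^+ 2 * Dpart i v (tnth b i) - 2 * w p v * DQ p v (tnth b i) * part i v.
Let J p v := w p v ^+ 2 * H v - 2 * w p v * (g v * DQ p v (X v)).

Let deriv_sum f Df x : polyfun f Df ->
  \sum_i Df (co x) (tnth b i) * (c i (X (co x)) : R) = Df (co x) (X (co x)).
Proof.
move=> pf; pose L : {linear V -> R^o} :=
  HB.pack (Df (co x)) (GRing.isLinear.Build R V R^o _ (Df (co x)) (polyfun_deriv_linear (co x) pf)).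
rewrite [in RHS]X_expand -[RHS]/(L _) linear_sum; apply: eq_bigr => i _.
by rewrite linearZ /= mulrC.
Qed.

Let H_sum x : H (co x) = \sum_i Dpart i (co x) (tnth b i).
Proof. by rewrite /Dpart big_split /= (deriv_sum _ pg) addrC /H mulr_sumr. Qed.

Let J_sum p x : J p (co x) = \sum_i j p i (co x).
Proof.
rewrite /J H_sum /j sumrB mulr_sumr; congr (_ - _).
rewrite -(deriv_sum _ (pQ p)) !mulr_sumr; apply: eq_bigr => i _; rewrite /part; ring.
Qed.

Let tame_w p : tame (fun x => w p (co x)).
Proof. exact/tame_pospart/(tame_add (tame_cst _ _) (tame_opp (polyfun_tame b (pQ p)))). Qed.

Let tame_deriv f Df B : polyfun f Df -> tame (fun x => Df (co x) B).
Proof. by move=> /(polyfun_deriv B) [D' pD]; exact: (polyfun_tame b pD). Qed.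

Let tame_w2 p : tame (fun x => w p (co x) ^+ 2).
Proof. by have := tame_mul (tame_w p) (tame_w p); congr tame; apply/funext => x; rewrite expr2. Qed.

Let tame_j p i : tame (fun x => j p i (co x)).
Proof.
apply: tame_add; first exact: (tame_mul (tame_w2 p) (tame_deriv _ (pp i))).
apply/tame_opp/tame_mul; last exact: (polyfun_tame b (pp i)).
exact: (tame_mul (tame_mul (tame_cst _ _) (tame_w p)) (tame_deriv _ (pQ p))).
Qed.

Let w0 p x : ~ Q p (co x) < 1 -> w p (co x) = 0.
Proof. by move=> /negP; rewrite -leNgt => h; rewrite /w /pospart max_r // subr_le0. Qed.

Let w_out p x : ~ box d M x -> w p (co x) = 0.
Proof. by move=> nb; apply: w0 => /Q_box. Qed.

Let boxfun_j p i : boxfun M (fun x => j p i (co x)).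
Proof.
apply: tame_boxfun (tame_j p i) _ => x /w_out h.
by rewrite /j h expr0n /= mulr0 !mul0r subr0.
Qed.

Let integral_j p i : (\int[mu]_x (j p i (co x))%:E = 0)%E.
Proof.
have line x : exists v, forall t, co (upd x i t) = v + t *: tnth b i.
  by exists (co (upd x i 0)) => t; exact: coords_upd.
apply: (@integral_partial_derivative _ _ i (fun x => w p (co x) ^+ 2 * part i (co x)) _ M (boxfun_j p i)).
- by move=> x /w_out ->; rewrite expr0n mul0r.
- move=> x t; have [v E] := line x; under eq_fun do rewrite E; rewrite E; set B := tnth b i.
  have dQ := polyfun_is_derive v B t (polyfun_add (polyfun_cst _ 1) (polyfun_scale (-1) (pQ p))).
  have dw := @is_derive1_comp _ (fun z : R => pospart z ^+ 2) _ t _ _ (is_derive_pospart_sq _) dQ.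
  have := is_deriveM dw (polyfun_is_derive v B t (pp i)).
  have -> : ((fun z : R => pospart z ^+ 2) \o (fun s : R => 1 + -1 * Q p (v + s *: B))) *
     (fun s : R => part i (v + s *: B)) = (fun s : R => w p (v + s *: B) ^+ 2 * part i (v + s *: B)).
    by apply/funext => s; rewrite /w /= mulrfctE /= mulN1r.
  move=> h; apply: (is_derive_eq h); rewrite /j /w /GRing.scale /= add0r !mulN1r; ring.
- move=> x; have [v E] := line x; under eq_fun do rewrite E; set B := tnth b i => t.
  have cw : continuous (fun s : R => w p (v + s *: B)).
    move=> s; apply: (@continuous_comp _ _ _ (fun s : R => 1 - Q p (v + s *: B)) (@pospart R)); last exact: pospart_continuous.
    have := polyfun_line_continuous (v := v) (B := B) (polyfun_add (polyfun_cst _ 1) (polyfun_scale (-1) (pQ p))).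
    by under eq_fun do rewrite mulN1r; apply.
  have cD f Df : polyfun f Df -> continuous (fun s : R => Df (v + s *: B) B).
    by move=> /(polyfun_deriv B) [D' pD]; exact: polyfun_line_continuous pD.
  apply: cvgB; apply: cvgM.
  + by apply: cvgM; exact: cw.
  + exact: (cD _ _ (pp i)).
  + apply: cvgM; last exact: (cD _ _ (pQ p)).
    by apply: cvgM; [exact: cvg_cst|exact: cw].
  + exact: (polyfun_line_continuous (pp i)).
Qed.

Let integral_J p : (\int[mu]_x (J p (co x))%:E = 0)%E.
Proof.
under eq_integral do rewrite J_sum -sumEFin.
rewrite integral_sum //; first by apply: big1 => i _; exact: integral_j.
by move=> i; exact: boxfun_integrable (boxfun_j p i).
Qed.

Let tame_H : tame (fun x => H (co x)).
Proof.
have := tame_sum (index_enum _) (fun i => tame_deriv (tnth b i) (pp i)).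
by congr tame; apply/funext => x; rewrite H_sum.
Qed.

(** The divergence J p of (1 - Q p)_+^2 g X integrates to zero, since this field has
    bounded support. On the sublevel set Q p tends to 0, so the cutoff tends to 1. The
    term where the cutoff is differentiated contains the derivative of Q p along X,
    which stays bounded and tends to 0. So dominated convergence applies as p tends to
    infinity. *)
Lemma loop_equation :
  \int[mu]_(x in sublevel) (g (co x) * divergence (co x) + Dg (co x) (X (co x))) = 0.
Proof.
have [CH hH] := tame_H.2 M; have [Cg hg] := (polyfun_tame b pg).2 M.
have wle p x : w p (co x) <= 1.
  by rewrite /w /pospart ge_max ler01 andbT lerBlDr lerDl.
have w_ge0 p x : 0 <= w p (co x) by exact: pospart_ge0.
pose C := `|CH| + 2 * (`|Cg| * `|C0|).
have C_ge0 : 0 <= C by rewrite addr_ge0 // mulr_ge0 // mulr_ge0.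
have J_le p x : `|J p (co x)| <= C.
  have [q1|/negP/w0 q1] := boolP (Q p (co x) < 1); last first.
    by rewrite /J q1 expr0n /= mulr0 !mul0r subrr normr0.
  have bx := Q_box q1.
  have w2 : 0 <= w p (co x) ^+ 2 <= 1 by rewrite exprn_ge0 //= exprn_ile1.
  have /andP[w2a w2b] := w2.
  have tw : 0 <= 2 * w p (co x) by rewrite mulr_ge0.
  rewrite /J (le_trans (ler_normB _ _)) // lerD //.
    rewrite normrM (ger0_norm w2a) -[leRHS]mul1r ler_pM //.
    exact: le_trans (hH x bx) (ler_norm _).
  rewrite normrM (ger0_norm tw) normrM ler_pM ?mulr_ge0 ?normr_ge0 //.
    by rewrite ler_piMr.
  by rewrite ler_pM ?normr_ge0 // ?(le_trans (hg x bx)) ?(le_trans (DQ_bound q1)) // ler_norm.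
have J_out p x : ~ box d M x -> J p (co x) = 0.
  by move=> /w_out h; rewrite /J h expr0n /= mulr0 !mul0r subrr.
have tJ p : tame (fun x => J p (co x)).
  apply: tame_add; first exact: (tame_mul (tame_w2 p) tame_H).
  have tDX : tame (fun x => DQ p (co x) (X (co x))).
    have := tame_sum (index_enum _) (fun i => tame_mul (tame_deriv (tnth b i) (pQ p)) (polyfun_tame b (pX (c i)))).
    by congr tame; apply/funext => x; exact: deriv_sum _ (pQ p).
  exact: tame_opp (tame_mul (tame_mul (tame_cst _ _) (tame_w p)) (tame_mul (polyfun_tame b pg) tDX)).
have mS := measurable_sublevel.
rewrite Rintegral_mkcond /Rintegral.
pose L x := ((fun x => H (co x)) \_ sublevel) x.
have JL x : (fun p => J p (co x)) @ \oo --> L x.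
  rewrite /L patchE; case: ifPn => [|/negP]; rewrite inE => Sx; last first.
    apply: cvg_near_cst; apply: nearW => p.
    have q1 : ~ Q p (co x) < 1 by move=> q1; apply: Sx; exists p.
    by rewrite /J w0 // expr0n /= mulr0 !mul0r subrr.
  have cw : (fun p => w p (co x)) @ \oo --> (1 : R).
    have -> : 1 = pospart (1 - 0 : R) by rewrite subr0 /pospart max_l.
    apply: (continuous_cvg _ (@pospart_continuous R _)).
    by apply: cvgB; [exact: cvg_cst|exact: Q_cvg].
  have -> : H (co x) = 1 ^+ 2 * H (co x) - 2 * 1 * (g (co x) * 0) by rewrite expr1n mul1r !mulr0 subr0.
  apply: cvgB; apply: cvgM.
  + by apply: cvgM; exact: cw.
  + exact: cvg_cst.
  + by apply: cvgM => //; exact: cvg_cst.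
  + by apply: cvgM; [exact: cvg_cst|exact: DQ_cvg].
have mJ p : measurable_fun setT (fun x => (J p (co x))%:E) by apply/measurable_EFinP; exact: (tJ p).1.
have [] := @dominated_convergence _ _ _ mu setT measurableT (fun p x => (J p (co x))%:E)
  (fun x => (L x)%:E) (EFin \o (fun x => \1_(box d M) x * C)) mJ.
- apply/measurable_EFinP; apply/(measurable_restrictT _ mS).
  by apply: measurable_funTS; exact: tame_H.1.
- by apply: aeW => x _; apply: cvg_EFin; [exact: nearW|exact: JL].
- apply: (@integrable_bounded_support _ _ _ _ (box d M) _ C).
  + exact: measurable_box.
  + exact: mu_box_fin.
  + apply: (@measurable_funM _ _ R setT (\1_(box d M)) (cst C)); last exact: measurable_cst.
    by apply: measurable_indic; exact: measurable_box.
  + move=> x; rewrite /= indicE; case: (x \in _); rewrite ?mul0r ?mul1r ?normr0 // ger0_norm //.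
  + by move=> x nb; rewrite /= indicE memNset // mul0r.
- apply: aeW => x p _ /=; rewrite lee_fin indicE.
  have [bx|nb] := pselect (box d M x); first by rewrite mem_set // mul1r.
  by rewrite J_out // normr0 memNset // mul0r.
move=> _ _; under eq_fun do rewrite integral_J.
move=> /cvg_lim => /(_ (@ereal_hausdorff _)).
rewrite lim_cst; last exact: ereal_hausdorff.
by move=> <-.
Qed.
End loop_equation.

(** * Traces over orthonormal bases of matrix spaces *)

Section matrix_units.
Variables (R : realType) (F : lawfulAlg R) (n : nat).
Local Notation M := (Mat F n n).
Implicit Types (T A C : M).

Definition unit_mx (i j : 'I_n) (u : F) : M := \matrix_(k, l) (if (k == i) && (l == j) then u else 0).

Lemma inner_unit_mx i j u T : inner (unit_mx i j u) T = reF (conjF F u * T i j).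
Proof.
rewrite inner_entries (bigD1 i) //= (bigD1 j) //= mxE !eqxx /=.
rewrite !big1 ?addr0 // => [k ki|l lj].
  by rewrite big1 // => l _; rewrite mxE (negPf ki) raddf0 mul0r re0.
by rewrite mxE (negPf lj) andbF raddf0 mul0r re0.
Qed.

Lemma unit_mx_expand T :
  T = \sum_i \sum_j \sum_(u <- onbF F) inner (unit_mx i j u) T *: unit_mx i j u.
Proof.
apply/matrixP => k l.
have E (S : 'I_n -> 'I_n -> F -> M) :
   (\sum_i \sum_j \sum_(u <- onbF F) S i j u : M) k l = \sum_i \sum_j \sum_(u <- onbF F) S i j u k l.
  rewrite summxE; apply: eq_bigr => i _; rewrite summxE; apply: eq_bigr => j _.
  by rewrite summxE.
rewrite E (bigD1 k) //= (bigD1 l) //= [X in _ + X + _]big1 ?addr0; last first.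
  by move=> j /negPf jl; rewrite big1 // => u _; rewrite scale_MatE mxE [l == j]eq_sym jl andbF scaler0.
rewrite [X in _ + X]big1 ?addr0; last first.
  by move=> i /negPf ik; apply: big1 => j _; apply: big1 => u _;
   rewrite scale_MatE mxE [k == i]eq_sym ik scaler0.
rewrite {1}(law_expand (lawfulP F) (T k l)); apply: eq_bigr => u _.
by rewrite scale_MatE mxE !eqxx inner_unit_mx.
Qed.

(** The reference for traces of linear maps: the traces over orthonormal bases of the
    whole space and of the space of self-adjoint matrices are expressed through it. *)
Definition unit_trace (L : M -> M) : R :=
  \sum_i \sum_j \sum_(u <- onbF F) inner (unit_mx i j u) (L (unit_mx i j u)).

Lemma mul_unit_mx i j u A C : (A ** unit_mx i j u ** C) i j = A i i * u * C j j.
Proof.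
rewrite mxE (bigD1 j) //= big1 ?addr0; last first.
  move=> l lj; rewrite mxE big1 ?mul0r // => k _.
  by rewrite !mxE (negPf lj) andbF mulr0.
rewrite mxE (bigD1 i) //= big1 ?addr0; first by rewrite mxE !eqxx.
by move=> k ki; rewrite mxE (negPf ki) mulr0.
Qed.

Lemma mul_adj_unit_mx i j u A C : (A ** adj (unit_mx i j u) ** C) i j = A i j * conjF F u * C i j.
Proof.
rewrite mxE (bigD1 i) //= big1 ?addr0; last first.
  move=> l lj; rewrite mxE big1 ?mul0r // => k _.
  by rewrite adjFE mxE (negPf lj) raddf0 mulr0.
rewrite mxE (bigD1 j) //= big1 ?addr0; first by rewrite adjFE mxE !eqxx.
by move=> k ki; rewrite adjFE mxE (negPf ki) andbF raddf0 mulr0.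
Qed.

(** A self-adjoint matrix has real diagonal entries, which commute with the units u;
    over C the formula fails for general A. *)
Lemma unit_trace_mul A C : A = adj A ->
  unit_trace (fun B => A ** B ** C) = (dimF F)%:R * rtr A * rtr C.
Proof.
move=> As; rewrite /unit_trace /rtr /mxtrace !re_sum -mulrA big_distrl mulr_sumr /=.
apply: eq_bigr => i _; rewrite mulrCA !mulr_sumr; apply: eq_bigr => j _.
have -> : A i i = reF (A i i) *: 1.
  by apply: conj_fixed_real; rewrite -[conjF F _]adjFE -As.
rewrite reZ (law_re1 (lawfulP F)) mulr1.
transitivity (\sum_(u <- onbF F) reF (A i i) * reF (C j j)).
  apply: eq_big_seq => u ur; rewrite inner_unit_mx mul_unit_mx.
  have -> : A i i = reF (A i i) *: 1.
    by apply: conj_fixed_real; rewrite -[conjF F _]adjFE -As.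
  rewrite -scalerAl mul1r -scalerAl -scalerAr !reZ (law_re1 (lawfulP F)) mulr1.
  by rewrite mulrA (law_unit (lawfulP F) ur) mul1r.
by rewrite big_const_seq count_predT (law_size (lawfulP F)) iter_addr_0 -mulr_natl; ring.
Qed.

(** Entry by entry this is law_anti. *)
Lemma unit_trace_adj A C :
  unit_trace (fun B => A ** adj B ** C) = (2 - (dimF F)%:R) * inner A C.
Proof.
rewrite /unit_trace inner_entries mulr_sumr; apply: eq_bigr => i _.
rewrite mulr_sumr; apply: eq_bigr => j _; rewrite -(law_anti (lawfulP F)).
by apply: eq_bigr => u _; rewrite inner_unit_mx mul_adj_unit_mx !mulrA.
Qed.

Lemma unit_trace_add L1 L2 : unit_trace (fun B => L1 B + L2 B) = unit_trace L1 + unit_trace L2.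
Proof.
rewrite /unit_trace -big_split; apply: eq_bigr => i _; rewrite -big_split; apply: eq_bigr => j _.
by rewrite -big_split; apply: eq_bigr => u _; rewrite innerDr.
Qed.

Lemma unit_trace_scale a L : unit_trace (fun B => a *: L B) = a * unit_trace L.
Proof.
rewrite /unit_trace mulr_sumr; apply: eq_bigr => i _; rewrite mulr_sumr; apply: eq_bigr => j _.
by rewrite mulr_sumr; apply: eq_bigr => u _; rewrite innerZr.
Qed.

Section basis.
Variables (E : {vspace M}) (b : (\dim E).-tuple M).
Hypothesis ob : orthonormal_basis b.

Lemma onb_expand T : T \in E -> T = \sum_i inner (tnth b i) T *: tnth b i.
Proof.
move=> TE; have [bE bb] := ob.
rewrite {1}(coord_basis bE TE); apply: eq_bigr => i _; rewrite (tnth_nth 0); congr (_ *: _).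
rewrite {2}(coord_basis bE TE) inner_sumr (bigD1 i) //= innerZr -!tnth_nth bb eqxx mulr1.
by rewrite big1 ?addr0 // => k ki; rewrite innerZr -tnth_nth bb eq_sym (negPf ki) mulr0.
Qed.

Lemma coords_mem x : coords b x \in E.
Proof.
have [bE _] := ob; apply: memv_suml => i _; apply: memvZ; apply: (basis_mem bE).
exact: mem_tnth.
Qed.

Lemma coords_norm x : inner (coords b x) (coords b x) = \sum_i (tnth x i : R) ^+ 2.
Proof.
have [_ bb] := ob; rewrite inner_sumr; apply: eq_bigr => i _.
rewrite innerZr innerC inner_sumr (bigD1 i) //= innerZr bb eqxx mulr1.
by rewrite big1 ?addr0 ?expr2 // => k ki; rewrite innerZr bb eq_sym (negPf ki) mulr0.
Qed.

Lemma coords_box (N : nat) x :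
  inner (coords b x) (coords b x) <= N.+1%:R -> box (\dim E) N.+1%:R x.
Proof.
rewrite coords_norm => le i.
have {le} : (tnth x i : R) ^+ 2 <= N.+1%:R.
  apply: le_trans le; rewrite (bigD1 i) //= lerDl.
  by apply: sumr_ge0 => k _; exact: sqr_ge0.
move=> le; rewrite -(@ler_pXn2r _ 2) ?nnegrE // real_normK ?num_real //.
by apply: (le_trans le); rewrite -natrX ler_nat expnS leq_pmulr // expn_gt0.
Qed.

(** The trace on E of L is the trace on the whole space of L P, where P is the
    orthogonal projection onto E: expand the basis of E in matrix units and exchange the
    sums. *)
Lemma onb_trace (L : M -> M) (P : M -> M) : linear L ->
  (forall T, P T = \sum_i inner (tnth b i) T *: tnth b i) ->
  \sum_i inner (tnth b i) (L (tnth b i)) = unit_trace (fun B => L (P B)).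
Proof.
move=> linL PE; pose L' : {linear M -> M} := HB.pack L (GRing.isLinear.Build R M M _ L linL).
transitivity (\sum_i \sum_k \sum_l \sum_(u <- onbF F)
   inner (unit_mx k l u) (tnth b i) * inner (unit_mx k l u) (L (tnth b i))).
  apply: eq_bigr => i _; rewrite {1}(unit_mx_expand (tnth b i)) innerC inner_sumr.
  apply: eq_bigr => k _; rewrite inner_sumr; apply: eq_bigr => l _; rewrite inner_sumr.
  by apply: eq_bigr => u _; rewrite innerZr (innerC (L _)).
rewrite exchange_big; apply: eq_bigr => k _; rewrite exchange_big; apply: eq_bigr => l _.
rewrite exchange_big; apply: eq_bigr => u _ /=.
rewrite PE -[L _]/(L' _) linear_sum inner_sumr; apply: eq_bigr => i _.
by rewrite linearZ innerZr innerC.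
Qed.
End basis.

Lemma onb_trace_full (b : (\dim {: M}).-tuple M) (L : M -> M) : orthonormal_basis b -> linear L ->
  \sum_i inner (tnth b i) (L (tnth b i)) = unit_trace L.
Proof.
move=> ob linL; apply: (onb_trace (P := id) linL) => T.
exact: (onb_expand ob (memvf T)).
Qed.

(** The orthogonal projection onto the self-adjoint matrices maps T to (T* + T) / 2. *)
Lemma onb_trace_selfadjoint (b : (\dim (selfadjoint F n)).-tuple M) (L : M -> M) :
  orthonormal_basis b -> linear L ->
  \sum_i inner (tnth b i) (L (tnth b i)) =
  2^-1 * (unit_trace L + unit_trace (fun B => L (adj B))).
Proof.
move=> ob linL; pose P T : M := 2^-1 *: (T + adj T).
pose L' : {linear M -> M} := HB.pack L (GRing.isLinear.Build R M M _ L linL).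
rewrite (onb_trace (b := b) (P := P) linL); last first.
  move=> T; have PE : P T \in selfadjoint F n.
    by rewrite mem_selfadjoint /P adjFZ adjFD adjFK addrC.
  rewrite {1}(onb_expand ob PE); apply: eq_bigr => i _; congr (_ *: _).
  have bi : tnth b i = adj (tnth b i).
    by apply/eqP; rewrite -mem_selfadjoint; apply: (basis_mem ob.1); exact: mem_tnth.
  rewrite /P innerZr innerDr; have -> : inner (tnth b i) (adj T) = inner (tnth b i) T.
    by rewrite !innerE -adjFM rtr_adj rtrC -bi.
  by field.
rewrite -unit_trace_add -unit_trace_scale; congr unit_trace; apply/funext => B.
by rewrite /P -[LHS]/(L' _) linearZ linearD.
Qed.

End matrix_units.

(** * Power sums along a tangential field *)

Section tangential.
Variable R : realType.
Implicit Types (s : seq R) (u : R).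

(** (p + 1) v^p <= 1 + v + ... + v^p. This bound compensates the factor that appears
    when a high power is differentiated. *)
Lemma bernstein_bound (v : R) p : 0 <= v <= 1 -> p.+1%:R * (v ^+ p * (1 - v)) <= 1.
Proof.
move=> /andP[v0 v1].
have -> : p.+1%:R * (v ^+ p * (1 - v)) = (1 - v) * \sum_(i < p.+1) v ^+ p.
  by rewrite sumr_const card_ord -mulr_natl; ring.
apply: (@le_trans _ _ ((1 - v) * \sum_(i < p.+1) v ^+ i)).
  rewrite ler_wpM2l ?subr_ge0 //; apply: ler_sum => i _.
  by rewrite ler_wiXn2l // -ltnS.
have -> : (1 - v) * \sum_(i < p.+1) v ^+ i = 1 - v ^+ p.+1.
  have := subrX1 v p.+1; rewrite -(opprB v 1) mulNr => <-; ring.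
by rewrite gerBl exprn_ge0.
Qed.

(** Half of the derivative of u^(2p + 2) when u moves with velocity u^m (1 - u^2). The
    factor 1 - u^2 expresses that the field is tangent to the boundary of the unit ball. *)
Definition tangential_term (m p : nat) u := p.+1%:R * (u ^+ (2 * p + 1 + m) * (1 - u ^+ 2)).

(** One factor |u|^p absorbs p + 1 by bernstein_bound, the other one remains and tends
    to 0. *)
Lemma tangential_term_le m p u : `|u| <= 1 -> `|tangential_term m p u| <= 2 * `|u| ^+ p.
Proof.
move=> u1; rewrite /tangential_term !normrM normrX ger0_norm //.
have n0 := normr_ge0 u.
have u2 : u ^+ 2 = `|u| ^+ 2 by rewrite real_normK ?num_real.
have -> : `|1 - u ^+ 2| = (1 - `|u|) * (1 + `|u|).
  rewrite ger0_norm ?u2 ?subr_ge0 ?exprn_ile1 //; ring.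
have := bernstein_bound p (introT andP (conj n0 u1)).
have h1 : `|u| ^+ (2 * p + 1 + m) <= `|u| ^+ p * `|u| ^+ p.
  by rewrite -exprD ler_wiXn2l // addnn -mul2n -addnA leq_addr.
have w0 : 0 <= `|u| ^+ p by rewrite exprn_ge0.
set w := `|u| ^+ p in h1 w0 *; set a := `|u| ^+ (2 * p + 1 + m) in h1 *.
set N := p.+1%:R; have N0 : 0 <= N by [].
set t := `|u| in u1 n0 * => h2.
apply: (@le_trans _ _ (N * ((w * w) * ((1 - t) * (1 + t))))).
  by rewrite ler_wpM2l // ler_wpM2r // mulr_ge0 ?subr_ge0 ?addr_ge0.
have -> : N * (w * w * ((1 - t) * (1 + t))) = (N * (w * (1 - t))) * ((1 + t) * w) by ring.
apply: (@le_trans _ _ (1 * ((1 + t) * w))).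
  by rewrite ler_wpM2r // mulr_ge0 ?addr_ge0.
by rewrite mul1r ler_wpM2r // -[leRHS]/(1 + 1) lerD2l.
Qed.

Lemma cvg_sum0 s (f : R -> nat -> R) : (forall u, u \in s -> f u @ \oo --> (0 : R)) ->
  (fun p => \sum_(u <- s) f u p) @ \oo --> (0 : R).
Proof.
elim: s => [|u s IH] h; first by under eq_fun do rewrite big_nil; exact: cvg_cst.
under eq_fun do rewrite big_cons.
have hu := h u (mem_head _ _).
have hs : (fun p => \sum_(v <- s) f v p) @ \oo --> (0 : R).
  by apply: IH => v vs; apply: h; rewrite inE vs orbT.
by have := cvgD hu hs; rewrite addr0; apply.
Qed.

Section family.
Variable s : seq R.
Let Q p := \sum_(u <- s) u ^+ (2 * p.+1).
Let D m p := 2 * \sum_(u <- s) tangential_term m p u.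

Let term_ge0 p u : 0 <= u ^+ (2 * p).
Proof. by rewrite exprM exprn_ge0 ?sqr_ge0. Qed.

Let term_le p u : u \in s -> u ^+ (2 * p.+1) <= Q p.
Proof.
move=> us; rewrite /Q (big_rem u) //= lerDl; apply: sumr_ge0 => v _; exact: term_ge0.
Qed.

Lemma powersum_lt1 p u : Q p < 1 -> u \in s -> `|u| < 1.
Proof.
move=> q1 us; have := le_lt_trans (term_le p us) q1; rewrite !ltNge; apply: contra => u1.
by rewrite exprM -real_normK ?num_real // -exprM exprn_ege1.
Qed.

Lemma powersum_le_size p q : Q p < 1 -> Q q <= (size s)%:R.
Proof.
move=> q1; have -> : (size s)%:R = \sum_(u <- s) (1 : R).
  by rewrite big_const_seq count_predT iter_addr_0.
rewrite /Q big_seq [leRHS]big_seq; apply: ler_sum => u us.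
by rewrite exprM -real_normK ?num_real // -exprM exprn_ile1 // ltW // (powersum_lt1 q1).
Qed.

Lemma tangential_bound m p : Q p < 1 -> `|D m p| <= 2 * (2 * (size s)%:R).
Proof.
move=> q1; rewrite /D normrM ger0_norm // ler_wpM2l //.
have -> : 2 * (size s)%:R = \sum_(u <- s) (2 : R).
  by rewrite big_const_seq count_predT iter_addr_0 mulr_natr.
rewrite (le_trans (ler_norm_sum _ _ _)) // big_seq [leRHS]big_seq; apply: ler_sum => u us.
have u1 := ltW (powersum_lt1 q1 us).
rewrite (le_trans (tangential_term_le m p u1)) // -[leRHS]mulr1 ler_wpM2l //.
by rewrite exprn_ile1.
Qed.

Lemma powersum_cvg p : Q p < 1 -> Q @ \oo --> (0 : R).
Proof.
move=> q1; apply: cvg_sum0 => u us; have u1 := powersum_lt1 q1 us.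
have h : (fun q => (u ^+ 2) ^+ q) @ \oo --> (0 : R).
  by apply: cvg_expr; rewrite normrX exprn_ilt1.
suff : (fun q => u ^+ 2 * (u ^+ 2) ^+ q) @ \oo --> (0 : R).
  by under eq_fun do rewrite -exprM -exprD -mulnS.
by have := cvgM (cvg_cst (u ^+ 2)) h; rewrite mulr0; apply.
Qed.

Lemma tangential_cvg m p : Q p < 1 -> D m @ \oo --> (0 : R).
Proof.
move=> q1; suff h : (fun q => \sum_(u <- s) tangential_term m q u) @ \oo --> (0 : R).
  by have := cvgM (cvg_cst (2 : R)) h; rewrite mulr0; apply.
apply: cvg_sum0 => u us; have u1 := powersum_lt1 q1 us.
apply: norm_cvg0; apply: (@squeeze_cvgr _ _ _ R (cst (0 : R)) (fun q => 2 * `|u| ^+ q) (fun q => `|tangential_term m q u|)) => [||].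
- by apply: nearW => q; rewrite normr_ge0 tangential_term_le ?ltW.
- exact: cvg_cst.
- have h : (fun q => `|u| ^+ q) @ \oo --> (0 : R) by apply: cvg_expr; rewrite normr_id.
  by have := cvgM (cvg_cst (2 : R)) h; rewrite mulr0; apply.
Qed.
End family.
End tangential.

(** * The loop equation on spaces of matrices *)

Section matrix_calculus.
Variables (R : realType) (F : lawfulAlg R) (n : nat).
Local Notation M := (Mat F n.+1 n.+1).
Implicit Types (T B : M).

Lemma polymap_mulM (f g : M -> M) Df Dg : polymap f Df -> polymap g Dg ->
  polymap (fun v => f v * g v) (fun v B => Df v B * g v + f v * Dg v B).
Proof.
apply: (polymap_bilin (bil := fun u w : M => u * w)).
  by move=> w a u v; rewrite mulrDl scalerAl.
by move=> u a v w; rewrite mulrDr scalerAr.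
Qed.

Lemma polymap_adjF (f : M -> M) Df : polymap f Df ->
  polymap (fun v => adj (f v)) (fun v B => adj (Df v B)).
Proof. by apply: polymap_lin; exact: adjF_linear. Qed.

Lemma polymap_exp (f : M -> M) Df k : polymap f Df ->
  polymap (fun v => f v ^+ k)
    (fun v B => \sum_(a < k) f v ^+ a * Df v B * f v ^+ (k - a.+1)).
Proof.
move=> pf; elim: k => [|k IH].
  have -> : (fun v B => \sum_(a < 0) f v ^+ a * Df v B * f v ^+ (0 - a.+1)) = (fun _ _ => 0 : M).
    by apply/funext => v; apply/funext => B; rewrite big_ord0.
  exact: polymap_cst.
have := polymap_mulM IH pf; congr polymap; first by apply/funext => v; rewrite exprSr.
apply/funext => v; apply/funext => B; rewrite big_ord_recr /= subnn expr0 mulr1.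
congr (_ + _); rewrite mulr_suml; apply: eq_bigr => a _.
by rewrite -mulrA -exprSr subSn // subSS.
Qed.

Lemma polyfun_rtr (f : M -> M) Df : polymap f Df ->
  polyfun (fun v => rtr (f v)) (fun v B => rtr (Df v B)).
Proof.
move=> pf; pose L : {linear M -> R^o} := @rtr R F n.+1 : M -> R^o.
exact: (pf L).
Qed.

Lemma rtrCM (A B : M) : rtr (A * B) = rtr (B * A).
Proof. exact: rtrC. Qed.

(** Since the real trace is cyclic, all terms of the derivative of the power contribute
    equally. *)
Lemma polyfun_rtr_exp (f : M -> M) Df k : polymap f Df ->
  polyfun (fun v => rtr (f v ^+ k.+1)) (fun v B => k.+1%:R * rtr (f v ^+ k * Df v B)).
Proof.
move=> pf; have := polyfun_rtr (polymap_exp k.+1 pf); congr polyfun.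
apply/funext => v; apply/funext => B; rewrite rtr_sum.
transitivity (\sum_(a < k.+1) rtr (f v ^+ k * Df v B)).
  apply: eq_bigr => a _; rewrite rtrCM mulrA -exprD subSS subnK //.
  by rewrite -ltnS.
by rewrite sumr_const card_ord mulr_natl.
Qed.

Section loop.
Variables (E : {vspace M}) (b : (\dim E).-tuple M).
Hypothesis ob : orthonormal_basis b.
Variables (Q : nat -> M -> R) (DQ : nat -> M -> M -> R).
Hypothesis pQ : forall p, polyfun (Q p) (DQ p).
Hypothesis Q0 : forall T, T \in E -> Q 0 T = inner T T.

Definition field_divergence (DX : M -> M -> M) T : R :=
  \sum_i inner (tnth b i) (DX T (tnth b i)).

(** The analytic hypotheses of loop_equation concern the power sums of the spectrum s of
    T only, and the results on tangential terms settle them. *)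
Lemma matrix_loop_equation (m : nat) (X : M -> M) DX (g : M -> R) Dg :
  polymap X DX -> polyfun g Dg ->
  (forall T, T \in E -> X T \in E) ->
  (forall T, T \in E -> exists s : seq R, [/\ size s = n.+1,
     forall p, Q p T = \sum_(u <- s) u ^+ (2 * p.+1) &
     forall p, DQ p T (X T) = 2 * \sum_(u <- s) tangential_term m p u]) ->
  \int[lebesgue_tuple R (\dim E)]_(x in sublevel b Q)
    (g (coords b x) * field_divergence DX (coords b x) +
     Dg (coords b x) (X (coords b x))) = 0.
Proof.
move=> pX pg XE spec.
pose c i : {linear M -> R^o} := inner (tnth b i) : M -> R^o.
have coE := coords_mem ob.
apply: (@loop_equation _ _ _ b c Q DQ pQ X DX g Dg n.+1%:R (2 * (2 * n.+1%:R)) pX pg).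
- by move=> x; apply: (onb_expand ob); exact: XE.
- move=> p x; have [s [_ -> _]] := spec _ (coE x).
  by apply: sumr_ge0 => u _; rewrite exprM exprn_ge0 // sqr_ge0.
- move=> p x q1; have [s [ss Qs _]] := spec _ (coE x).
  rewrite Qs in q1; apply: (coords_box ob); rewrite -Q0 // Qs -ss.
  exact: powersum_le_size q1.
- move=> p x q1; have [s [ss Qs DQs]] := spec _ (coE x).
  by rewrite Qs in q1; rewrite DQs -ss; exact: tangential_bound q1.
- move=> x [p q1]; have [s [ss Qs DQs]] := spec _ (coE x).
  by rewrite Qs in q1; under eq_fun do rewrite Qs; exact: powersum_cvg q1.
- move=> x [p q1]; have [s [ss Qs DQs]] := spec _ (coE x).
  by rewrite Qs in q1; under eq_fun do rewrite DQs; exact: tangential_cvg q1.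
Qed.

End loop.
End matrix_calculus.

(** * All matrices: divergences and moment identities *)

Section integrals_over_sublevel.
Variables (R : realType) (V : vectType R) (d : nat) (b : d.-tuple V).
Variables (Q : nat -> V -> R) (M : R).
Hypothesis pQ : forall p, exists DQ, polyfun (Q p) DQ.
Hypothesis Q_box : forall p x, Q p (coords b x) < 1 -> box d M x.
Local Notation mu := (lebesgue_tuple R d).

Definition is_polyfun (f : V -> R) := exists Df, polyfun f Df.

Lemma is_polyfunD f g : is_polyfun f -> is_polyfun g -> is_polyfun (fun v => f v + g v).
Proof. by move=> [Df pf] [Dg pg]; eexists; exact: (polyfun_add pf pg). Qed.
Lemma is_polyfunM f g : is_polyfun f -> is_polyfun g -> is_polyfun (fun v => f v * g v).
Proof. by move=> [Df pf] [Dg pg]; eexists; exact: (polyfun_mul pf pg). Qed.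
Lemma is_polyfunZ a f : is_polyfun f -> is_polyfun (fun v => a * f v).
Proof. by move=> [Df pf]; eexists; exact: (polyfun_scale a pf). Qed.
Lemma is_polyfun_cst c : is_polyfun (fun=> c).
Proof. by eexists; exact: polyfun_cst. Qed.

Definition sublevel_integral (f : V -> R) : R := \int[mu]_(x in sublevel b Q) f (coords b x).

Lemma measurable_sublevel_ex : measurable (sublevel b Q).
Proof.
have [DQ hDQ] := boolp.choice pQ; exact: (measurable_sublevel b hDQ).
Qed.

Lemma sublevel_fin : (mu (sublevel b Q) < +oo)%E.
Proof.
apply: (@le_lt_trans _ _ (mu (box d M))); last exact: mu_box_fin.
apply: le_measure; rewrite ?inE; [exact: measurable_sublevel_ex|exact: measurable_box|].
by move=> x [p]; exact: Q_box.
Qed.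

Lemma is_polyfun_integrable f : is_polyfun f ->
  mu.-integrable (sublevel b Q) (EFin \o (fun x => f (coords b x))).
Proof.
move=> [Df pf]; have [mf bf] := polyfun_tame b pf; have [C hC] := bf M.
apply: measurable_bounded_integrable => //.
- exact: measurable_sublevel_ex.
- exact: sublevel_fin.
- exact: measurable_funTS.
- exists C; split; rewrite ?num_real // => y Cy x [p q1].
  exact: le_trans (hC x (Q_box q1)) (ltW Cy).
Qed.

Lemma sublevel_integralD f g : is_polyfun f -> is_polyfun g -> sublevel_integral (fun v => f v + g v) = sublevel_integral f + sublevel_integral g.
Proof.
move=> pf pg; apply: RintegralD; [exact: measurable_sublevel_ex|exact: is_polyfun_integrable..].
Qed.

Lemma sublevel_integralZ a f : is_polyfun f -> sublevel_integral (fun v => a * f v) = a * sublevel_integral f.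
Proof.
move=> pf; apply: RintegralZl; [exact: measurable_sublevel_ex|exact: is_polyfun_integrable].
Qed.

Lemma sublevel_integral_le f g : is_polyfun f -> is_polyfun g ->
  (forall x, sublevel b Q x -> f (coords b x) <= g (coords b x)) -> sublevel_integral f <= sublevel_integral g.
Proof.
move=> pf pg h; apply: le_Rintegral; [exact: measurable_sublevel_ex|exact: is_polyfun_integrable..|exact: h].
Qed.

Lemma eq_sublevel_integral f g : (forall x, sublevel b Q x -> f (coords b x) = g (coords b x)) -> sublevel_integral f = sublevel_integral g.
Proof. by move=> h; apply: eq_Rintegral => x; rewrite inE => /h. Qed.
End integrals_over_sublevel.

Lemma polymap_deriv_linear (R : realType) (V U : vectType R) (f : V -> U) Df v :
  polymap f Df -> linear (Df v).
Proof.
move=> pf a x y; rewrite [LHS](coord_vbasis (memvf _)) [RHS](coord_vbasis (memvf _)).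
apply: eq_bigr => i _; congr (_ *: _).
have /= -> := polyfun_deriv_linear v (pf (coord (vbasis {:U}) i)) a x y.
by rewrite linearP.
Qed.

Section full.
Variables (R : realType) (F : lawfulAlg R) (n : nat).
Local Notation M := (Mat F n.+1 n.+1).
Implicit Types (T B : M).
Local Notation beta := ((dimF F)%:R : R).
Local Notation N := (n.+1%:R : R).

Definition gram T : M := adj T * T.
Definition dgram T B : M := adj B * T + adj T * B.
Definition gpow k T : R := rtr (gram T ^+ k).

Lemma polymap_gram : polymap gram dgram.
Proof. by apply: polymap_mulM (@polymap_id R M); apply: polymap_adjF; exact: polymap_id. Qed.

Definition Qg p T := gpow p.+1 T.
Definition DQg p T B : R := p.+1%:R * rtr (gram T ^+ p * dgram T B).
Lemma polyfun_Qg p : polyfun (Qg p) (DQg p).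
Proof. exact: polyfun_rtr_exp polymap_gram. Qed.

Lemma gpow0 T : gpow 0 T = N. Proof. by rewrite /gpow expr0; exact: rtr1. Qed.

Lemma gpow1 T : gpow 1 T = inner T T. Proof. by []. Qed.

Lemma adj_gram T : adj (gram T) = gram T.
Proof. by rewrite -[gram T]/(adj T ** T) adjFM adjFK. Qed.

(** With W = T* T this is the field T W^k, which moves a singular value u with velocity
    u^(2k + 1). The difference of two consecutive ones is tangent to the boundary of the
    ball. *)
Definition gram_field k T : M := T * gram T ^+ k.
Definition dfield k T B : M := B * gram T ^+ k +
  T * \sum_(a < k) gram T ^+ a * dgram T B * gram T ^+ (k - a.+1).
Lemma polymap_field k : polymap (gram_field k) (dfield k).
Proof. exact: (polymap_mulM (@polymap_id R M) (polymap_exp k polymap_gram)). Qed.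

Lemma dgram_field k T : dgram T (gram_field k T) = 2%:R *: gram T ^+ k.+1.
Proof.
rewrite /dgram /gram_field -[adj (_ * _)]/(adj (T ** gram T ^+ k)) adjFM adjF_exp ?adj_gram // mmE.
by rewrite -mulrA -exprSr mulrA -exprS scaler_nat mulr2n.
Qed.

Lemma dgramB T B C : dgram T (B - C) = dgram T B - dgram T C.
Proof. by rewrite /dgram linearB mulrBl mulrBr /= opprD addrACA. Qed.

Lemma DQg_field p k T :
  DQg p T (gram_field k T - gram_field k.+1 T) = 2 * (p.+1%:R * (gpow (p + k).+1 T - gpow (p + k).+2 T)).
Proof.
rewrite /DQg dgramB !dgram_field -scalerBr -scalerAr rtrZ mulrBr -!exprD rtrB.
by rewrite !addnS mulrCA.
Qed.

Lemma spec_gram T : exists s : seq R, [/\ size s = n.+1,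
  forall k, gpow k T = \sum_(u <- s) u ^+ (2 * k) & forall u, u \in s -> 0 <= u].
Proof.
have [_ h1 h2] := singular_valuesP T; exists (singular_values T); split => //.
by rewrite size_tuple.
Qed.

Lemma spec_field k T : exists s : seq R, [/\ size s = n.+1,
   forall p, Qg p T = \sum_(u <- s) u ^+ (2 * p.+1) &
   forall p, DQg p T (gram_field k T - gram_field k.+1 T) = 2 * \sum_(u <- s) tangential_term (2 * k + 1) p u].
Proof.
have [s [ss sk _]] := spec_gram T; exists s; split => // p; first exact: sk.
rewrite DQg_field; congr (2 * _); rewrite !sk -sumrB mulr_sumr; apply: eq_bigr => u _.
rewrite /tangential_term; congr (_ * _); rewrite mulrBr mulr1 -exprD; congr (_ ^+ _ - _ ^+ _); lia.
Qed.

Section basis.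
Variable b : (\dim {: M}).-tuple M.
Hypothesis ob : orthonormal_basis b.

Let ut_mul (A C : M) : A = adj A -> unit_trace (fun B : M => A * B * C) = beta * rtr A * rtr C.
Proof. exact: unit_trace_mul. Qed.
Let ut_adj (A C : M) : unit_trace (fun B : M => A * adj B * C) = (2 - beta) * inner A C.
Proof. exact: unit_trace_adj. Qed.

Lemma field_divergence_full DX T : linear (DX T) ->
  field_divergence b DX T = unit_trace (DX T).
Proof. by move=> linD; exact: onb_trace_full. Qed.

Lemma dfield_linear k T : linear (dfield k T).
Proof. exact: polymap_deriv_linear (polymap_field k). Qed.

Lemma divergence_field0 T : field_divergence b (dfield 0) T = beta * N ^+ 2.
Proof.
rewrite field_divergence_full; last exact: dfield_linear.
have -> : dfield 0 T = fun B => 1 * B * 1.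
  by apply/funext => B; rewrite /dfield big_ord0 mulr0 addr0 expr0 mul1r.
by rewrite ut_mul ?adjF_one // rtr1 expr2 mulrA.
Qed.

(** By the product rule, each occurrence of T in the field contributes a product of two
    traces, and each occurrence of T* a single trace with the coefficient 2 - beta. *)
Lemma divergence_field1 T : field_divergence b (dfield 1) T = (2 * beta * N + 2 - beta) * gpow 1 T.
Proof.
rewrite field_divergence_full; last exact: dfield_linear.
have -> : dfield 1 T = fun B => 1 * B * gram T + (T * adj B * T + T * adj T * B * 1).
  apply/funext => B; rewrite /dfield big_ord_recl big_ord0 subnn !expr0 addr0 expr1 !mulr1 !mul1r.
  by rewrite /dgram mulrDr !mulrA.
rewrite !unit_trace_add !ut_mul ?ut_adj ?adjF_one //; last first.
  by rewrite -[T * adj T]/(T ** adj T) adjFM adjFK.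
by rewrite rtr1 rtrCM gpow1 innerE -/(gram T); ring.
Qed.

Lemma divergence_field2 T : field_divergence b (dfield 2) T =
  (2 * beta * N + 4 - 2 * beta) * gpow 2 T + beta * gpow 1 T ^+ 2.
Proof.
rewrite field_divergence_full; last exact: dfield_linear.
set W := gram T.
have -> : dfield 2 T = fun B => 1 * B * W ^+ 2 + (T * adj B * (T * W) + (T * adj T * B * W +
    (T * W * adj B * T + T * W * adj T * B * 1))).
  apply/funext => B; rewrite /dfield !big_ord_recl big_ord0 /= !subnn !expr0 addr0 expr1 !mulr1 !mul1r.
  by rewrite /dgram -/W !(mulrDl, mulrDr) !mulrA !addrA.
have TTs : T * adj T = adj (T * adj T) by rewrite -[T * adj T]/(T ** adj T) adjFM adjFK.
have TWTs : T * W * adj T = adj (T * W * adj T).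
  by rewrite -[T * W * adj T]/(T ** W ** adj T) adjFM (adjFM T) adjFK (adj_gram T : adj W = W) mmA.
rewrite !unit_trace_add !ut_mul // ?adjF_one // !ut_adj.
have p1 : rtr (T * adj T) = gpow 1 T by rewrite rtrCM.
have p1' : rtr W = gpow 1 T by rewrite /gpow expr1.
have p2 : rtr (T * W * adj T) = gpow 2 T by rewrite rtrCM mulrA.
have i1 : inner T (T * W) = gpow 2 T by rewrite innerE -mmE mmA.
have i2 : inner (T * W) T = gpow 2 T by rewrite innerC.
rewrite i1 i2 p2 p1 p1' -/(gpow 2 T) rtr1; ring.
Qed.

Let Q_box p x : Qg p (coords b x) < 1 -> box (\dim {: M}) N x.
Proof.
move=> q1; have [s [ss sk _]] := spec_gram (coords b x).
have := powersum_le_size 0 (_ : \sum_(u <- s) u ^+ (2 * p.+1) < 1); rewrite -!sk => /(_ q1).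
by rewrite gpow1 ss; exact: coords_box.
Qed.

Lemma is_polyfun_gpow k : is_polyfun (gpow k).
Proof.
case: k => [|k]; last by eexists; exact: polyfun_Qg.
have := @is_polyfun_cst R M N; congr is_polyfun.
by apply/funext => T; rewrite gpow0.
Qed.

Local Notation I := (sublevel_integral b Qg).

Let pQ p : exists DQ, polyfun (Qg p) DQ. Proof. by eexists; exact: polyfun_Qg. Qed.

Let loop k g Dg : polyfun g Dg ->
  I (fun T => g T * (field_divergence b (dfield k) T - field_divergence b (dfield k.+1) T) +
        Dg T (gram_field k T - gram_field k.+1 T)) = 0.
Proof.
move=> pg; have pX := polymap_add (polymap_field k) (polymap_scale (-1) (polymap_field k.+1)).
have XE T : gram_field k T - gram_field k.+1 T = gram_field k T + -1 *: gram_field k.+1 T by rewrite scaleN1r.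
have h : I (fun T => g T * field_divergence b (fun v B => dfield k v B + -1 *: dfield k.+1 v B) T +
    Dg T (gram_field k T + -1 *: gram_field k.+1 T)) = 0.
  apply: (matrix_loop_equation ob polyfun_Qg _ (m := 2 * k + 1) pX pg).
  - by [].
  - by move=> T _; exact: memvf.
  - by move=> T _; rewrite -XE; exact: spec_field.
rewrite -[RHS]h; apply: eq_sublevel_integral => x _; rewrite -XE; congr (_ * _ + _).
rewrite /field_divergence -sumrB; apply: eq_bigr => i _.
by rewrite innerDr innerZr mulN1r.
Qed.

(** The loop equation for the field T - T W with the test functions 1 and tr W, and for
    the field T W - T W^2 with the test function 1, where W = T* T. The last item holds
    because the singular values are less than 1 on the domain of integration. *)
Lemma full_identities :
  [/\ beta * N ^+ 2 * I (fun=> 1) = (2 * beta * N + 2 - beta) * I (gpow 1),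
      beta * N ^+ 2 * I (gpow 1) + 2 * (I (gpow 1) - I (gpow 2)) =
        (2 * beta * N + 2 - beta) * I (fun T => gpow 1 T ^+ 2),
      (2 * beta * N + 2 - beta) * I (gpow 1) =
        (2 * beta * N + 4 - 2 * beta) * I (gpow 2) + beta * I (fun T => gpow 1 T ^+ 2) &
      0 <= I (gpow 2) <= I (gpow 1)].
Proof.
have P1 := is_polyfun_cst M (1 : R).
have Pg := is_polyfun_gpow.
have Psq : is_polyfun (fun T => gpow 1 T ^+ 2).
  have := is_polyfunM (Pg 1%N) (Pg 1%N); congr is_polyfun.
have lin2 a f c g : is_polyfun f -> is_polyfun g ->
    I (fun T => a * f T + c * g T) = a * I f + c * I g.
  by move=> pf pg; rewrite (sublevel_integralD pQ Q_box) ?(sublevel_integralZ pQ Q_box) //; exact: is_polyfunZ.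
split.
- have := loop 0 (polyfun_cst M 1).
  have -> : I (fun T => 1 * (field_divergence b (dfield 0) T - field_divergence b (dfield 1) T) + 0)
     = I (fun T => beta * N ^+ 2 * 1 + (- (2 * beta * N + 2 - beta)) * gpow 1 T).
    by apply: eq_sublevel_integral => x _; rewrite divergence_field0 divergence_field1; ring.
  by rewrite lin2 // mulNr => /eqP; rewrite subr_eq0 => /eqP.
- have := loop 0 (polyfun_Qg 0).
  have -> : I (fun T => Qg 0 T * (field_divergence b (dfield 0) T - field_divergence b (dfield 1) T)
      + DQg 0 T (gram_field 0 T - gram_field 1 T))
     = I (fun T => 1 * (beta * N ^+ 2 * gpow 1 T + (- (2 * beta * N + 2 - beta)) * gpow 1 T ^+ 2) +
         1 * (2 * gpow 1 T + (- 2) * gpow 2 T)).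
    apply: eq_sublevel_integral => x _; rewrite divergence_field0 divergence_field1 DQg_field /Qg; ring.
  have P2 a f c g : is_polyfun f -> is_polyfun g -> is_polyfun (fun T => a * f T + c * g T).
    by move=> pf pg; apply: is_polyfunD; exact: is_polyfunZ.
  rewrite lin2; [|exact: P2..]; rewrite !lin2 // => h.
  by apply/eqP; rewrite -subr_eq0; apply/eqP; rewrite -[RHS]h; ring.
- have := loop 1 (polyfun_cst M 1).
  have -> : I (fun T => 1 * (field_divergence b (dfield 1) T - field_divergence b (dfield 2) T) + 0)
     = I (fun T => 1 * ((2 * beta * N + 2 - beta) * gpow 1 T +
            (- (2 * beta * N + 4 - 2 * beta)) * gpow 2 T) + (- beta) * gpow 1 T ^+ 2).
    by apply: eq_sublevel_integral => x _; rewrite divergence_field1 divergence_field2; ring.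
  have P2 a f c g : is_polyfun f -> is_polyfun g -> is_polyfun (fun T => a * f T + c * g T).
    by move=> pf pg; apply: is_polyfunD; exact: is_polyfunZ.
  rewrite lin2; [|exact: P2|by []]; rewrite lin2 // => h.
  by apply/eqP; rewrite -subr_eq0; apply/eqP; rewrite -[RHS]h; ring.
- apply/andP; split.
    apply: Rintegral_ge0 => x _; have [s [_ -> _]] := spec_gram (coords b x).
    by apply: sumr_ge0 => u _; rewrite exprM exprn_ge0 ?sqr_ge0.
  apply: (sublevel_integral_le pQ Q_box) => // x [p q1].
  have [s [ss sk s0]] := spec_gram (coords b x).
  rewrite !sk big_seq [leRHS]big_seq; apply: ler_sum => u us.
  have : `|u| < 1 by apply: (@powersum_lt1 _ s p) => //; rewrite -sk.
  rewrite ger0_norm ?s0 // => u1; apply: ler_wiXn2l => //; [exact: s0|exact: ltW].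
Qed.

Lemma full_dim : (\dim {: M})%:R = beta * N ^+ 2.
Proof. by rewrite dim_Mat !natrM expr2 mulrC. Qed.

End basis.
End full.

(** * Self-adjoint matrices: divergences and moment identities *)

Lemma unit_trace_sum (R : realType) (F : lawfulAlg R) n I (r : seq I) (L : I -> Mat F n n -> Mat F n n) :
  unit_trace (fun B => \sum_(i <- r) L i B) = \sum_(i <- r) unit_trace (L i).
Proof.
elim: r => [|i r IH].
  rewrite big_nil /unit_trace big1 // => i _; rewrite big1 // => j _; rewrite big1 // => u _.
  by rewrite big_nil inner0r.
rewrite big_cons -IH -unit_trace_add; congr unit_trace; apply/funext => B.
by rewrite big_cons.
Qed.

Section selfadjoint_case.
Variables (R : realType) (F : lawfulAlg R) (n : nat).
Local Notation M := (Mat F n.+1 n.+1).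
Implicit Types (T B : M).
Local Notation beta := ((dimF F)%:R : R).
Local Notation N := (n.+1%:R : R).
Local Notation E := (selfadjoint F n.+1).

Definition tpow k T : R := rtr (T ^+ k).
Definition dtpow k T B : R := k.+1%:R * rtr (T ^+ k * B).
Lemma polyfun_tpow k : polyfun (tpow k.+1) (dtpow k).
Proof. exact: (polyfun_rtr_exp k (@polymap_id R M)). Qed.

Definition Qs p := tpow (2 * p + 1).+1.
Definition DQs p := dtpow (2 * p + 1).
Lemma polyfun_Qs p : polyfun (Qs p) (DQs p). Proof. exact: polyfun_tpow. Qed.

Lemma tpow0 T : tpow 0 T = N. Proof. by rewrite /tpow expr0; exact: rtr1. Qed.

Definition dpow k T B : M := \sum_(a < k) T ^+ a * B * T ^+ (k - a.+1).
Lemma polymap_pow k : polymap (fun T : M => T ^+ k) (dpow k).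
Proof. exact: (polymap_exp k (@polymap_id R M)). Qed.

Lemma dtpow_field k j T : dtpow k T (T ^+ j - T ^+ j.+2) =
  k.+1%:R * (tpow (k + j) T - tpow (k + j).+2 T).
Proof. by rewrite /dtpow mulrBr rtrB -!exprD !addnS. Qed.

Lemma spec_pow T : T = adj T -> exists s : seq R, size s = n.+1 /\
  forall k, tpow k T = \sum_(u <- s) u ^+ k.
Proof.
move=> /eigenvaluesP [_ h]; exists (eigenvalues T); split; first by rewrite size_tuple.
move=> k; have := h ('X^k); rewrite rmorphXn /= horner_algX /tpow => ->.
by apply: eq_bigr => u _; rewrite hornerXn.
Qed.

Lemma spec_sa_field j T : T = adj T -> exists s : seq R, [/\ size s = n.+1,
   forall p, Qs p T = \sum_(u <- s) u ^+ (2 * p.+1) &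
   forall p, DQs p T (T ^+ j - T ^+ j.+2) = 2 * \sum_(u <- s) tangential_term j p u].
Proof.
move=> /spec_pow [s [ss sk]]; exists s; split => // p.
  by rewrite /Qs sk; apply: eq_bigr => u _; congr (_ ^+ _); lia.
rewrite /DQs dtpow_field !sk -sumrB.
have -> : (2 * p + 1).+1%:R = 2 * p.+1%:R :> R by rewrite -natrM; congr _%:R; lia.
rewrite -mulrA; congr (2 * _); rewrite mulr_sumr; apply: eq_bigr => u _.
by rewrite /tangential_term; congr (_ * _); rewrite mulrBr mulr1 -exprD addn2.
Qed.

Section basis.
Variable b : (\dim E).-tuple M.
Hypothesis ob : orthonormal_basis b.

Let coE x : coords b x = adj (coords b x).
Proof. by apply/eqP; rewrite -mem_selfadjoint; exact: coords_mem. Qed.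

(** Each of the k occurrences of T contributes by onb_trace_selfadjoint the product of
    two traces and, with the coefficient 2 - beta, a single trace. *)
Lemma divergence_pow k T : T = adj T -> field_divergence b (dpow k) T =
  \sum_(a < k) 2^-1 * (beta * tpow a T * tpow (k - a.+1) T + (2 - beta) * tpow k.-1 T).
Proof.
move=> Ts; rewrite /field_divergence (onb_trace_selfadjoint ob); last first.
  exact: polymap_deriv_linear (polymap_pow k).
rewrite /dpow !unit_trace_sum -big_split mulr_sumr; apply: eq_bigr => a _.
congr (_ * (_ + _)); first by apply: unit_trace_mul; rewrite adjF_exp.
rewrite [LHS]unit_trace_adj innerE adjF_exp // mmE -exprD; congr (_ * rtr (_ ^+ _)).
have := ltn_ord a; lia.
Qed.

(** The dimension is the divergence of the identity field. *)
Lemma selfadjoint_dim : (\dim E)%:R = 2^-1 * (beta * N ^+ 2 + (2 - beta) * N).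
Proof.
have Ts : (0 : M) = adj 0 by rewrite linear0.
have := divergence_pow 1 Ts; rewrite big_ord_recl big_ord0 /= !tpow0 addr0 => h.
transitivity (field_divergence b (dpow 1) 0); last by rewrite h expr2 mulrA.
rewrite /field_divergence; under eq_bigr => i _.
  rewrite /dpow big_ord_recl big_ord0 !expr0 addr0 mul1r mulr1 ob.2 eqxx; over.
by rewrite sumr_const card_ord.
Qed.

Let Q_box p x : Qs p (coords b x) < 1 -> box (\dim E) N x.
Proof.
move=> q1; have [s [ss sk _]] := spec_sa_field 0 (coE x).
rewrite sk in q1; have := powersum_le_size 0 q1.
rewrite -(sk 0) [Qs 0 _](_ : _ = inner (coords b x) (coords b x)); last first.
  by rewrite /Qs /tpow expr2 innerE -coE.
by rewrite ss; exact: coords_box.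
Qed.

Lemma is_polyfun_tpow k : is_polyfun (tpow k).
Proof.
case: k => [|k]; last by eexists; exact: polyfun_tpow.
have := @is_polyfun_cst R M N; congr is_polyfun.
by apply/funext => T; rewrite tpow0.
Qed.

Local Notation I := (sublevel_integral b Qs).

Let pQ p : exists DQ, polyfun (Qs p) DQ. Proof. by eexists; exact: polyfun_Qs. Qed.

Let loop j g Dg : polyfun g Dg ->
  I (fun T => g T * (field_divergence b (dpow j) T - field_divergence b (dpow j.+2) T) +
        Dg T (T ^+ j - T ^+ j.+2)) = 0.
Proof.
move=> pg; have pX := polymap_add (polymap_pow j) (polymap_scale (-1) (polymap_pow j.+2)).
have XE T : T ^+ j - T ^+ j.+2 = T ^+ j + -1 *: T ^+ j.+2 by rewrite scaleN1r.
have sE T : T \in E -> T = adj T by rewrite mem_selfadjoint => /eqP.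
have h : I (fun T => g T * field_divergence b (fun v B => dpow j v B + -1 *: dpow j.+2 v B) T +
    Dg T (T ^+ j + -1 *: T ^+ j.+2)) = 0.
  apply: (matrix_loop_equation ob polyfun_Qs _ (m := j) pX pg).
  - by move=> T /sE Ts; rewrite /Qs /tpow expr2 innerE -Ts.
  - by move=> T /sE Ts; rewrite -XE mem_selfadjoint adjFB !adjF_exp.
  - by move=> T /sE Ts; rewrite -XE; exact: spec_sa_field.
rewrite -[RHS]h; apply: eq_sublevel_integral => x _; rewrite -XE; congr (_ * _ + _).
rewrite /field_divergence -sumrB; apply: eq_bigr => i _.
by rewrite innerDr innerZr mulN1r.
Qed.

Local Notation A := (beta * N + 2 - beta).
Local Notation a := (beta * N + 3 - 3 / 2 * beta).
Local Notation d := (2^-1 * (beta * N ^+ 2 + (2 - beta) * N)).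
Local Notation P := tpow.

Lemma divergence_pow0 x : let T := coords b x in field_divergence b (dpow 0) T = 0.
Proof. by move=> T; rewrite (divergence_pow _ (coE x)) big_ord0. Qed.
Lemma divergence_pow1 x : let T := coords b x in field_divergence b (dpow 1) T = d.
Proof. by move=> T; rewrite (divergence_pow _ (coE x)) !big_ord_recl big_ord0 /= !tpow0; ring. Qed.
Lemma divergence_pow2 x : let T := coords b x in field_divergence b (dpow 2) T = A * P 1 T.
Proof. by move=> T; rewrite (divergence_pow _ (coE x)) !big_ord_recl big_ord0 /= /bump !leq0n !add1n ?subSS ?subn0 ?subnn !tpow0 -/T; field. Qed.
Lemma divergence_pow3 x : let T := coords b x in field_divergence b (dpow 3) T =
  a * P 2 T + beta / 2 * P 1 T ^+ 2.
Proof. by move=> T; rewrite (divergence_pow _ (coE x)) !big_ord_recl big_ord0 /= /bump !leq0n !add1n ?subSS ?subn0 ?subnn !tpow0 -/T; field. Qed.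
Lemma divergence_pow5 x : let T := coords b x in field_divergence b (dpow 5) T =
  (a + 2 - beta) * P 4 T + beta * (P 1 T * P 3 T) + beta / 2 * P 2 T ^+ 2.
Proof. by move=> T; rewrite (divergence_pow _ (coE x)) !big_ord_recl big_ord0 /= /bump !leq0n !add1n ?subSS ?subn0 ?subnn !tpow0 -/T; field. Qed.

Let f0 T : R := 1.
Let q11 T := P 1 T ^+ 2.
Let q13 T := P 1 T * P 3 T.
Let q112 T := P 1 T ^+ 2 * P 2 T.
Let q22 T := P 2 T ^+ 2.
Let q1111 T := P 1 T ^+ 4.

Let PP := is_polyfun_tpow.
Let p0 : is_polyfun f0. Proof. exact: is_polyfun_cst. Qed.
Let p11 : is_polyfun q11.
Proof. exact: (is_polyfunM (PP 1) (PP 1)). Qed.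
Let p13 : is_polyfun q13. Proof. exact: (is_polyfunM (PP 1) (PP 3)). Qed.
Let p112 : is_polyfun q112. Proof. exact: (is_polyfunM p11 (PP 2)). Qed.
Let p22 : is_polyfun q22.
Proof. exact: (is_polyfunM (PP 2) (PP 2)). Qed.
Let p1111 : is_polyfun q1111.
Proof.
have := is_polyfunM p11 p11; congr is_polyfun; apply/funext => T; rewrite /q11 /q1111; ring.
Qed.

#[local] Hint Resolve PP p0 p11 p13 p112 p22 p1111 : core.

(* A list of pairs stands for a linear combination; each moment identity below is then
   obtained by naming its terms and leaving the verification to ring. *)
Let all_polyfun (l : seq (R * (M -> R))) := foldr (fun cf acc => is_polyfun cf.2 /\ acc) True l.

Let lin_polyfun l : all_polyfun l -> is_polyfun (fun T => \sum_(cf <- l) cf.1 * cf.2 T).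
Proof.
elim: l => [_|[c f] l IH /= [pf /IH pl]].
  by have := is_polyfun_cst M (0 : R); congr is_polyfun; apply/funext => T; rewrite big_nil.
have := is_polyfunD (is_polyfunZ c pf) pl; congr is_polyfun.
by apply/funext => T; rewrite big_cons.
Qed.

Let sublevel_integral_lin l : all_polyfun l ->
  I (fun T => \sum_(cf <- l) cf.1 * cf.2 T) = \sum_(cf <- l) cf.1 * I cf.2.
Proof.
elim: l => [_|[c f] l IH /= [pf pl]].
  by rewrite big_nil; under eq_fun do rewrite big_nil; rewrite /sublevel_integral Rintegral_cst ?mul0r //;
    exact: measurable_sublevel_ex.
rewrite big_cons /= -IH // -(sublevel_integralZ pQ Q_box) // -(sublevel_integralD pQ Q_box).
- by under eq_fun do rewrite big_cons.
- exact: is_polyfunZ.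
- exact: lin_polyfun.
Qed.

Let loop_lin j g Dg l : polyfun g Dg -> all_polyfun l ->
  (forall x, let T := coords b x in
    g T * (field_divergence b (dpow j) T - field_divergence b (dpow j.+2) T) +
        Dg T (T ^+ j - T ^+ j.+2) = \sum_(cf <- l) cf.1 * cf.2 T) ->
  \sum_(cf <- l) cf.1 * I cf.2 = 0.
Proof.
move=> pg pl h; rewrite -sublevel_integral_lin // -[RHS](loop j pg); apply: eq_sublevel_integral => x _; exact: esym (h x).
Qed.

Let expand := (big_cons, big_nil).

(** The loop equation for the fields T^j - T^(j + 2). For j = 0 the test functions are
    tr T, tr T tr (T^2) and tr (T^3), and these control the moments that contain traces
    of odd powers. For j = 1 they are 1, tr (T^2) and (tr T)^2, and for j = 3 only 1. *)
Lemma selfadjoint_identities :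
  [/\ N * I f0 - I (P 2) = A * I q11,
      A * I q112 = N * I (P 2) - I q22 + 2 * I q11 - 2 * I q13,
      A * I q13 = 3 * I (P 2) - 3 * I (P 4) &
      d * I f0 = a * I (P 2) + beta / 2 * I q11] /\
  [/\ d * I (P 2) - a * I q22 - beta / 2 * I q112 = - 2 * (I (P 2) - I (P 4)),
      d * I q11 - a * I q112 - beta / 2 * I q1111 = - 2 * (I q11 - I q13) &
      a * I (P 2) + beta / 2 * I q11 =
        (a + 2 - beta) * I (P 4) + beta * I q13 + beta / 2 * I q22].
Proof.
have done0 (x y z : R) : z = 0 -> x - y = z -> x = y by move=> -> /eqP; rewrite subr_eq0 => /eqP.
split; split.
- apply: done0 (@loop_lin 0 _ _ [:: (N, f0); (-1, P 2); (- A, q11)] (polyfun_tpow 0) _ _) _ => [|x T|].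
  + by rewrite /all_polyfun /=; do !split.
  + rewrite divergence_pow0 divergence_pow2 dtpow_field !expand /= !addn0 tpow0 /f0 /q11 -/T; ring.
  + rewrite !expand /=; ring.
- apply: done0 (@loop_lin 0 _ _ [:: (A, q112); (-N, P 2); (1, q22); (-2, q11); (2, q13)]
     (polyfun_scale (-1) (polyfun_mul (polyfun_tpow 0) (polyfun_tpow 1))) _ _) _ => [|x T|].
  + by rewrite /all_polyfun /=; do !split.
  + rewrite divergence_pow0 divergence_pow2 !dtpow_field !expand /= !addn0 tpow0 /q11 /q112 /q22 /q13 -/T; ring.
  + rewrite !expand /=; ring.
- apply: done0 (@loop_lin 0 _ _ [:: (A, q13); (-3, P 2); (3, P 4)]
     (polyfun_scale (-1) (polyfun_tpow 2)) _ _) _ => [|x T|].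
  + by rewrite /all_polyfun /=; do !split.
  + rewrite divergence_pow0 divergence_pow2 !dtpow_field !expand /= !addn0 /q13 -/T; ring.
  + rewrite !expand /=; ring.
- apply: done0 (@loop_lin 1 _ _ [:: (d, f0); (-a, P 2); (- (beta / 2), q11)]
     (polyfun_cst M 1) _ _) _ => [|x T|].
  + by rewrite /all_polyfun /=; do !split.
  + rewrite divergence_pow1 divergence_pow3 !expand /= /f0 /q11 -/T; ring.
  + rewrite !expand /=; ring.
- apply: done0 (@loop_lin 1 _ _ [:: (d, P 2); (-a, q22); (- (beta / 2), q112); (2, P 2); (-2, P 4)]
     (polyfun_tpow 1) _ _) _ => [|x T|].
  + by rewrite /all_polyfun /=; do !split.
  + rewrite divergence_pow1 divergence_pow3 !dtpow_field !expand /= /q22 /q112 -/T !addn1; ring.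
  + rewrite !expand /=; ring.
- apply: done0 (@loop_lin 1 _ _ [:: (d, q11); (-a, q112); (- (beta / 2), q1111); (2, q11); (-2, q13)]
     (polyfun_mul (polyfun_tpow 0) (polyfun_tpow 0)) _ _) _ => [|x T|].
  + by rewrite /all_polyfun /=; do !split.
  + rewrite divergence_pow1 divergence_pow3 !dtpow_field !expand /= /q11 /q112 /q13 /q1111 -/T !addn1; ring.
  + rewrite !expand /=; ring.
- apply: done0 (@loop_lin 3 _ _ [:: (a, P 2); (beta / 2, q11); (- (a + 2 - beta), P 4); (- beta, q13); (- (beta / 2), q22)]
     (polyfun_cst M 1) _ _) _ => [|x T|].
  + by rewrite /all_polyfun /=; do !split.
  + rewrite divergence_pow3 divergence_pow5 !expand /= /q11 /q13 /q22 -/T; ring.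
  + rewrite !expand /=; ring.
Qed.

(** This is the integral of the square of tr (T^2) - m + t delta, where delta is the
    divergence of the field T - T^3. For the best t it is the Cauchy-Schwarz inequality
    that bounds the variance of tr (T^2) from below. *)
Lemma variance_quadratic_ge0 m t :
  0 <= I q22 - 2 * m * I (P 2) + m ^+ 2 * I f0 +
    2 * t * (d * I (P 2) - a * I q22 - beta / 2 * I q112 - m * (d * I f0 - a * I (P 2) - beta / 2 * I q11)) +
    t ^+ 2 * (d ^+ 2 * I f0 + a ^+ 2 * I q22 + beta ^+ 2 / 4 * I q1111
       - 2 * a * d * I (P 2) - beta * d * I q11 + a * beta * I q112).
Proof.
pose l := [:: (1 + t ^+ 2 * a ^+ 2 - 2 * t * a, q22);
  (- (2 * m) + 2 * t * (d + m * a) - t ^+ 2 * (2 * a * d), P 2);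
  (m ^+ 2 - 2 * t * m * d + t ^+ 2 * d ^+ 2, f0);
  (- (2 * t * (beta / 2)) + t ^+ 2 * (a * beta), q112);
  (2 * t * m * (beta / 2) - t ^+ 2 * (beta * d), q11);
  (t ^+ 2 * (beta ^+ 2 / 4), q1111)].
have := @sublevel_integral_lin l; rewrite !expand /= => h.
have <- : I (fun T => \sum_(cf <- l) cf.1 * cf.2 T) = I q22 - 2 * m * I (P 2) + m ^+ 2 * I f0 +
    2 * t * (d * I (P 2) - a * I q22 - beta / 2 * I q112 - m * (d * I f0 - a * I (P 2) - beta / 2 * I q11)) +
    t ^+ 2 * (d ^+ 2 * I f0 + a ^+ 2 * I q22 + beta ^+ 2 / 4 * I q1111
       - 2 * a * d * I (P 2) - beta * d * I q11 + a * beta * I q112).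
  rewrite h; [ring|by []].
apply: Rintegral_ge0 => x _; set T := coords b x.
have -> : \sum_(cf <- l) cf.1 * cf.2 T =
    (P 2 T - m + t * (d - a * P 2 T - beta / 2 * P 1 T ^+ 2)) ^+ 2.
  by rewrite !expand /= /q22 /f0 /q112 /q11 /q1111; field.
exact: sqr_ge0.
Qed.

Lemma selfadjoint_bounds : [/\ 0 <= I (P 4), I (P 4) <= I (P 2), I (P 2) <= N * I f0 & 0 <= I q11].
Proof.
have sp x : sublevel b Qs x -> exists s : seq R, [/\ size s = n.+1,
    forall k, P k (coords b x) = \sum_(u <- s) u ^+ k & forall u, u \in s -> `|u| < 1].
  move=> [p q1]; have [s [ss sk]] := spec_pow (coE x); exists s; split=> // u us.
  apply: (@powersum_lt1 _ s p) => //; move: q1; rewrite /Qs sk.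
  by congr (_ < _); apply: eq_bigr => v _; congr (_ ^+ _); lia.
have sq u : 0 <= u ^+ 2 :> R by exact: sqr_ge0.
have e4 u : u ^+ 4 = u ^+ 2 * u ^+ 2 :> R by rewrite -exprD.
have s1 u : `|u| < 1 -> u ^+ 2 <= 1 :> R.
  by move=> u1; rewrite -real_normK ?num_real // exprn_ile1 // ltW.
split.
- apply: Rintegral_ge0 => x _; have [s [_ ->]] := spec_pow (coE x).
  by apply: sumr_ge0 => u _; rewrite e4 mulr_ge0.
- apply: (sublevel_integral_le pQ Q_box) => // x /sp [s [ss sk s0]]; rewrite !sk big_seq [leRHS]big_seq.
  by apply: ler_sum => u us; rewrite e4 ler_piMr // s1 // s0.
- rewrite -(sublevel_integralZ pQ Q_box) //; apply: (sublevel_integral_le pQ Q_box) => //; first exact: is_polyfunZ.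
  move=> x /sp [s [ss sk s0]]; rewrite sk /f0 mulr1 -ss.
  have -> : (size s)%:R = \sum_(u <- s) (1 : R) by rewrite big_const_seq count_predT iter_addr_0.
  rewrite big_seq [leRHS]big_seq; apply: ler_sum => u us; exact/s1/s0.
- by apply: Rintegral_ge0 => x _; exact: sqr_ge0.
Qed.

(** The general estimate requires matrices of size at least 2; for size 1 these
    relations close the system of moment identities. *)
Lemma selfadjoint_size1 : n = 0%N -> I q11 = I (P 2) /\ I q22 = I (P 4).
Proof.
move=> n0; split; apply: eq_sublevel_integral => x _; have [s [ss sk]] := spec_pow (coE x);
  rewrite n0 in ss; case: s ss sk => [|u [|//]] // _ sk.
  by rewrite /q11 !sk !big_seq1.
by rewrite /q22 !sk !big_seq1 -exprM.
Qed.

End basis.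
End selfadjoint_case.

(** * The boundary of the unit ball is negligible *)

Section thin_shell_reduction.
Variables (R : realType) (F : lawfulAlg R) (n : nat).
Local Notation M := (Mat F n.+1 n.+1).
Variables (E : {vspace M}) (b : (\dim E).-tuple M).
Hypothesis ob : orthonormal_basis b.
Hypothesis dE : (0 < \dim E)%N.
Local Notation d := (\dim E).
Local Notation mu := (lebesgue_tuple R d).
Local Notation co := (coords b).
Implicit Types x y : d.-tuple (measurableTypeR R).

Let A : set (d.-tuple (measurableTypeR R)) := [set x | op_norm (co x) <= 1].
Let B : set (d.-tuple (measurableTypeR R)) := [set x | op_norm (co x) < 1].

Lemma coords_scaleT r x : co (scaleT r x) = r *: co x.
Proof.
rewrite /coords scaler_sumr; apply: eq_bigr => i _.
by rewrite tnth_mktuple scalerA.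
Qed.

Let AE x : A x <-> forall k, gpow k (co x) <= n.+1%:R.
Proof. exact: op_norm_le1. Qed.
Let BE x : B x <-> exists k, gpow k (co x) < 1.
Proof. exact: op_norm_lt1. Qed.

Let mgpow k : measurable_fun setT (fun x => gpow k (co x)).
Proof. by have [D pD] := is_polyfun_gpow F n k; exact: (polyfun_tame b pD).1. Qed.

Lemma measurable_closed_op_ball : measurable A.
Proof.
have -> : A = \bigcap_k ((fun x => gpow k (co x)) @^-1` `]-oo, n.+1%:R]%classic).
  apply/seteqP; split => x.
    by move=> /AE h k _; rewrite /= in_itv /=.
  by move=> h; apply/AE => k; have := h k Logic.I; rewrite /= in_itv.
apply: bigcapT_measurable => k; rewrite -[X in measurable X]setTI.
by apply: mgpow => //; exact: measurable_itv.
Qed.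

Lemma measurable_open_op_ball : measurable B.
Proof.
have -> : B = \bigcup_k ((fun x => gpow k (co x)) @^-1` `]-oo, 1%R[%classic).
  apply/seteqP; split => x.
    by move=> /BE [k h]; exists k => //; rewrite /= in_itv.
  by move=> [k _]; rewrite /= in_itv /= => h; apply/BE; exists k.
apply: bigcupT_measurable => k; rewrite -[X in measurable X]setTI.
by apply: mgpow => //; exact: measurable_itv.
Qed.

Lemma ball_fin : (mu A < +oo)%E.
Proof.
apply: (@le_lt_trans _ _ (mu (box d n.+1%:R))); last exact: mu_box_fin.
apply: le_measure; rewrite ?inE; [exact: measurable_closed_op_ball|exact: measurable_box|].
by move=> x /AE /(_ 1%N); rewrite gpow1; exact: coords_box.
Qed.

Lemma gpowZ k s (T : M) : gpow k (s *: T) = s ^+ (2 * k) * gpow k T.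
Proof.
rewrite /gpow /gram linearZ -scalerAl -scalerAr scalerA -expr2 exprZn -exprM.
by rewrite rtrZ.
Qed.

Lemma op_norm_scale_lt1 s x : 0 <= s < 1 -> A x -> B (scaleT s x).
Proof.
move=> /andP[s0 s1] /AE h; apply/BE.
have [|//|k hk] := @expr_small R (s ^+ 2) n.+1%:R^-1; rewrite ?invr_gt0 ?ltr0n ?sqr_ge0 ?exprn_ilt1 //.
exists k; rewrite coords_scaleT gpowZ exprM.
apply: (le_lt_trans (ler_wpM2l _ (h k))); first by rewrite exprn_ge0 ?sqr_ge0.
by rewrite -ltr_pdivlMr ?ltr0n // div1r.
Qed.

Let BA : B `<=` A. Proof. by move=> x /ltW. Qed.
Let B_fin : (mu B < +oo)%E.
Proof.
apply: le_lt_trans ball_fin; apply: le_measure; rewrite ?inE //; [exact: measurable_open_op_ball|exact: measurable_closed_op_ball].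
Qed.

Lemma indic_integral (S : set (d.-tuple (measurableTypeR R))) : measurable S ->
  (\int[mu]_x (\1_S x)%:E = mu S)%E.
Proof. by move=> mS; rewrite integral_indic // setIT. Qed.

Lemma ball_scale_le s : 0 < s < 1 -> ((s ^+ d)%:E * mu A <= mu B)%E.
Proof.
move=> /andP[s0 s1]; rewrite -(indic_integral measurable_closed_op_ball) -(indic_integral measurable_open_op_ball).
have mi S : measurable S -> measurable_fun setT (fun x => (\1_S x)%:E : \bar R).
  by move=> mS; apply/measurable_EFinP; exact: measurable_indic.
have g0 (S : set (d.-tuple (measurableTypeR R))) x : (0 <= (\1_S x)%:E :> \bar R)%E.
  by rewrite lee_fin.
have H := ge0_integral_scaleT s0 (mi _ measurable_open_op_ball) (g0 B).
apply: (@le_trans _ _ ((s ^+ d)%:E * \int[mu]_x (\1_B (scaleT s x))%:E)%E); last by rewrite -H.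
apply: lee_wpmul2l; first by rewrite lee_fin exprn_ge0 // ltW.
apply: ge0_le_integral.
- exact: measurableT.
- by move=> x _; exact: g0.
- by apply: mi; exact: measurable_closed_op_ball.
- apply: (measurableT_comp (mi _ measurable_open_op_ball)); exact: measurable_scaleT.
- move=> x _; rewrite lee_fin !indicE; case: (boolP (x \in A)) => [/set_mem Ax|_]; last by rewrite ler0n.
  have Bx : B (scaleT s x) by apply: op_norm_scale_lt1 Ax; rewrite s1 ltW.
  by rewrite (mem_set Bx) lexx.
Qed.

Lemma bernoulli_inequality (e : R) k : 0 <= e <= 1 -> 1 - k%:R * e <= (1 - e) ^+ k.
Proof.
move=> /andP[e0 e1]; elim: k => [|k IH]; first by rewrite mul0r subr0 expr0.
rewrite exprS; apply: (le_trans _ (ler_wpM2l _ IH)); last by rewrite subr_ge0.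
rewrite -natr1; have : 0 <= k%:R * e * e by rewrite !mulr_ge0.
by move=> ?; nra.
Qed.

(** Scaling by s < 1 maps the closed ball A into the open ball B, so s^d mu(A) <= mu(B);
    then s tends to 1. *)
Lemma boundary_null : mu (A `\` B) = 0%E.
Proof.
have fA : mu A \is a fin_num by rewrite ge0_fin_numE // ball_fin.
have fB : mu B \is a fin_num by rewrite ge0_fin_numE // B_fin.
rewrite measureD ?ball_fin //; [|exact: measurable_closed_op_ball|exact: measurable_open_op_ball].
rewrite (_ : A `&` B = B); last by apply/seteqP; split => [x [] //|x Bx]; split => //; exact: BA.
apply/eqP; rewrite sube_eq ?fin_num_adde_defl // add0e; apply/eqP/le_anti/andP; split; last first.
  by apply: le_measure; rewrite ?inE //; [exact: measurable_open_op_ball|exact: measurable_closed_op_ball].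
rewrite -[leLHS](fineK fA) -[leRHS](fineK fB) lee_fin leNgt; apply/negP => ltBA.
set u := fine (mu A) in ltBA; set v := fine (mu B) in ltBA.
have v0 : 0 <= v by exact: fine_ge0.
have key s : 0 < s < 1 -> s ^+ d * u <= v.
  by move=> /ball_scale_le; rewrite -(fineK fA) -(fineK fB) -EFinM lee_fin.
have u0 : 0 < u by exact: le_lt_trans ltBA.
(* With this e, the Bernoulli inequality gives (1 - e)^d u >= u - d e u = (u + v) / 2,
   which exceeds v. *)
pose e := (u - v) / (2 * d%:R * u).
have d0 : 0 < d%:R :> R by rewrite ltr0n.
have d1 : 1 <= d%:R :> R by rewrite ler1n.
have e0 : 0 < e by rewrite divr_gt0 ?subr_gt0 // !mulr_gt0.
have e1 : e < 1.
  rewrite ltr_pdivrMr ?mulr_gt0 // mul1r; nra.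
have eE : d%:R * e * u = (u - v) / 2 by rewrite /e; field; rewrite !gt_eqF.
have := key (1 - e); rewrite subr_gt0 e1 gtrBl e0 => /(_ isT).
have := ler_wpM2r (ltW u0) (bernoulli_inequality d (introT andP (conj (ltW e0) (ltW e1)))).
rewrite mulrBl mul1r eE; lra.
Qed.

Lemma ball_measure_gt0 : (0 < mu A)%E.
Proof.
pose e : R := d.+1%:R^-1.
have e0 : 0 < e by rewrite invr_gt0 ltr0n.
apply: (@lt_le_trans _ _ (mu (box d e))).
  by rewrite mu_box ?ltW // lte_fin exprn_gt0 // mulr_gt0.
apply: le_measure; rewrite ?inE; [exact: measurable_box|exact: measurable_closed_op_ball|].
move=> x bx; apply: BA; apply/BE; exists 1%N; rewrite gpow1 (coords_norm ob).
apply: (@le_lt_trans _ _ (\sum_(i < d) e ^+ 2)).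
  by apply: ler_sum => i _; rewrite -real_normK ?num_real // lerXn2r ?nnegrE ?normr_ge0 ?(ltW e0) //; exact: bx.
rewrite sumr_const card_ord -mulr_natl.
have E1 : d.+1%:R * e = 1 by rewrite mulfV // pnatr_eq0.
have E2 : d.+1%:R = d%:R + 1 :> R by rewrite -natr1.
have : 0 <= d%:R :> R by [].
rewrite expr2 mulrA; nra.
Qed.

End thin_shell_reduction.

(** * The thin-shell parameter through moments on the open ball *)

Section sigma2_formula.
Variables (R : realType) (F : lawfulAlg R) (n : nat).
Local Notation M := (Mat F n.+1 n.+1).
Variables (E : {vspace M}) (b : (\dim E).-tuple M).
Hypothesis ob : orthonormal_basis b.
Hypothesis dE : (0 < \dim E)%N.
Local Notation d := (\dim E).
Local Notation mu := (lebesgue_tuple R d).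
Local Notation co := (coords b).

Let A : set (d.-tuple (measurableTypeR R)) := [set x | op_norm (co x) <= 1].
Let B : set (d.-tuple (measurableTypeR R)) := [set x | op_norm (co x) < 1].
Let v := fine (mu A).
Let r := v `^ (- d%:R^-1).

Let v_gt0 : 0 < v.
Proof. by apply: fine_gt0; rewrite (ball_measure_gt0 ob) (ball_fin ob). Qed.

Let r_gt0 : 0 < r. Proof. exact: powR_gt0. Qed.

Let rd : r ^+ d = v^-1.
Proof.
rewrite /r -powR_mulrn ?ltW // -powRrM mulNr mulVf ?pnatr_eq0 -?lt0n //.
by rewrite powRN powRr1 // ltW.
Qed.

Let hom : set (d.-tuple (measurableTypeR R)) := co @^-1` homothetic1 b (@op_ball R F n.+1 E).

Let opb : co @^-1` (@op_ball R F n.+1 E) = A.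
Proof.
apply/seteqP; split => x; first by move=> [].
by move=> Ax; split => //; exact: coords_mem.
Qed.

Let hom_scale y : hom (scaleT r y) <-> A y.
Proof.
rewrite /hom /homothetic1 /preimage /= /vol opb -/v -/r coords_scaleT; split.
  move=> [T [TE T1]] h; have rT : r *: (T - co y) = 0 by rewrite scalerBr h subrr.
  move/eqP: rT; rewrite scaler_eq0 (gt_eqF r_gt0) /= subr_eq0 => /eqP Ty; rewrite /A /= -Ty; exact: T1.
by move=> Ay; exists (co y) => //; split => //; exact: coords_mem.
Qed.

Let measurable_hom : measurable hom.
Proof.
have -> : hom = (@scaleT R d r^-1) @^-1` A.
  apply/seteqP; split => x /=.
    move=> hx; apply/hom_scale; congr hom: hx; apply: eq_from_tnth => i.
    by rewrite !tnth_mktuple mulrA mulfV ?mul1r // gt_eqF.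
  move=> /hom_scale; congr hom; apply: eq_from_tnth => i.
  by rewrite !tnth_mktuple mulrA mulfV ?mul1r // gt_eqF.
rewrite -[X in measurable X]setTI; have m := @measurable_scaleT R d r^-1. exact: (m measurableT A (measurable_closed_op_ball b)).
Qed.

Lemma fine_mul_gt0 (c : R) (X : \bar R) : 0 < c -> fine (c%:E * X) = c * fine X.
Proof.
by move=> c0; case: X => [x| |] //=; rewrite ?gt0_muley ?gt0_muleNy ?lte_fin ?mulr0.
Qed.

Lemma closed_ball_integral (f : M -> R) : (exists Df, polyfun f Df) -> (forall T, 0 <= f T) ->
  (\int[mu]_(x in A) (f (co x))%:E = \int[mu]_(x in B) (f (co x))%:E)%E.
Proof.
move=> [Df pf] f0; have mf := polyfun_measurable b pf.
have mA := measurable_closed_op_ball b; have mB := measurable_open_op_ball b.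
rewrite (ge0_negligible_integral (N := A `\` B)).
- congr (integral _ _ _); apply/seteqP; split => x; last first.
    by move=> Bx; split; [exact: ltW|case].
  by move=> [Ax nAB]; apply: contrapT => nB; apply: nAB.
- exact: measurableD.
- exact: mA.
- by apply/measurable_EFinP; exact: measurable_funTS.
- by move=> x _; rewrite lee_fin.
- exact: (boundary_null ob dE).
Qed.

(** Substitute x = r y; the Jacobian r^d equals 1 / v. *)
Lemma vol_integral_homothetic (f : M -> R) (k : nat) : (exists Df, polyfun f Df) ->
  (forall T, 0 <= f T) -> (forall T, f (r *: T) = r ^+ k * f T) ->
  vol_integral b (homothetic1 b (@op_ball R F n.+1 E)) f =
   v^-1 * r ^+ k * \int[mu]_(x in B) f (co x).
Proof.
move=> pf f0 fr; have mA := measurable_closed_op_ball b.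
have mf : measurable_fun setT (f \o co) by case: pf => Df pf; exact: (polyfun_measurable b pf).
rewrite /vol_integral -/hom /Rintegral -closed_ball_integral // -fine_mul_gt0; last first.
  by rewrite mulr_gt0 ?invr_gt0 ?exprn_gt0.
congr fine; rewrite integral_mkcond.
have mh : measurable_fun setT ((fun x => (f (co x))%:E) \_ hom : _ -> \bar R).
  apply/(measurable_restrictT _ measurable_hom).
  by apply/measurable_EFinP; exact: measurable_funTS.
rewrite (ge0_integral_scaleT r_gt0 mh); last first.
  by move=> x; rewrite patchE; case: ifP => // _; rewrite lee_fin.
rewrite rd EFinM -muleA; congr (_ * _)%E.
rewrite -ge0_integralZl //; last 3 first.
- by apply/measurable_EFinP; exact: measurable_funTS.
- by move=> x _; rewrite lee_fin.
- by rewrite lee_fin exprn_ge0 // ltW.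
rewrite [RHS]integral_mkcond; apply: eq_integral => x _; rewrite !patchE.
have -> : (scaleT r x \in hom) = (x \in A).
  by apply/idP/idP; rewrite !inE => /hom_scale.
by case: ifP => // _; rewrite coords_scaleT fr EFinM.
Qed.

(** The variance and the squared mean both scale as r^4, so that only the volume v
    remains of the normalization. The operator norm of a matrix enters only through the
    domain, and the Hilbert-Schmidt norm is the Euclidean norm. *)
Lemma sigma2E : sigma2 b = d%:R *
  (((\int[mu]_(x in B) (inner (co x) (co x) ^+ 2)) * (\int[mu]_(x in B) 1) -
    (\int[mu]_(x in B) inner (co x) (co x)) ^+ 2) / (\int[mu]_(x in B) inner (co x) (co x)) ^+ 2)
  /\ 0 < \int[mu]_(x in B) (1 : R).
Proof.
have vE : \int[mu]_(x in B) (1 : R) = v.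
  have mA := measurable_closed_op_ball b; have mB := measurable_open_op_ball b.
  have h := closed_ball_integral (ex_intro _ _ (polyfun_cst M (1 : R))) (fun=> ler01).
  by rewrite /Rintegral -h integral_cst // mul1e.
split; last by rewrite vE.
have P1 : exists Df, polyfun (fun T : M => inner T T) Df.
  by eexists; exact: (polyfun_Qg F n 0).
have P2 : exists Df, polyfun (fun T : M => inner T T ^+ 2) Df.
  by case: P1 => D1 p1; eexists; exact: (polyfun_mul p1 p1).
have hsE : (fun T : M => hs_norm T ^+ 2) = (fun T : M => inner T T).
  by apply/funext => T; rewrite hs_normE.
have hsE2 : (fun T : M => (hs_norm T ^+ 2) ^+ 2) = (fun T : M => inner T T ^+ 2).
  by apply/funext => T; rewrite hs_normE.
rewrite /sigma2 /variance_on hsE hsE2.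
rewrite (@vol_integral_homothetic (fun T => inner T T) 2) //; last 2 first.
- by move=> T; exact: inner_ge0.
- by move=> T; rewrite innerZl innerZr expr2 mulrA.
rewrite (@vol_integral_homothetic (fun T => inner T T ^+ 2) 4) //; last 2 first.
- by move=> T; exact: sqr_ge0.
- by move=> T; rewrite innerZl innerZr; ring.
rewrite vE; set K1 := \int[mu]_(x in B) inner (co x) (co x).
set K2 := \int[mu]_(x in B) _; congr (_ * _).
have [->|K0] := eqVneq K1 0; first by rewrite mulr0 expr0n /= invr0 !mulr0.
by field; rewrite K0 !gt_eqF.
Qed.
End sigma2_formula.

(** * Estimates from the moment identities *)

Section arithmetic.
Variable R : realFieldType.
Implicit Types (beta N d c m : R).

(** Eliminating I2 from the first two identities gives s = 2 (I1 - J) / I1, hence s <=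
    2. With m = I1 / I0 the third one becomes e (I1 - J) = (2 - beta + beta m) I1 + (2
    beta / c) (I1 - J). The bracket is of the order of N, as is e, whence I1 <= 8 (I1 -
    J). *)
Lemma full_estimate beta N (I0 I1 I2 J : R) :
  beta = 1 \/ beta = 2 \/ beta = 4 -> 1 <= N -> 0 < I0 ->
  beta * N ^+ 2 * I0 = (2 * beta * N + 2 - beta) * I1 ->
  beta * N ^+ 2 * I1 + 2 * (I1 - J) = (2 * beta * N + 2 - beta) * I2 ->
  (2 * beta * N + 2 - beta) * I1 = (2 * beta * N + 4 - 2 * beta) * J + beta * I2 ->
  0 <= J <= I1 ->
  let s := beta * N ^+ 2 * ((I2 * I0 - I1 ^+ 2) / I1 ^+ 2) in 4^-1 <= s /\ s <= 2.
Proof.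
move=> hb N1 I00 e1 e2 e3 /andP[J0 JI] s.
set c := 2 * beta * N + 2 - beta in e1 e2 e3.
set e := 2 * beta * N + 4 - 2 * beta in e3.
have b1 : 1 <= beta by case: hb => [->|[->|->]]; lra.
have bN : beta <= beta * N by nra.
have c0 : 0 < c by rewrite /c; nra.
have I10 : 0 < I1.
  have : 0 < c * I1 by rewrite -e1; rewrite !mulr_gt0 ?exprn_gt0 //; lra.
  by rewrite pmulr_rgt0.
have sE : s = 2 * (I1 - J) / I1.
  rewrite /s; have -> : beta * N ^+ 2 = c * I1 / I0 by rewrite -e1; field; rewrite gt_eqF.
  have E2 : c * I2 = c * I1 ^+ 2 / I0 + 2 * (I1 - J).
    rewrite -e2; have -> : c * I1 ^+ 2 / I0 = c * I1 / I0 * I1 by field; rewrite gt_eqF.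
    by rewrite -e1; field; rewrite gt_eqF.
  have -> : I2 = I1 ^+ 2 / I0 + 2 * (I1 - J) / c.
    by apply: (mulfI (lt0r_neq0 c0)); rewrite E2; field; rewrite !gt_eqF.
  by field; rewrite !gt_eqF.
split; rewrite sE; last by rewrite ler_pdivrMr //; lra.
rewrite ler_pdivlMr //; suff : I1 <= 8 * (I1 - J) by lra.
pose m := I1 / I0; have I1E : I1 = m * I0 by rewrite /m mulfVK // gt_eqF.
have mc : c * m = beta * N ^+ 2.
  by apply: (mulIf (lt0r_neq0 I00)); rewrite e1 I1E mulrA.
have m0 : 0 < m by rewrite divr_gt0.
have D0 : 0 <= I1 - J by lra.
have key : e * (I1 - J) = (2 - beta + beta * m) * I1 + 2 * beta / c * (I1 - J).
  have E2 : I2 = m * I1 + 2 / c * (I1 - J).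
    apply: (mulfI (lt0r_neq0 c0)); rewrite -e2 -mc; field; rewrite gt_eqF //.
  rewrite E2 in e3.
  have -> : e * (I1 - J) = e * I1 - e * J by ring.
  have -> : e * J = c * I1 - beta * (m * I1 + 2 / c * (I1 - J)) by rewrite e3; ring.
  have -> : e = c + 2 - beta by rewrite /e /c; ring.
  by field; rewrite gt_eqF.
have e0 : 0 < e by rewrite /e; nra.
have hm : e <= 8 * (2 - beta + beta * m).
  have h : c * e <= c * (8 * (2 - beta + beta * m)).
    have -> : c * (8 * (2 - beta + beta * m)) = 8 * ((2 - beta) * c + beta * (c * m)) by ring.
    rewrite mc /c /e; case: hb => [->|[->|->]]; nra.
  by rewrite ler_pM2l in h.
have : 0 <= 2 * beta / c * (I1 - J) by rewrite mulr_ge0 // divr_ge0 ?ltW // mulr_gt0 //; lra.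
move=> h2; have h3 : e * I1 <= e * (8 * (I1 - J)).
  have -> : e * (8 * (I1 - J)) = 8 * (e * (I1 - J)) by ring.
  rewrite key; apply: (@le_trans _ _ (8 * (2 - beta + beta * m) * I1)); last lra.
  by rewrite ler_pM2r.
by rewrite ler_pM2l in h3.
Qed.

(** In the notation of the next section the self-adjoint case gives the lower bound D^2
    / (2 N^2), and D_lower is the inequality N <= 600 D. *)
Definition lower_constant : R := (2 * 600 ^+ 2)^-1.

Lemma lower_constant_gt0 : 0 < lower_constant.
Proof.
rewrite /lower_constant; have : (0 : R) < 600 by lra.
by move: (600 : R) => K K0; rewrite invr_gt0 mulr_gt0 // exprn_gt0.
Qed.

Lemma lower_constant_le : lower_constant <= 4^-1.
Proof.
rewrite /lower_constant; have : (2 : R) <= 600 by lra.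
move: (600 : R) => K K2; have p : 4 <= 2 * K ^+ 2 by nra.
by rewrite lef_pV2 ?posrE //; lra.
Qed.

Section selfadjoint_normalized.
(* The numbers m, j, x, y, z, q, w are the means over the unit ball of tr (T^2), tr
   (T^4), (tr T)^2, tr T tr (T^3), (tr T)^2 tr (T^2), tr (T^2)^2 and (tr T)^4, and d is
   the dimension. The hypotheses h1 to h7 are the moment identities of self-adjoint
   matrices, and h8 is the quadratic inequality of variance_quadratic_ge0 around the
   mean m of tr (T^2). *)
Variables (beta N m j x y z q w : R).
Hypothesis hb : beta = 1 \/ beta = 2 \/ beta = 4.
Hypothesis hN : N = 2 \/ 3 <= N.
Let A := beta * N + 2 - beta.
Let a := beta * N + 3 - 3 / 2 * beta.
Let d := 2^-1 * (beta * N ^+ 2 + (2 - beta) * N).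
Hypotheses (h1 : N - m = A * x) (h2 : A * z = N * m - q + 2 * x - 2 * y)
  (h3 : A * y = 3 * m - 3 * j) (h4 : d = a * m + beta / 2 * x)
  (h5 : d * m - a * q - beta / 2 * z = - 2 * (m - j))
  (h6 : d * x - a * z - beta / 2 * w = - 2 * (x - y))
  (h7 : a * m + beta / 2 * x = (a + 2 - beta) * j + beta * y + beta / 2 * q)
  (h8 : forall t, 0 <= q - 2 * m * m + m ^+ 2 +
    2 * t * (d * m - a * q - beta / 2 * z - m * (d - a * m - beta / 2 * x)) +
    t ^+ 2 * (d ^+ 2 + a ^+ 2 * q + beta ^+ 2 / 4 * w - 2 * a * d * m - beta * d * x + a * beta * z))
  (j0 : 0 <= j) (jm : j <= m) (mN : m <= N) (x0 : 0 <= x).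

Let N2 : 2 <= N. Proof. by case: hN => [->|]; lra. Qed.
Let b1 : 1 <= beta. Proof. by case: hb => [->|[->|->]]; lra. Qed.
Let b4 : beta <= 4. Proof. by case: hb => [->|[->|->]]; lra. Qed.
Let bN : 2 * beta <= beta * N.
Proof. by rewrite [2 * _]mulrC ler_wpM2l // (le_trans ler01 b1). Qed.
Let A_ge : beta + 2 <= A. Proof. by move: bN; rewrite /A; lra. Qed.
Let A_gt0 : 0 < A. Proof. by move: A_ge b1; lra. Qed.
Let a_ge : 7 / 2 <= a. Proof. by move: bN b1; rewrite /a; lra. Qed.

(* h1 and h4 are two linear equations for m and x. *)
Let m_equation : (2 * A * a - beta) * m = 2 * A * d - beta * N.
Proof.
have -> : beta * N = beta * (A * x) + beta * m by rewrite -h1; ring.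
by rewrite h4; field.
Qed.

Let m_ge : N <= 4 * m.
Proof.
have Ag := A_ge; have ag := a_ge; have Ng := N2; have bg := b1; have bg4 := b4; have bNg := bN.
have Aa : (beta + 2) * (7 / 2) <= A * a by apply: ler_pM => //; lra.
have p : 0 < 2 * A * a - beta by lra.
suff : (2 * A * a - beta) * N <= (2 * A * a - beta) * (4 * m) by rewrite (ler_pM2l p).
have -> : (2 * A * a - beta) * (4 * m) = 4 * (2 * A * d - beta * N) by rewrite -m_equation; ring.
suff : 3 * beta * N <= 2 * A * (4 * d - a * N) by lra.
have -> : 4 * d - a * N = N * (beta * N + 1 - beta / 2) by rewrite /d /a; field.
have N0 : 0 <= N by lra.
have t2 : (beta + 2) * (5 / 2) <= A * (beta * N + 1 - beta / 2) by apply: ler_pM => //; lra.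
have -> : 2 * A * (N * (beta * N + 1 - beta / 2)) = 2 * (A * (beta * N + 1 - beta / 2)) * N by ring.
by apply: ler_wpM2r => //; lra.
Qed.

(* V is the variance of tr (T^2) and D is the mean of tr (T^2) - tr (T^4). *)
Let V := q - m ^+ 2.
Let D := m - j.

Let V_ge0 : 0 <= V.
Proof. by have := h8 0; rewrite /V; lra. Qed.

(* Eliminating z between h2 and h5 gives (a A - beta / 2) V = 2 A D - beta x + beta y,
   where x >= 0 and beta y <= A D. *)
Let V_upper : V <= 3 * D / (a - 2^-1).
Proof.
have e1 : (a * A - beta / 2) * V = 2 * A * D - beta * x + beta * y.
  have -> : (a * A - beta / 2) * V = A * (a * q - m * (a * m)) - beta / 2 * (q - m ^+ 2) by rewrite /V; ring.
  have -> : a * q = d * m - beta / 2 * z + 2 * (m - j).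
    transitivity (d * m - beta / 2 * z - (d * m - a * q - beta / 2 * z)); first by ring.
    by rewrite h5; ring.
  have -> : a * m = d - beta / 2 * x by rewrite h4; ring.
  have -> : A * (d * m - beta / 2 * z + 2 * (m - j) - m * (d - beta / 2 * x)) =
     beta / 2 * (m * (A * x)) - beta / 2 * (A * z) + 2 * A * D by rewrite /D; ring.
  by rewrite h2 -h1; field.
have e2 : beta * y <= A * D.
  have : beta * (A * y) <= A * (A * D).
    rewrite h3; have -> : 3 * m - 3 * j = 3 * D by rewrite /D; ring.
    have t : beta * 3 <= A * A.
      apply: (@le_trans _ _ ((beta + 2) * (beta + 2))); last by apply: ler_pM; rewrite ?A_ge // addr_ge0 // (le_trans ler01 b1).
      by move: b1 b4; nra.
    by rewrite !mulrA; apply: ler_wpM2r => //; rewrite /D subr_ge0.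
  have -> : beta * (A * y) = A * (beta * y) by ring.
  by rewrite (ler_pM2l A_gt0).
rewrite ler_pdivlMr; last by move: a_ge; lra.
have p : 0 <= beta * x by rewrite mulr_ge0 // (le_trans ler01 b1).
have e3 : A * (V * (a - 2^-1)) <= A * (3 * D).
  have : 0 <= (A - beta) * V by rewrite mulr_ge0 // subr_ge0; move: A_ge; lra.
  have -> : A * (V * (a - 2^-1)) = (a * A - beta / 2) * V - 2^-1 * ((A - beta) * V) by field.
  by rewrite e1; lra.
by move: e3; rewrite (ler_pM2l A_gt0).
Qed.

Let D_ge0 : 0 <= D. Proof. by rewrite /D subr_ge0. Qed.
Let y_ge0 : 0 <= y.
Proof.
rewrite -(pmulr_rge0 _ A_gt0) h3; have -> : 3 * m - 3 * j = 3 * D by rewrite /D; ring.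
by rewrite mulr_ge0.
Qed.

(* h7 expresses the right-hand side through m, x, V and y, and the contributions of V
   and y are nonnegative. *)
Let D_equation : (2 - beta) * m + beta / 2 * (m ^+ 2 - x) <= (a + 2 - beta) * D.
Proof.
have -> : (a + 2 - beta) * D =
    (2 - beta) * m + beta / 2 * (m ^+ 2 - x) + beta / 2 * V + beta * y.
  have -> : (a + 2 - beta) * D = a * m + (2 - beta) * m - (a + 2 - beta) * j by rewrite /D; ring.
  have -> : (a + 2 - beta) * j = a * m + beta / 2 * x - beta * y - beta / 2 * q by rewrite h7; ring.
  by rewrite /V; field.
have v0 := V_ge0; have y0 := y_ge0; have bg := b1.
have : 0 <= beta / 2 * V by rewrite mulr_ge0 // divr_ge0 //; lra.
have : 0 <= beta * y by rewrite mulr_ge0 //; lra.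
lra.
Qed.

(* By D_equation, D is at least of the order of beta m^2 / (2 a), that is, of N. For
   beta = 4 the coefficient 2 - beta is negative and the margin is thin for small N;
   the exact values m = 2 N^2 / (4 N - 1) and x = N / (2 (4 N - 1)) are used in this
   case. *)
Let D_lower : N <= 600 * D.
Proof.
have De := D_equation; have Ng := N2; have mg := m_ge; have me := m_equation; have D0 := D_ge0.
have [h12|h4'] : (beta = 1 \/ beta = 2) \/ beta = 4 by case: hb => [|[|]]; [left; left|left; right|right].
  have D1 : 25 / 512 * N ^+ 2 <= (2 * N) * D \/ N ^+ 2 / 32 <= (9 / 4 * N) * D.
    case: h12 => hbeta.
      right; have x1 : x <= 3 / 4.
        have : (N + 1) * x <= (N + 1) * (3 / 4).
          have <- : N - m = (N + 1) * x by rewrite h1 /A hbeta; ring.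
          lra.
        by rewrite ler_pM2l //; lra.
      have De1 : m + 2^-1 * (m ^+ 2 - x) <= (N + 5 / 2) * D.
        by move: De; congr (is_true (_ <= _)); rewrite /a hbeta; by field.
      have m2 : N ^+ 2 <= 16 * m ^+ 2.
        have -> : 16 * m ^+ 2 = (4 * m) ^+ 2 by ring.
        by rewrite lerXn2r ?nnegrE //; lra.
      have : (N + 5 / 2) * D <= (9 / 4 * N) * D by rewrite ler_wpM2r //; lra.
      lra.
    left; have x1 : x <= 3 / 8.
      have : (2 * N) * x <= (2 * N) * (3 / 8).
        have <- : N - m = (2 * N) * x by rewrite h1 /A hbeta; ring.
        lra.
      by rewrite ler_pM2l //; lra.
    have m7 : 7 / 16 * N <= m.
      have e : (8 * N ^+ 2 - 2) * m = 4 * N ^+ 3 - 2 * N.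
        have -> : 8 * N ^+ 2 - 2 = 2 * A * a - beta by rewrite /A /a hbeta; field.
        by rewrite me /A /d hbeta; field.
      have p : 0 < 8 * N ^+ 2 - 2 by nra.
      suff : (8 * N ^+ 2 - 2) * (7 / 16 * N) <= (8 * N ^+ 2 - 2) * m by rewrite (ler_pM2l p).
      rewrite e; nra.
    have m2 : 49 / 256 * N ^+ 2 <= m ^+ 2.
      have -> : 49 / 256 * N ^+ 2 = (7 / 16 * N) ^+ 2 by field.
      by rewrite lerXn2r ?nnegrE //; lra.
    have De1 : m ^+ 2 - x <= (2 * N) * D.
      by move: De; congr (is_true (_ <= _)); rewrite /a hbeta; by field.
    have : 4 <= N ^+ 2 by nra.
    lra.
  have N0 : 0 < N by lra.
  have : N * N <= N * (600 * D) by case: D1 => D1; nra.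
  by rewrite (ler_pM2l N0).
pose u := 4 * N - 1; have u0 : 0 < u by rewrite /u; lra.
have um : u * m = 2 * N ^+ 2.
  have p : 8 * (N - 1) != 0 by rewrite lt0r_neq0 //; lra.
  apply: (mulfI p); rewrite mulrA.
  have -> : 8 * (N - 1) * u = 2 * A * a - beta by rewrite /u /A /a h4'; field.
  by rewrite me /A /d h4'; field.
have ux : u * x = N / 2.
  have A0 : A != 0 by rewrite lt0r_neq0.
  by apply: (mulfI A0); rewrite mulrCA -h1 mulrBr um /u /A h4'; field.
have De1 : 2 * (m ^+ 2 - m - x) <= (4 * N - 5) * D.
  by move: De; congr (is_true (_ <= _)); rewrite /a h4'; by field.
have De2 : 2 * (4 * N ^+ 4 - 8 * N ^+ 3 + N / 2) <= u ^+ 2 * ((4 * N - 5) * D).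
  have -> : 2 * (4 * N ^+ 4 - 8 * N ^+ 3 + N / 2) = u ^+ 2 * (2 * (m ^+ 2 - m - x)).
    have -> : u ^+ 2 * (2 * (m ^+ 2 - m - x)) = 2 * ((u * m) ^+ 2 - u * (u * m) - u * (u * x)) by ring.
    by rewrite um ux /u; field.
  by rewrite ler_wpM2l // exprn_ge0 // ltW.
(* For N = 2 both sides are equal to 2. *)
have low : N ^+ 4 / 8 <= 2 * (4 * N ^+ 4 - 8 * N ^+ 3 + N / 2).
  case: hN => [->|N3]; first lra.
  have : 0 <= N ^+ 3 * (N - 3) by rewrite mulr_ge0 ?exprn_ge0 //; lra.
  have : 0 <= N ^+ 3 by rewrite exprn_ge0 //; lra.
  have -> : N ^+ 4 = N ^+ 3 * (N - 3) + 3 * N ^+ 3 by ring.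
  lra.
have up : u ^+ 2 * ((4 * N - 5) * D) <= 64 * N ^+ 3 * D.
  rewrite mulrA ler_wpM2r //; have -> : 64 * N ^+ 3 = (4 * N) ^+ 2 * (4 * N) by ring.
  apply: ler_pM; [by rewrite exprn_ge0 // ltW|by lra| |by lra].
  by rewrite lerXn2r ?nnegrE /u //; lra.
have N3 : 0 < N ^+ 3 by rewrite exprn_gt0 //; lra.
have : N ^+ 3 * N <= N ^+ 3 * (512 * D).
  have -> : N ^+ 3 * N = N ^+ 4 by ring.
  lra.
rewrite (ler_pM2l N3); lra.
Qed.

(** Let G be the mean of delta^2, where delta is the divergence of the field T - T^3.
    The identities give the covariance -2 D of delta and tr (T^2), hence 4 D^2 <= G V by
    h8, and G <= N (2 a + 1) <= 8 d. With D_lower this bounds d V / m^2 from below. The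
    upper bound follows from V_upper, D <= m and d <= m (a + 2). *)
Lemma selfadjoint_normalized_estimate :
  let s := d * (V / m ^+ 2) in lower_constant <= s /\ s <= 10.
Proof.
move=> s; have mNg := mN; have x0g := x0; have j0g := j0; have Ng := N2; have mg := m_ge; have D0 := D_ge0; have v0 := V_ge0; have ag := a_ge.
have bg := b1; have bg4 := b4; have bNg := bN; have Ag := A_ge; have Dl := D_lower.
have m0 : 0 < m by lra.
have Dm : D <= m by rewrite /D gerBl.
have dE : d = 2^-1 * N * (beta * N + 2 - beta) by rewrite /d; ring.
have d0 : 0 < d by rewrite dE !mulr_gt0 //; lra.
have bx : beta * x <= N.
  have : A * (beta * x) <= A * N.
    have -> : A * (beta * x) = beta * (N - m) by rewrite h1; ring.
    by apply: ler_pM => //; lra.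
  by rewrite (ler_pM2l A_gt0).
have m20 : 0 < m ^+ 2 by rewrite exprn_gt0.
have dN : N * (2 * a + 1) <= 8 * d.
  have -> : 8 * d = N * (4 * (beta * N + 2 - beta)) by rewrite dE; field.
  by rewrite ler_wpM2l //; [lra|rewrite /a; lra].
split; rewrite /s mulrA.
  have K0 : (0 : R) < 600 by lra.
  have aD : 0 < D by lra.
  have by1 : 0 <= beta * y by rewrite mulr_ge0 ?y_ge0 //; lra.
  have by0 : beta * y <= D * 3.
    have : A * (beta * y) <= A * (D * 3).
      have -> : A * (beta * y) = beta * (D * 3) by rewrite mulrCA h3 /D; ring.
      by rewrite ler_wpM2r ?mulr_ge0 //; lra.
    by rewrite (ler_pM2l A_gt0).
  pose G := 2 * a * D + beta * (x - y).
  have GE : G = 2 * a * D + beta * x - beta * y by rewrite /G; ring.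
  have aD7 : 7 * D <= 2 * a * D by rewrite ler_wpM2r //; lra.
  have bx0 : 0 <= beta * x by rewrite mulr_ge0 //; lra.
  have G0 : 0 < G by lra.
  have GV : 4 * D ^+ 2 <= G * V.
    (* The minimizer of the quadratic polynomial V - 4 D t + G t^2. *)
    have := h8 (2 * D / G).
    have -> : q - 2 * m * m + m ^+ 2 = V by rewrite /V; ring.
    have -> : d * m - a * q - beta / 2 * z - m * (d - a * m - beta / 2 * x) = - 2 * D.
      by rewrite h5 h4 /D; ring.
    have -> : d ^+ 2 + a ^+ 2 * q + beta ^+ 2 / 4 * w - 2 * a * d * m - beta * d * x + a * beta * z = G.
      transitivity (d * (d - a * m - beta / 2 * x) - a * (d * m - a * q - beta / 2 * z)
        - beta / 2 * (d * x - a * z - beta / 2 * w)); first by field.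
      by rewrite h5 h6 {2}h4 /G /D; field.
    have -> : V + 2 * (2 * D / G) * (-2 * D) + (2 * D / G) ^+ 2 * G = (G * V - 4 * D ^+ 2) / G.
      by field; rewrite gt_eqF.
    by rewrite pmulr_lge0 ?invr_gt0 // subr_ge0.
  have Gle : G <= N * (2 * a + 1).
    have : 2 * a * D <= 2 * a * N by rewrite ler_wpM2l //; lra.
    have -> : N * (2 * a + 1) = 2 * a * N + N by ring.
    lra.
  have m2 : m ^+ 2 <= N ^+ 2 by rewrite !expr2; apply: ler_pM; rewrite ?mNg // ltW.
  rewrite ler_pdivlMr // -(ler_pM2r G0).
  apply: (@le_trans _ _ (d * (4 * D ^+ 2))); last first.
    by rewrite -[leRHS]mulrA [V * G]mulrC ler_wpM2l // ltW.
  have t1 : m ^+ 2 * G <= N ^+ 2 * (8 * d).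
    by apply: ler_pM; [exact: ltW|exact: ltW|exact: m2|exact: le_trans Gle dN].
  rewrite /lower_constant; move: (600 : R) K0 Dl => K K0 Dl.
  have N2D : N ^+ 2 <= K ^+ 2 * D ^+ 2.
    have -> : K ^+ 2 * D ^+ 2 = (K * D) * (K * D) by ring.
    have N0 : 0 <= N by lra.
    by rewrite expr2; apply: ler_pM; [exact: N0|exact: N0|exact: Dl|exact: Dl].
  have t2 : N ^+ 2 * (8 * d) <= K ^+ 2 * D ^+ 2 * (8 * d).
    by rewrite ler_wpM2r //; lra.
  have K2 : 0 < 2 * K ^+ 2 by rewrite mulr_gt0 // exprn_gt0.
  rewrite -mulrA ler_pdivrMl //; apply: (le_trans (le_trans t1 t2)).
  by rewrite le_eqVlt; apply/orP; left; apply/eqP; ring.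
rewrite ler_pdivrMr //.
have a0 : 0 < a - 2^-1 by lra.
have V1 : V * (a - 2^-1) <= 3 * m.
  by have := V_upper; rewrite ler_pdivlMr //; lra.
have d1 : d <= m * (a + 2).
  have -> : d = a * m + 2^-1 * (beta * x) by rewrite h4; field.
  lra.
have : d * V * (a - 2^-1) <= 10 * m ^+ 2 * (a - 2^-1).
  have t1 : d * (V * (a - 2^-1)) <= m * (a + 2) * (3 * m).
    by apply: ler_pM => //; [exact: ltW|rewrite mulr_ge0 // ltW].
  have t2 : 0 <= m ^+ 2 * (7 * a - 11) by rewrite mulr_ge0 ?exprn_ge0 // ?ltW //; lra.
  rewrite -mulrA; apply: (le_trans t1); rewrite -subr_ge0.
  have -> : 10 * m ^+ 2 * (a - 2^-1) - m * (a + 2) * (3 * m) = m ^+ 2 * (7 * a - 11) by field.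
  exact: t2.
by rewrite (ler_pM2r a0).
Qed.

End selfadjoint_normalized.
End arithmetic.

(** * The thin-shell estimate *)

(** The normalized estimate, after division of all integrals by the volume I0. *)
Lemma selfadjoint_estimate (R : realFieldType) (beta N I0 I2 I4 I11 I13 I112 I22 I1111 : R) :
  let A := beta * N + 2 - beta in
  let a := beta * N + 3 - 3 / 2 * beta in
  let d := 2^-1 * (beta * N ^+ 2 + (2 - beta) * N) in
  beta = 1 \/ beta = 2 \/ beta = 4 -> N = 2 \/ 3 <= N -> 0 < I0 ->
  [/\ N * I0 - I2 = A * I11, A * I112 = N * I2 - I22 + 2 * I11 - 2 * I13,
      A * I13 = 3 * I2 - 3 * I4 & d * I0 = a * I2 + beta / 2 * I11] /\
  [/\ d * I2 - a * I22 - beta / 2 * I112 = - 2 * (I2 - I4),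
      d * I11 - a * I112 - beta / 2 * I1111 = - 2 * (I11 - I13) &
      a * I2 + beta / 2 * I11 = (a + 2 - beta) * I4 + beta * I13 + beta / 2 * I22] ->
  (forall m t, 0 <= I22 - 2 * m * I2 + m ^+ 2 * I0 +
    2 * t * (d * I2 - a * I22 - beta / 2 * I112 - m * (d * I0 - a * I2 - beta / 2 * I11)) +
    t ^+ 2 * (d ^+ 2 * I0 + a ^+ 2 * I22 + beta ^+ 2 / 4 * I1111
       - 2 * a * d * I2 - beta * d * I11 + a * beta * I112)) ->
  [/\ 0 <= I4, I4 <= I2, I2 <= N * I0 & 0 <= I11] ->
  let s := d * ((I22 * I0 - I2 ^+ 2) / I2 ^+ 2) in lower_constant R <= s /\ s <= 10.
Proof.
move=> A a d hb hN I00 [[h1 h2 h3 h4] [h5 h6 h7]] h8 [b1 b2 b3 b4] s.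
pose nz x := x / I0; have I0n : I0 != 0 by rewrite gt_eqF.
have nE x : x = nz x * I0 by rewrite /nz mulfVK.
rewrite (nE I2) (nE I4) (nE I11) (nE I13) (nE I112) (nE I22) (nE I1111) in h1 h2 h3 h4 h5 h6 h7 h8 b1 b2 b3 b4 *.
have cancel x y : x * I0 = y * I0 -> x = y by apply: mulIf.
have cle x y : x * I0 <= y * I0 -> x <= y by rewrite ler_pM2r.
have := @selfadjoint_normalized_estimate R beta N (nz I2) (nz I4) (nz I11) (nz I13) (nz I112) (nz I22) (nz I1111) hb hN.
rewrite -/A -/a -/d.
have -> : s = d * ((nz I22 - nz I2 ^+ 2) / nz I2 ^+ 2).
  rewrite /s; congr (_ * _); rewrite {1 2}(nE I2) {1}(nE I22).
  have [->|z] := eqVneq (nz I2) 0; first by rewrite mul0r expr0n /= invr0 !mulr0.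
  by field; rewrite z I0n.
apply.
- by apply: cancel; rewrite mulrBl h1; ring.
- by apply: cancel; rewrite -mulrA h2; ring.
- by apply: cancel; rewrite -mulrA h3; ring.
- by apply: cancel; rewrite h4; ring.
- apply: cancel; transitivity (d * (nz I2 * I0) - a * (nz I22 * I0) - beta / 2 * (nz I112 * I0)); first by ring.
  by rewrite h5; ring.
- apply: cancel; transitivity (d * (nz I11 * I0) - a * (nz I112 * I0) - beta / 2 * (nz I1111 * I0)); first by ring.
  by rewrite h6; ring.
- apply: cancel; transitivity (a * (nz I2 * I0) + beta / 2 * (nz I11 * I0)); first by ring.
  by rewrite h7; ring.
- move=> t; apply: cle; rewrite mul0r; apply: le_trans (h8 (nz I2) t) _.
  by rewrite le_eqVlt; apply/orP; left; apply/eqP; ring.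
- by apply: cle; rewrite mul0r.
- exact: cle.
- exact: cle.
- by apply: cle; rewrite mul0r.
Qed.

Section main.
Variables (R : realType) (F : lawfulAlg R) (n : nat).
Hypothesis hF : dimF F = 1%N \/ dimF F = 2%N \/ dimF F = 4%N.
Local Notation M := (Mat F n.+1 n.+1).
Local Notation beta := ((dimF F)%:R : R).
Local Notation N := (n.+1%:R : R).

Let hbeta : beta = 1 \/ beta = 2 \/ beta = 4.
Proof. by case: hF => [->|[->|->]]; [left|right; left|right; right]. Qed.

Let beta_ge1 : 1 <= beta.
Proof. by case: hbeta => [->|[->|->]]; rewrite ?lexx ?ler1n. Qed.

Lemma thin_shell_full (b : (\dim {: M}).-tuple M) : orthonormal_basis b ->
  lower_constant R <= sigma2 b /\ sigma2 b <= 10.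
Proof.
move=> ob.
have N1 : 1 <= N by rewrite ler1n.
have d0 : (0 < \dim {: M})%N.
  rewrite -(ltr0n R) full_dim mulr_gt0 ?exprn_gt0 ?ltr0n // -(ltr0n R).
  exact: lt_le_trans ltr01 beta_ge1.
have [sE I0] := sigma2E ob d0.
have setE : [set x | op_norm (coords b x) < 1] = sublevel b (@Qg R F n).
  apply/seteqP; split => x /=.
    move=> /op_norm_lt1 [[|k] hk]; last by exists k.
    by move: hk; rewrite expr0 [rtr _]rtr1 ltNge ler1n.
  by move=> [p hp]; apply/op_norm_lt1; exists p.+1.
rewrite setE in sE I0; rewrite sE full_dim.
have [e1 e2 e3 e4] := full_identities ob.
have [lo hi] := full_estimate hbeta N1 I0 e1 e2 e3 e4.
split; last by apply: (le_trans hi); rewrite ler_nat.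
exact: le_trans (lower_constant_le R) lo.
Qed.

Lemma thin_shell_selfadjoint (b : (\dim (selfadjoint F n.+1)).-tuple M) : orthonormal_basis b ->
  lower_constant R <= sigma2 b /\ sigma2 b <= 10.
Proof.
move=> ob; have bg := beta_ge1.
have N1 : 1 <= N by rewrite ler1n.
have d0 : (0 < \dim (selfadjoint F n.+1))%N.
  rewrite -(ltr0n R) (selfadjoint_dim ob) mulr_gt0 ?invr_gt0 //.
  have -> : beta * N ^+ 2 + (2 - beta) * N = N * (beta * (N - 1) + 2) by ring.
  rewrite mulr_gt0 ?ltr0n // ltr_wpDl // mulr_ge0 // subr_ge0 //.
have [sE I0] := sigma2E ob d0.
have coE x : coords b x = adj (coords b x).
  by apply/eqP; rewrite -mem_selfadjoint; exact: coords_mem.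
have gE x k : gpow k (coords b x) = tpow (2 * k) (coords b x).
  by rewrite /gpow /gram -coE -expr2 -exprM.
have setE : [set x | op_norm (coords b x) < 1] = sublevel b (@Qs R F n).
  have ix p : (2 * p.+1 = (2 * p + 1).+1)%N by rewrite mulnS addn1.
  apply/seteqP; split => x /=.
    move=> /op_norm_lt1 [[|k] hk].
      by move: hk; rewrite expr0 [rtr _]rtr1 ltNge ler1n.
    by exists k; rewrite /Qs -ix -gE.
  by move=> [p hp]; apply/op_norm_lt1; exists p.+1; rewrite -[rtr _]/(gpow p.+1 _) gE ix.
have iE x : inner (coords b x) (coords b x) = tpow 2 (coords b x) by rewrite -[LHS]gpow1 gE.
rewrite setE in sE I0; rewrite sE (selfadjoint_dim ob).
have -> : \int[lebesgue_tuple R (\dim (selfadjoint F n.+1))]_(x in sublevel b (@Qs R F n))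
    (inner (coords b x) (coords b x) ^+ 2) = sublevel_integral b (@Qs R F n) (fun T => tpow 2 T ^+ 2).
  by apply: eq_Rintegral => x _; rewrite iE.
have -> : \int[lebesgue_tuple R (\dim (selfadjoint F n.+1))]_(x in sublevel b (@Qs R F n))
    inner (coords b x) (coords b x) = sublevel_integral b (@Qs R F n) (tpow 2).
  by apply: eq_Rintegral => x _; rewrite iE.
have ids := selfadjoint_identities ob.
have [hn|hn] := eqVneq n 0%N; last first.
  apply: (selfadjoint_estimate hbeta _ I0 ids (variance_quadratic_ge0 ob) (selfadjoint_bounds ob)).
  have [->|n1] := eqVneq n 1%N; first by left.
  by right; rewrite ler_nat; case: (n) hn n1 => [|[|]].
(* For size 1 the matrix T is uniformly distributed on [-1, 1], and sigma2 = 4 / 5. *)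
have [q1 q2] := selfadjoint_size1 ob hn.
have hN : N = 1 by rewrite hn.
move: ids I0 => [[_ e2 e3 e4] [e5 _ _]]; rewrite q1 q2 hN in e2 e3 e4 e5 *.
set I2 := sublevel_integral b _ (tpow 2) in e2 e3 e4 e5 *; set I4 := sublevel_integral b _ (tpow 4) in e2 e3 e5 *.
set I112 := sublevel_integral b _ _ in e2 e5; set I13 := sublevel_integral b _ _ in e2 e3.
have -> : \int[lebesgue_tuple R (\dim (selfadjoint F n.+1))]_(x in sublevel b (@Qs R F n)) (1 : R)
  = sublevel_integral b (@Qs R F n) (fun=> 1) by [].
set I0 := sublevel_integral b _ _ in e4 *; move=> I0p.
have f4 : I0 = 3 * I2.
  transitivity (2^-1 * (beta * 1 ^+ 2 + (2 - beta) * 1) * I0); first by field.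
  by rewrite e4; field.
have f3 : 2 * I13 = 3 * I2 - 3 * I4 by rewrite -e3; ring.
have f2 : 2 * I112 = 2 * I4.
  transitivity ((beta * 1 + 2 - beta) * I112); first by ring.
  by rewrite e2 f3; ring.
have f5 : 3 * I2 = 5 * I4.
  have h : I2 - (3 - beta / 2) * I4 - beta / 2 * I112 = - 2 * (I2 - I4) by rewrite -e5; field.
  have f2' : I112 = I4 by lra.
  have : I2 - (3 - beta / 2) * I4 - beta / 2 * I112 = I2 - 3 * I4 by rewrite f2'; field.
  lra.
have I2p : 0 < I2 by lra.
have -> : 2^-1 * (beta * 1 ^+ 2 + (2 - beta) * 1) * ((I4 * I0 - I2 ^+ 2) / I2 ^+ 2) = 4 / 5.
  have -> : I4 = 3 / 5 * I2 by lra.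
  by rewrite f4; field; rewrite gt_eqF.
by split; [apply: le_trans (lower_constant_le R) _; lra|lra].
Qed.
End main.

Theorem theorem3 (R : realType) :
  exists C1 C2 : R, 0 < C1 /\
    forall (n : nat) (k : scalars)
      (E : {vspace Mat (scalar_alg R k) n n})
      (b : (\dim E).-tuple (Mat (scalar_alg R k) n n)),
      (1 <= n)%N ->
      E = fullv \/ E = selfadjoint (scalar_alg R k) n ->
      orthonormal_basis b ->
      C1 <= sigma2 b /\ sigma2 b <= C2.
Proof.
exists (lower_constant R), 10; split; first exact: lower_constant_gt0.
have main (F : lawfulAlg R) (hF : dimF F = 1%N \/ dimF F = 2%N \/ dimF F = 4%N) n
    (E : {vspace Mat F n.+1 n.+1}) (b : (\dim E).-tuple (Mat F n.+1 n.+1)) :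
    E = fullv \/ E = selfadjoint F n.+1 -> orthonormal_basis b ->
    lower_constant R <= sigma2 b /\ sigma2 b <= 10.
  case=> EE; move: b; rewrite EE => b.
    exact: thin_shell_full.
  exact: thin_shell_selfadjoint.
case=> [//|n] k E b _; case: k E b => E b.
- by apply: (main (lawful_scalars R RealScalars)); left.
- by apply: (main (lawful_scalars R ComplexScalars)); right; left.
- by apply: (main (lawful_scalars R QuaternionScalars)); right; right.
Qed.
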